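(* Let $U\in\mathcal{U}(n,m)$ and let $U=S_1\cup S_2\cup\cdots\cup S_d$ be the unique partition of $U$ into irreducible sets. Then $$C_{\mathrm{cv}}(U)=\frac{\operatorname{rg}(S_1)}{n}C_{\mathrm{cv}}(S_1)\oplus\cdots\oplus\frac{\operatorname{rg}(S_d)}{n}C_{\mathrm{cv}}(S_d),$$ and $\dim(C_{\mathrm{cv}}(U))=m-d$.
   Context: $\mathcal{U}(n,m)$ denotes the set of all matrices $U=(u_1,\dots,u_m)$ whose columns $u_i\in\mathbb{S}^{n-1}\subset\mathbb{R}^n$ are pairwise distinct unit vectors with $\operatorname{pos}U=\mathbb{R}^n$ (every vector of $\mathbb{R}^n$ is a non-negative linear combination of the $u_i$). $U$ is also identified with the set $\{u_1,\dots,u_m\}$. For $S\subseteq U$, $\operatorname{rg}(S)=\dim(\operatorname{lin}S)$. Irreducible sets: for nonempty $S\subseteq U$ let $\mathcal{L}(S)=\{T\subseteq S:1\le\operatorname{rg}(T)\le\operatorname{rg}(S)-1,\ S\cap\operatorname{lin}T=T\}$ and $\mathcal{F}(S)=\{T\in\mathcal{L}(S):\operatorname{lin}(T)\cap\operatorname{lin}(S\setminus T)=\{0\}\}$. $S$ is irreducible if $\mathcal{F}(S)=\emptyset$. Starting from $U$ and repeatedly replacing a set $S$ by $T$ and $S\setminus T$ for some $T\in\mathcal{F}(S)$, one arrives at a unique partition $U=S_1\cup\dots\cup S_d$ into irreducible sets; it satisfies $\mathbb{R}^n=\operatorname{lin}S_1\oplus\dots\oplus\operatorname{lin}S_d$ and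 $\operatorname{pos}S_j=\operatorname{lin}S_j$ for all $j$. Cone-volume sets: let $S\subseteq U$ with $\operatorname{pos}S=\operatorname{lin}S$, $k=\operatorname{rg}(S)$. For $b\in\mathbb{R}^m_{\ge0}$ let $b_S$ be the subvector of entries $b_i$ with $u_i\in S$, let $P(S,b_S)=\{x\in\operatorname{lin}S:\langle u_i,x\rangle\le b_i\text{ for all }u_i\in S\}$, and $F_S(u_i)=P(S,b_S)\cap\{x\in\operatorname{lin}S:\langle u_i,x\rangle=b_i\}$. The cone-volume vector $\gamma(S,b_S)\in\mathbb{R}^m$ has entries $\frac{b_i}{k}\operatorname{vol}_{k-1}(F_S(u_i))$ if $u_i\in S$ and $0$ if $u_i\notin S$. Then $C_{\mathrm{cv}}(S)=\{\gamma(S,b_S):b\in\mathbb{R}^m_{\ge0},\ \operatorname{vol}_k(P(S,b_S))=1\}\subset\mathbb{R}^m$. In particular this defines $C_{\mathrm{cv}}(U)$ (case $S=U$, $k=n$). $\oplus$ of sets is the Minkowski sum $\{x_1+\dots+x_d\}$ of sets lying in complementary coordinate subspaces. $\dim$ of a set is the dimension of its affine hull. *)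

(* Defs.v *)
From HB Require Import structures.
From mathcomp Require Import all_boot all_order all_algebra.
From mathcomp Require Import all_classical all_reals all_analysis.

Set Implicit Arguments.
Unset Strict Implicit.
Unset Printing Implicit Defensive.

Import Order.TTheory GRing.Theory Num.Theory.

Local Open Scope classical_set_scope.
Local Open Scope ring_scope.

Section Euclidean.
Variables (R : realType) (n : nat).
Implicit Types (x y : 'cV[R]_n) (A : set 'cV[R]_n).

Definition dotv x y : R := \sum_i x i 0 * y i 0.

Definition enorm x : R := Num.sqrt (dotv x x).

Definition affine_hull A : set 'cV[R]_n :=
  [set y | exists k (x : 'I_k -> 'cV[R]_n) (c : 'I_k -> R),
     [/\ forall i, A (x i), \sum_i c i = 1 & y = \sum_i c i *: x i]].

(* dim A = d; in particular A is nonempty. *)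
Definition has_dim A (d : nat) : Prop :=
  exists (x0 : 'cV[R]_n) (L : {vspace 'cV[R]_n}),
    \dim L = d /\ affine_hull A = [set x0 + v | v in [set v | v \in L]].

Definition scale_set (a : R) A : set 'cV[R]_n := [set a *: x | x in A].

Definition minkowski_sum (I : finType) (P : {set I})
    (A : I -> set 'cV[R]_n) : set 'cV[R]_n :=
  [set x | exists y : I -> 'cV[R]_n,
     (forall j, j \in P -> A j (y j)) /\ x = \sum_(j in P) y j].

End Euclidean.

Section Volume.
Variable R : realType.

(* Lebesgue measure on R^k, as an iterated product measure. The product
   measure [\x] is a set function defined by integrating sections; it is the
   Lebesgue measure on Borel sets, and is only meaningful there. *)
Fixpoint lebesgue_n (k : nat) : set (k.-tuple R) -> \bar R :=
  match k with
  | 0 => fun A => dirac [tuple] A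
  | k'.+1 => fun A =>
      product_measure1 (@lebesgue_measure R) (@lebesgue_n k')
        [set p : R * k'.-tuple R | A (cons_tuple p.1 p.2)]
  end.

Definition col_of_tuple (k : nat) (t : k.-tuple R) : 'cV[R]_k :=
  \col_i tnth t i.

(* [p.1 + p.2 *m y], y in R^k, is an isometric parametrization of a
   k-dimensional affine subspace containing A. *)
Definition orthonormal_chart (n k : nat) (A : set 'cV[R]_n)
    (p : 'cV[R]_n * 'M[R]_(n, k)) : Prop :=
  p.2^T *m p.2 = 1%:M /\ A `<=` [set p.1 + p.2 *m y | y in setT].

(* k-dimensional volume of a (Borel) subset A of a k-dimensional affine
   subspace of R^n: Lebesgue measure read in some orthonormal chart. The value
   does not depend on the chart; it is junk if A lies in no k-dimensional
   affine subspace. *)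
Definition vol (n k : nat) (A : set 'cV[R]_n) : \bar R :=
  let p := xget (0, 0) (@orthonormal_chart n k A) in
  @lebesgue_n k [set t | A (p.1 + p.2 *m col_of_tuple t)].

End Volume.

Section ConeVolume.
Variables (R : realType) (n m : nat).

(* The vectors u_1, ..., u_m are the columns of U. As they are pairwise
   distinct, subsets of {u_1, ..., u_m} are given by sets of indices. *)
Variable U : 'M[R]_(n, m).
Implicit Types (S T : {set 'I_m}) (P : {set {set 'I_m}}) (b : 'cV[R]_m).

Definition pos_hull S : set 'cV[R]_n :=
  [set x | exists c : 'I_m -> R,
     (forall i, 0 <= c i) /\ x = \sum_(i in S) c i *: col i U].

Definition in_Unm : Prop :=
  [/\ forall i, enorm (col i U) = 1,
      injective (fun i => col i U)
    & pos_hull [set: 'I_m]%SET = [set: 'cV[R]_n]].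

Definition lin S : {vspace 'cV[R]_n} := <<[seq col i U | i in S]>>%VS.

Definition rg S : nat := \dim (lin S).

(* L(S) *)
Definition flats S : {set {set 'I_m}} :=
  [set T : {set 'I_m} | [&& T \subset S, (1 <= rg T <= rg S - 1)%N &
     [set i in S | col i U \in lin T]%SET == T]]%SET.

(* F(S) *)
Definition splitting_flats S : {set {set 'I_m}} :=
  [set T in flats S | (lin T :&: lin (S :\: T) == 0)%VS]%SET.

Definition irreducible S : Prop := splitting_flats S = finset.set0.

(* The partitions reached from {U} by repeatedly replacing a block S by T and
   S \ T, where T is in F(S). *)
Inductive reachable : {set {set 'I_m}} -> Prop :=
| reachable_start : reachable [set [set: 'I_m]]%SET
| reachable_split P S T : reachable P -> S \in P -> T \in splitting_flats S ->
    reachable (T |: ((S :\: T) |: (P :\ S)))%SET.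

(* An arbitrary partition into irreducible sets (e.g. into singletons) is not
   enough: it has to be produced by the splitting procedure. *)
Definition irreducible_partition P : Prop :=
  reachable P /\ forall S, S \in P -> irreducible S.

Definition polytope S b : set 'cV[R]_n :=
  [set x | x \in lin S /\ forall i, i \in S -> dotv (col i U) x <= b i 0].

Definition face S b (i : 'I_m) : set 'cV[R]_n :=
  polytope S b `&` [set x | x \in lin S /\ dotv (col i U) x = b i 0].

(* The volumes below are finite when pos S = lin S, as P(S, b) is then
   bounded. *)
Definition cone_volume_vector S b : 'cV[R]_m :=
  \col_i (if i \in S
          then b i 0 / (rg S)%:R * fine (vol (rg S - 1) (face S b i))
          else 0).

Definition Ccv S : set 'cV[R]_m :=
  [set cone_volume_vector S b | b in
     [set b : 'cV[R]_m | (forall i, 0 <= b i 0) /\ vol (rg S) (polytope S b) = 1%E]].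

End ConeVolume.

(* Main.v *)
From HB Require Import structures.
Require Import Defs.
From mathcomp Require Import all_boot all_order all_algebra.
From mathcomp Require Import all_classical all_reals all_analysis.
From mathcomp Require Import measurable_realfun ring lra.

(* Lebesgue measure on columns is handled through one fact: two sigma-finite
   translation invariant measures are proportional. It gives scaling, rotation
   invariance (hence that [vol] does not depend on the chart) and, for
   independent spans [lin T] and [lin (S \ T)], a constant D with
   vol P(S, b) = D vol P(T, b) vol P(S \ T, b). Facets satisfy the same formula
   with the same D, seen by thickening them to prisms; after normalization to
   volume one D cancels, which splits [Ccv U S] along each step of the procedure.

   Write V(b) = vol P(U, b) and gamma(b) for the cone-volume vector. Cutting
   P(S, b) into the cones over its facets gives sum_i gamma_i = vol P(S, b), so
   the entries of a member of Ccv(U) have a fixed sum over each block, and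
   dim <= m - d.
   Conversely, let [a] be a linear functional that is constant on Ccv(U); after
   subtracting a constant, sum_i a_i gamma_i(b) = 0 for all b > 0. Comparing
   cones yields V(b') <= sum_i (b'_i / b_i)^n gamma_i(b), so along the torus
   action b |-> (e^(t a_i) b_i)_i the function V grows at most quadratically in
   each small step; hence V is invariant under this action. It is also invariant
   under the translations b + U^T v, so by conjugation under
   b + (e^(-j a_i) <u_i, v>)_i for all j, and by interpolation under
   b + (1_T(i) <u_i, v>)_i for every level set T of [a]. If some c >= 0 had
   sum_i c_i u_i = 0 but sum_(i in T) c_i u_i <> 0, then, for such a c of minimal
   support, these directions would allow moving b to 0 on the support of c while
   keeping V > 0, although P(U, b) then degenerates. So no such c exists, which
   says that the level sets of [a] split every block; [a] is therefore constant
   on irreducible blocks. *)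

Set Implicit Arguments.
Unset Strict Implicit.
Unset Printing Implicit Defensive.

Import Order.TTheory GRing.Theory Num.Theory.
Import numFieldNormedType.Exports.

Local Open Scope classical_set_scope.
Local Open Scope ring_scope.

(** * Lebesgue measure on column vectors *)

Section TranslationInvariantMeasures.
Context d (T : measurableType d) (R : realType).
Variables (add sub : T -> T -> T) (o : T).
Hypotheses (addKs : forall x y, sub (add x y) y = x)
  (subDs : forall x y, sub x (add y x) = sub o y)
  (addCs : commutative add)
  (madd : measurable_fun setT (fun p : T * T => add p.1 p.2))
  (msub : measurable_fun setT (fun p : T * T => sub p.1 p.2)).
Variables mu la : {sigma_finite_measure set T -> \bar R}.
Hypotheses
  (mu_inv : forall y A, measurable A -> mu [set x | A (add x y)] = mu A)
  (la_inv : forall y A, measurable A -> la [set x | A (add x y)] = la A).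

(* Evaluate [{(x, y) | x \in A, x + y \in B}] by Tonelli in both orders,
   substituting [x - y] for [x] in between. *)
Lemma translation_invariant_proportional (A B : set T) :
  measurable A -> measurable B ->
  (mu A * la B = la [set y | A (sub o y)] * mu B)%E.
Proof.
move=> mA mB.
pose E : set (T * T) := (fst @^-1` A) `&` ((fun p : T * T => add p.1 p.2) @^-1` B).
pose E' : set (T * T) := ((fun p : T * T => sub p.1 p.2) @^-1` A) `&` (fst @^-1` B).
have mE : measurable E.
  apply: measurableI; rewrite -[X in measurable X]setTI.
    exact: measurable_fst.
  exact: madd.
have mE' : measurable E'.
  apply: measurableI; rewrite -[X in measurable X]setTI.
    exact: msub.
  exact: measurable_fst.
have swapE (X : set (T * T)) : measurable X -> (mu \x la)%E X = (mu \x^ la)%E X.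
  move=> mX; apply: product_measure_unique => // C D mC mD.
  exact: product_measure2E.
have -> : (mu A * la B = (mu \x la) E)%E.
  rewrite /product_measure1 (eq_integral (fun x => (\1_A x)%:E * la B)%E); last first.
    move=> x _ /=; rewrite indicE; case: (boolP (x \in A)) => xA.
      rewrite mul1e -(la_inv x mB); congr (la _); apply/seteqP; split => y /=.
        by move=> /xsectionP[_]/=; rewrite addCs.
      by move=> h; apply/xsectionP; split => /=; [rewrite inE in xA|rewrite addCs].
    rewrite mul0e (_ : xsection _ _ = set0) ?measure0// -subset0 => y /xsectionP[/= Ax _].
    by move: xA; rewrite notin_setE.
  by rewrite ge0_integralZr ?integral_indic ?setIT//;
    apply/measurable_EFinP; exact: measurable_indic.
have -> : (la [set y | A (sub o y)] * mu B = (mu \x la) E')%E.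
  rewrite /product_measure1
    (eq_integral (fun x => la [set y | A (sub o y)] * (\1_B x)%:E)%E).
    by rewrite ge0_integralZl ?integral_indic ?setIT//;
    apply/measurable_EFinP; exact: measurable_indic.
  move=> x _ /=; rewrite indicE; case: (boolP (x \in B)) => xB.
    have mX : measurable [set y | A (sub x y)].
      rewrite (_ : mkset _ = xsection (((fun p : T * T => sub p.1 p.2) @^-1` A)) x).
        apply: measurable_xsection; rewrite -[X in measurable X]setTI; exact: msub.
      by apply/seteqP; split => y /=; [move=> ?; apply/xsectionP|move/xsectionP].
    rewrite mule1 (_ : xsection _ _ = [set y | A (sub x y)]).
      rewrite -(la_inv x mX); congr (la _); apply/seteqP; split => y /=.
        by rewrite subDs.
      by rewrite subDs.
    apply/seteqP; split => y /=.
      by move=> /xsectionP[].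
    by move=> h; apply/xsectionP; split => //=; rewrite inE in xB.
  rewrite mule0 (_ : xsection _ _ = set0) ?measure0// -subset0 => y /xsectionP[/= _ Bx].
  by move: xB; rewrite notin_setE.
rewrite !swapE// /product_measure2; apply: eq_integral => y _ /=.
rewrite -(@mu_inv y (ysection E' y)); last exact: measurable_ysection.
congr (mu _); apply/seteqP; split => x /=.
  by move=> /ysectionP[/= Ax Bx]; apply/ysectionP; split => //=; rewrite addKs.
by move=> /ysectionP[/=]; rewrite addKs => Ax Bx; apply/ysectionP.
Qed.

End TranslationInvariantMeasures.

(** * Measurable structure on column vectors *)

Section MeasurableColumn.
Variable R : realType.

(** The sigma-algebra is carried over from tuples along [col_of_tuple], so that [lebesgue_n], which
    lives on tuples, is evaluated on measurable sets only. *)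
Definition column_measurable n : set (set 'cV[R]_n) :=
  [set A | measurable (@col_of_tuple R n @^-1` A)].

Let column_measurable0 n : @column_measurable n set0.
Proof. by rewrite /column_measurable/= preimage_set0. Qed.

Let column_measurableC n A : @column_measurable n A -> column_measurable (~` A).
Proof. by rewrite /column_measurable/= preimage_setC => /measurableC. Qed.

Let column_measurable_bigcup n (F : _^nat) :
  (forall i, @column_measurable n (F i)) -> column_measurable (\bigcup_i F i).
Proof.
by rewrite /column_measurable/= preimage_bigcup; exact: bigcupT_measurable.
Qed.

HB.instance Definition _ n := @isMeasurable.Build default_measure_display
  'cV[R]_n (@column_measurable n) (@column_measurable0 n)
  (@column_measurableC n) (@column_measurable_bigcup n).

Lemma measurable_columnE n (A : set 'cV[R]_n) :
  measurable A = measurable (@col_of_tuple R n @^-1` A).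
Proof. by []. Qed.

Lemma measurable_coord n (i : 'I_n) :
  measurable_fun setT (fun x : 'cV[R]_n => x i 0).
Proof.
move=> _ Y mY; rewrite setTI measurable_columnE.
have := @measurable_tnth _ R n i measurableT Y mY; rewrite setTI.
by congr measurable; apply/seteqP; split => t /=; rewrite mxE.
Qed.

Lemma measurable_columnP d (T : measurableType d) n (f : T -> 'cV[R]_n) :
  (forall i, measurable_fun setT (fun x => f x i 0)) -> measurable_fun setT f.
Proof.
move=> mf; pose g x := [tuple f x i 0 | i < n].
have mg : measurable_fun setT g.
  apply/measurable_fun_tnthP => i; rewrite (_ : _ \o _ = fun x => f x i 0)//.
  by apply/funext => x /=; rewrite tnth_mktuple.
move=> _ Y mY; have := mg measurableT _ mY; rewrite !setTI.
congr measurable; apply/seteqP; split => x /=; congr Y.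
  by apply/matrixP => i j; rewrite mxE tnth_mktuple ord1.
by apply/matrixP => i j; rewrite mxE tnth_mktuple ord1.
Qed.

Lemma measurable_column_add n :
  measurable_fun setT (fun p : 'cV[R]_n * 'cV[R]_n => p.1 + p.2).
Proof.
apply: measurable_columnP => i.
under eq_fun do rewrite mxE.
by apply: measurable_funD; apply: (measurableT_comp (measurable_coord i)).
Qed.

Lemma measurable_column_sub n :
  measurable_fun setT (fun p : 'cV[R]_n * 'cV[R]_n => p.1 - p.2).
Proof.
apply: measurable_columnP => i.
under eq_fun do rewrite 2!mxE.
by apply: measurable_funB; apply: (measurableT_comp (measurable_coord i)).
Qed.

Lemma measurable_mulmx d (T : measurableType d) n k (M : 'M[R]_(k, n))
    (f : T -> 'cV[R]_n) :
  measurable_fun setT f -> measurable_fun setT (fun x => M *m f x).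
Proof.
move=> mf; apply: measurable_columnP => i.
under eq_fun do rewrite mxE.
apply: measurable_sum => j; apply: measurable_funM; first exact: measurable_cst.
exact: (measurableT_comp (measurable_coord j)).
Qed.

Lemma measurable_dotv n (u : 'cV[R]_n) : measurable_fun setT (fun x => dotv u x).
Proof.
apply: measurable_sum => j; apply: measurable_funM; first exact: measurable_cst.
exact: measurable_coord.
Qed.

Lemma measurable_affine k n (a : 'cV[R]_n) (M : 'M[R]_(n, k)) :
  measurable_fun setT (fun x => a + M *m x).
Proof.
apply: measurable_columnP => i; under eq_fun do rewrite mxE.
apply: measurable_funD; first exact: measurable_cst.
apply: (measurableT_comp (measurable_coord i)).
by apply: measurable_mulmx; exact: measurable_id.
Qed.

Lemma measurable_affine_preimage k n (a : 'cV[R]_n) (M : 'M[R]_(n, k)) A :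
  measurable A -> measurable [set x | A (a + M *m x)].
Proof.
by move=> mA; rewrite -[mkset _]setTI; exact: (measurable_affine a M measurableT).
Qed.

(** Peels off the first coordinate, in step with the recursion of [lebesgue_n] over [cons_tuple]. *)
Definition ccons n (s : R) (y : 'cV[R]_n) : 'cV[R]_n.+1 := col_mx s%:M y.

Definition ctail n (x : 'cV[R]_n.+1) : 'cV[R]_n := \col_i x (lift ord0 i) 0.

Lemma ccons0 n s (y : 'cV[R]_n) j : ccons s y ord0 j = s.
Proof.
transitivity ((col_mx s%:M y : 'M[R]_(1 + n, 1)) (lshift n ord0) j).
  by congr (_ _ _); exact/val_inj.
by rewrite col_mxEu !ord1 mxE.
Qed.

Lemma cconsS n s (y : 'cV[R]_n) i j : ccons s y (lift ord0 i) j = y i 0.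
Proof.
transitivity ((col_mx s%:M y : 'M[R]_(1 + n, 1)) (rshift 1 i) j).
  by congr (_ _ _); exact/val_inj.
by rewrite col_mxEd ord1.
Qed.

Lemma cconsK n (x : 'cV[R]_n.+1) : ccons (x ord0 0) (ctail x) = x.
Proof.
apply/matrixP => i j; rewrite ord1; case: (unliftP ord0 i) => [k ->|->].
  by rewrite cconsS mxE.
by rewrite ccons0.
Qed.

Lemma ctailK n s (y : 'cV[R]_n) : ctail (ccons s y) = y.
Proof. by apply/matrixP => i j; rewrite mxE cconsS ord1. Qed.

Lemma cconsD n s t (x y : 'cV[R]_n) : ccons s x + ccons t y = ccons (s + t) (x + y).
Proof.
apply/matrixP => i j; rewrite mxE ord1; case: (unliftP ord0 i) => [k ->|->].
  by rewrite !cconsS mxE.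
by rewrite !ccons0.
Qed.

Lemma mulmx_ccons k n (u : 'cV[R]_k) (Q : 'M[R]_(k, n)) s y :
  (row_mx u Q : 'M[R]_(k, n.+1)) *m ccons s y = s *: u + Q *m y.
Proof. by have := mul_row_col u Q s%:M y; rewrite mul_mx_scalar => h; exact: h. Qed.

Lemma ccons_col_of_tuple n s (t : n.-tuple R) :
  col_of_tuple (cons_tuple s t) = ccons s (col_of_tuple t).
Proof.
apply/matrixP => i j; rewrite mxE; case: (unliftP ord0 i) => [k ->|->].
  by rewrite cconsS mxE tnthS.
by rewrite ccons0.
Qed.

Lemma measurable_ccons n :
  measurable_fun setT (fun p : R * 'cV[R]_n => ccons p.1 p.2).
Proof.
apply: measurable_columnP => i; case: (unliftP ord0 i) => [k ->|->].
  under eq_fun do rewrite cconsS.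
  by apply: (measurableT_comp (measurable_coord k)).
under eq_fun do rewrite ccons0.
exact: measurable_fst.
Qed.

Lemma measurable_ctail n : measurable_fun setT (@ctail n).
Proof.
by apply: measurable_columnP => i; under eq_fun do rewrite mxE; exact: measurable_coord.
Qed.

End MeasurableColumn.

(** The measurability proofs and the left inverse [g] are arguments so that the measure and
    sigma-finiteness instances can be inferred from the term. *)
Definition image_measure d1 d2 (T1 : measurableType d1) (T2 : measurableType d2)
  (R : realType) (m : set T1 -> \bar R) (f : T1 -> T2) (g : T2 -> T1)
  (mf : measurable_fun setT f) (mg : measurable_fun setT g) (fK : cancel f g) :=
  pushforward m f.

Section ImageMeasure.
Context d1 d2 (T1 : measurableType d1) (T2 : measurableType d2) (R : realType).
Variables (m : {sigma_finite_measure set T1 -> \bar R}).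
Variables (f : T1 -> T2) (g : T2 -> T1).
Variables (mf : measurable_fun setT f) (mg : measurable_fun setT g)
  (fK : cancel f g).

Let m1 : {measure set T2 -> \bar R}.
Proof. by pose m0 : {measure set T2 -> \bar R} := pushforward m f; exact: (m0 mf). Defined.

HB.instance Definition _ := isMeasure.Build _ _ _ (image_measure m mf mg fK)
  (@measure0 _ _ _ m1) (@measure_ge0 _ _ _ m1)
  (@measure_semi_sigma_additive _ _ _ m1).

Let image_sigma_finite : sigma_finite setT (image_measure m mf mg fK).
Proof.
have /sigma_finiteP[F [TF ndF Foo]] := sigma_finiteT m.
(* As [g] is a left inverse of [f], pulling these sets back along [f] returns the sets [F n] of
   finite measure. *)
exists (fun n => g @^-1` (F n)).
  by rewrite -preimage_bigcup -TF preimage_setT.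
move=> n; have [mFn Fn] := Foo n; split.
  by rewrite -[X in measurable X]setTI; exact: mg.
rewrite /image_measure /pushforward -comp_preimage (_ : g \o f = id) ?preimage_id//.
by apply/funext => x /=; rewrite fK.
Qed.

HB.instance Definition _ := Measure_isSigmaFinite.Build _ _ _
  (image_measure m mf mg fK) image_sigma_finite.

End ImageMeasure.

Section SigmaFiniteProduct.
Local Open Scope ereal_scope.
Context d1 d2 (T1 : measurableType d1) (T2 : measurableType d2) (R : realType).
Variables (m1 : {sigma_finite_measure set T1 -> \bar R}).
Variables (m2 : {sigma_finite_measure set T2 -> \bar R}).

(* Unlike for [m1 \x m2] itself, sigma-finiteness is inferable for this copy:
   the library instance is shadowed by the one for subprobabilities. *)
Definition sigma_finite_product : set (T1 * T2) -> \bar R := m1 \x m2.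

HB.instance Definition _ := Measure.on sigma_finite_product.

Let sigma_finite_product_sigma_finite : sigma_finite setT sigma_finite_product.
Proof.
have /sigma_finiteP[F [TF ndF Foo]] := sigma_finiteT m1.
have /sigma_finiteP[G [TG ndG Goo]] := sigma_finiteT m2.
exists (fun k => F k `*` G k).
  apply/esym/seteqP; split => // -[x y] _.
  have [i _ Fi] : (\bigcup_i F i) x by rewrite -TF.
  have [j _ Gj] : (\bigcup_i G i) y by rewrite -TG.
  exists (maxn i j) => //; split => /=.
    by move: x Fi; exact/subsetPset/ndF/leq_maxl.
  by move: y Gj; exact/subsetPset/ndG/leq_maxr.
move=> k; have [mF ?] := Foo k; have [mG ?] := Goo k.
split; first exact: measurableX.
rewrite /sigma_finite_product product_measure1E//.
by rewrite lte_mul_pinfty// ge0_fin_numE.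
Qed.

HB.instance Definition _ := Measure_isSigmaFinite.Build _ _ _
  sigma_finite_product sigma_finite_product_sigma_finite.

End SigmaFiniteProduct.

Section ProductInvariance.
Context d1 d2 (T1 : measurableType d1) (T2 : measurableType d2) (R : realType).
Variables (m1 : {measure set T1 -> \bar R}).
Variables (m2 : {sigma_finite_measure set T2 -> \bar R}).
Variables (f1 : T1 -> T1) (f2 : T2 -> T2).
Hypotheses (mf1 : measurable_fun setT f1)
  (inv1 : forall A, measurable A -> m1 (f1 @^-1` A) = m1 A)
  (inv2 : forall A, measurable A -> m2 (f2 @^-1` A) = m2 A).

(** Invariance of [m2] removes [f2] from each section; the outer integral then becomes one against
    the pushforward of [m1] by [f1], which agrees with [m1]. *)
Lemma product_measure1_invariant A : measurable A ->
  (m1 \x m2)%E [set p | A (f1 p.1, f2 p.2)] = (m1 \x m2)%E A.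
Proof.
move=> mA; rewrite /product_measure1.
transitivity (\int[m1]_x (m2 \o xsection A) (f1 x))%E.
  apply: eq_integral => x _ /=; rewrite -[RHS]inv2; last exact: measurable_xsection.
  by [].
have mX := measurable_fun_xsection m2 mA.
rewrite -(@ge0_integral_pushforward _ _ _ _ _ f1 mf1 m1 setT (m2 \o xsection A)) ?preimage_setT//.
by apply: eq_measure_integral => B mB _; exact: inv1.
Qed.

End ProductInvariance.

(** * Lebesgue measure on columns and its translation invariance *)

Section ColumnLebesgue.
Variable R : realType.

Definition lam n (A : set 'cV[R]_n) : \bar R := lebesgue_n (@col_of_tuple R n @^-1` A).

Local Notation leb := (@lebesgue_measure R).

Lemma lamS n (A : set 'cV[R]_n.+1) :
  lam A = (leb \x @lam n)%E [set p | A (ccons p.1 p.2)].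
Proof.
rewrite /lam /=; apply: eq_integral => x _ /=; congr (lebesgue_n _).
apply/seteqP; split => t /=.
  by move/xsectionP => /= h; apply/xsectionP; rewrite /= -ccons_col_of_tuple.
by move/xsectionP => /= h; apply/xsectionP; rewrite /= ccons_col_of_tuple.
Qed.

Lemma lam0E (A : set 'cV[R]_0) : lam A = dirac (0 : 'cV[R]_0) A.
Proof.
rewrite /lam /= /dirac /= !indicE; congr (_%:R%:E); congr (nat_of_bool _).
by apply/idP/idP; rewrite !inE /=; congr A; apply/matrixP => -[].
Qed.

(** Induction on the dimension: a point mass, then the image under [ccons] of a product measure.
    Stating an equality of set functions lets all measure axioms be transported to [lam]. *)
Lemma lam_sigma_finite_exists n :
  exists m : {sigma_finite_measure set 'cV[R]_n -> \bar R},
  (m : set 'cV[R]_n -> \bar R) = @lam n.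
Proof.
elim: n => [|n [m mE]].
  exists (dirac (0 : 'cV[R]_0)); apply/funext => A /=; by rewrite lam0E.
pose uc (x : 'cV[R]_n.+1) : measurableTypeR R * 'cV[R]_n := (x ord0 0, ctail x).
have muc : measurable_fun setT uc.
  by apply: measurable_fun_pair; [exact: measurable_coord|exact: measurable_ctail].
pose f (p : measurableTypeR R * 'cV[R]_n) : 'cV[R]_n.+1 := ccons p.1 p.2.
have mf : measurable_fun setT f := @measurable_ccons R n.
have ucK : cancel f uc by case=> s y; rewrite /uc /f /= ccons0 ctailK.
pose mu : {sigma_finite_measure set (measurableTypeR R * 'cV[R]_n)%type -> \bar R} :=
  sigma_finite_product leb m.
pose mu' : {sigma_finite_measure set 'cV[R]_n.+1 -> \bar R} := image_measure mu mf muc ucK.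
by exists mu'; apply/funext => A; rewrite lamS -mE.
Qed.

Definition lam_measure n := projT1 (cid (@lam_sigma_finite_exists n)).
Lemma lam_measureE n : (lam_measure n : set 'cV[R]_n -> \bar R) = @lam n.
Proof. exact: (projT2 (cid (@lam_sigma_finite_exists n))). Qed.

Let lam0 n : @lam n set0 = 0%E.
Proof. by rewrite -lam_measureE measure0. Qed.
Let lam_ge0 n A : (0 <= @lam n A)%E.
Proof. by rewrite -lam_measureE measure_ge0. Qed.
Let lam_sigma_additive n : semi_sigma_additive (@lam n).
Proof. by rewrite -lam_measureE; exact: measure_semi_sigma_additive. Qed.
HB.instance Definition _ n := isMeasure.Build _ _ _ (@lam n)
  (@lam0 n) (@lam_ge0 n) (@lam_sigma_additive n).
Let lam_sigma_finite n : sigma_finite setT (@lam n).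
Proof. by rewrite -lam_measureE; exact: sigma_finiteT. Qed.
HB.instance Definition _ n := Measure_isSigmaFinite.Build _ _ _ (@lam n)
  (@lam_sigma_finite n).

(** Uniqueness of Lebesgue measure: the shifted measure has the same values on half-open
    intervals. *)
Lemma lebesgue_measure_shift (r : R) (A : set R) : measurable A ->
  leb [set x | A (x + r)] = leb A.
Proof.
move=> mA.
have mshift : measurable_fun setT ((fun x => x + r) : measurableTypeR R -> measurableTypeR R).
  by apply: measurable_funD; [exact: measurable_id|exact: measurable_cst].
pose m1 : {measure set (measurableTypeR R) -> \bar R} :=
  pushforward leb ((fun x => x + r) : measurableTypeR R -> measurableTypeR R).
apply/esym/(@lebesgue_measure_unique R (m1 mshift)) => //= _ [[a b]] _ <-.
rewrite /m1 /pushforward/= (_ : _ @^-1` _ = `]a - r, b - r]%classic); last first.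
  by apply/seteqP; split => x /=; rewrite !in_itv /= ltrBlDr lerBrDr.
rewrite !lebesgue_measure_itv/= !lte_fin ltrD2r; case: ifPn => // _.
by rewrite -!EFinB; congr EFin; ring.
Qed.

(** By [lamS] the measure is a product, and a shift acts separately on the first coordinate and on
    the tail. *)
Lemma lam_shift n (v : 'cV[R]_n) (A : set 'cV[R]_n) : measurable A ->
  lam [set x | A (x + v)] = lam A.
Proof.
elim: n v A => [|n IH] v A mA.
  by congr lam; apply/seteqP; split => x /=; congr A; apply/matrixP => -[].
rewrite !lamS; pose r := v ord0 0; pose w : 'cV[R]_n := ctail v.
have vE : ccons r w = v := cconsK v.
have mA' : measurable [set p : measurableTypeR R * 'cV[R]_n | A (ccons p.1 p.2)].
  by rewrite -[X in measurable X]setTI; exact: measurable_ccons.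
have mshift : measurable_fun setT ((fun x => x + r) : measurableTypeR R -> measurableTypeR R).
  by apply: measurable_funD; [exact: measurable_id|exact: measurable_cst].
rewrite -(@product_measure1_invariant _ _ _ _ R leb (@lam n) _ (fun y => y + w) mshift _ _ _ mA').
- congr (_ \x _)%E; apply/seteqP; split => -[s y] /=.
    by rewrite -vE cconsD.
  by rewrite -vE cconsD.
- by move=> B mB; exact: lebesgue_measure_shift.
- by move=> B mB; exact: IH.
Qed.

End ColumnLebesgue.

Section RealEReal.
Variable R : realType.

Lemma mule_fin_inj (c : R) (a b : \bar R) :
  c != 0 -> (a * c%:E = b * c%:E -> a = b)%E.
Proof.
move=> c0 h; have := congr1 (fun z => (z * c^-1%:E)%E) h.
by rewrite -!muleA -!EFinM mulfV// !mule1.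
Qed.

Lemma measurable_forall d (T : measurableType d) (I : finType) (P : I -> set T) :
  (forall i, measurable (P i)) -> measurable [set x | forall i, P i x].
Proof.
move=> mP; rewrite (_ : mkset _ = \bigcap_(i in [set: I]) P i).
  by apply: fin_bigcap_measurable => // i _; exact: mP.
by apply/seteqP; split => x /= h i; [move=> _|]; exact: h.
Qed.

Lemma measurable_le_fun d (T : measurableType d) (f g : T -> R) :
  measurable_fun setT f -> measurable_fun setT g -> measurable [set x | f x <= g x].
Proof.
move=> mf mg; rewrite (_ : mkset _ = (fun x => g x - f x) @^-1` `[0, +oo[%classic).
  by rewrite -[X in measurable X]setTI; apply: (measurable_funB mg mf).
by apply/seteqP; split => x /=; rewrite in_itv /= andbT subr_ge0.
Qed.

Lemma measurable_eq_fun d (T : measurableType d) (f g : T -> R) :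
  measurable_fun setT f -> measurable_fun setT g -> measurable [set x | f x = g x].
Proof.
move=> mf mg; rewrite (_ : mkset _ = [set x | f x <= g x] `&` [set x | g x <= f x]).
  by apply: measurableI; exact: measurable_le_fun.
by apply/seteqP; split => x /= => [->|[h1 h2]]; [|apply/eqP; rewrite eq_le h1 h2].
Qed.

End RealEReal.

(** * Scaling, rotation and product formulas *)

Section LamInvariance.
Variable R : realType.
Local Notation leb := (@lebesgue_measure R).

(** Cubes are the reference sets of known measure: they fix constants of proportionality and bound
    other volumes. *)
Definition cube n (r : R) : set 'cV[R]_n := [set x | forall i, `|x i 0| <= r].

Lemma measurable_cube n r : measurable (@cube n r).
Proof.
apply: measurable_forall => i; apply: measurable_le_fun; last exact: measurable_cst.
by apply: measurableT_comp => //; exact: measurable_coord.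
Qed.

Lemma lam_cube n r : 0 <= r -> lam (@cube n r) = ((r *+ 2) ^+ n)%:E.
Proof.
move=> r0; elim: n => [|n IH].
  by rewrite lam0E /dirac indicE mem_set ?expr0// => -[].
rewrite lamS (_ : mkset _ = (`[- r, r]%classic : set (measurableTypeR R)) `*` @cube n r).
  rewrite product_measure1E//=; [|exact: measurable_cube].
  rewrite IH lebesgue_measure_itv /= lte_fin exprS EFinM; congr (_ * _)%E.
  case: ifPn => [_|]; first by rewrite -EFinB opprK.
  by rewrite -leNgt => h; rewrite (_ : r = 0) ?mul0rn//; lra.
apply/seteqP; split => -[s y] /=.
  move=> h; split.
    by have := h ord0; rewrite ccons0 in_itv /= ler_norml.
  by move=> i; have := h (lift ord0 i); rewrite cconsS.
rewrite in_itv /= -ler_norml => -[hs hy] i; case: (unliftP ord0 i) => [k ->|->].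
  by rewrite cconsS.
by rewrite ccons0.
Qed.

Lemma preimage_mulmx_measurable n k (M : 'M[R]_(k, n)) (A : set 'cV[R]_k) :
  measurable A -> measurable [set x | A (M *m x)].
Proof.
move=> mA; rewrite -[mkset _]setTI.
by apply: (measurable_mulmx M (@measurable_id _ _ setT)).
Qed.

Lemma pow2_neq0 n : (2 ^+ n : R) != 0.
Proof. by rewrite expf_neq0 ?pnatr_eq0. Qed.

(** The general identity carries a reflected [A] on the right. Applied to [lam] itself and the unit
    cube, it shows that [lam] is invariant under reflection, which removes the reflection. *)
Lemma lam_proportional n (mu : {sigma_finite_measure set 'cV[R]_n -> \bar R})
    (A B : set 'cV[R]_n) :
  (forall (v : 'cV[R]_n) (A : set 'cV[R]_n), measurable A -> mu [set x | A (x + v)] = mu A) ->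
  measurable A -> measurable B -> (mu A * lam B = lam A * mu B)%E.
Proof.
move=> mu_inv mA mB.
have prop (m : {sigma_finite_measure set 'cV[R]_n -> \bar R})
    (X Y : set 'cV[R]_n) :
  (forall (v : 'cV[R]_n) (A : set 'cV[R]_n), measurable A -> m [set x | A (x + v)] = m A) ->
  measurable X -> measurable Y -> (m X * lam Y = lam [set x | X (- x)%R] * m Y)%E.
  move=> m_inv mX mY.
  have := @translation_invariant_proportional _ _ R (fun x y : 'cV[R]_n => x + y)
    (fun x y => x - y) 0 _ _ _ (@measurable_column_add R n)
    (@measurable_column_sub R n) m (@lam R n) m_inv (@lam_shift R n) X Y mX mY.
  move=> -> //; last 3 first.
  - by move=> x y; rewrite addrK.
  - by move=> x y; rewrite opprD addrC subrK sub0r.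
  - exact: addrC.
  by congr (lam _ * _)%E; apply/seteqP; split => x /=; rewrite sub0r.
rewrite prop//; congr (_ * _)%E.
have := prop (@lam R n) A (cube 1) (@lam_shift R n) mA (measurable_cube 1).
by rewrite /= !lam_cube// => h; apply/esym/(mule_fin_inj (pow2_neq0 n)).
Qed.

(** The image of [lam] under scaling is again translation invariant, hence proportional to [lam];
    the unit cube gives the factor. *)
Lemma lam_scale n (r : R) (A : set 'cV[R]_n) : 0 < r -> measurable A ->
  lam [set x | A (r *: x)] = ((r^-1 ^+ n)%:E * lam A)%E.
Proof.
move=> r0 mA.
have mscale (c : R) : measurable_fun setT (fun x : 'cV[R]_n => c *: x).
  apply: measurable_columnP => i; under eq_fun do rewrite mxE.
  by apply: measurable_funM; [exact: measurable_cst|exact: measurable_coord].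
have scK : cancel (fun x : 'cV[R]_n => r *: x) (fun x => r^-1 *: x).
  by move=> x; rewrite scalerA mulVf ?gt_eqF// scale1r.
pose mu : {sigma_finite_measure set 'cV[R]_n -> \bar R} :=
  image_measure (@lam R n) (mscale r) (mscale r^-1) scK.
have := @lam_proportional n mu A (cube 1) _ mA (measurable_cube 1).
rewrite lam_cube// (_ : mu (cube 1) = ((r^-1 *+ 2) ^+ n)%:E); last first.
  rewrite -lam_cube ?invr_ge0 ?ltW//; congr lam; apply/seteqP; split => x /= h i.
    by have := h i; rewrite mxE normrM gtr0_norm// mulrC -ler_pdivlMr// mul1r.
  by have := h i; rewrite mxE normrM (gtr0_norm r0) mulrC -ler_pdivlMr// mul1r.
rewrite -[r^-1 *+ 2]mulr_natr exprMn EFinM muleA => h.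
rewrite muleC; apply: (mule_fin_inj (@pow2_neq0 n)); apply: h.
move=> v B mB; rewrite /mu /= /image_measure /pushforward.
rewrite -[RHS](lam_shift (r^-1 *: v)); last first.
  by rewrite -[X in measurable X]setTI; apply: (mscale r measurableT).
congr lam; apply/seteqP; split => x /=; rewrite scalerDr scalerA mulfV ?gt_eqF// scale1r//.
Qed.

Lemma dotvE n (x y : 'cV[R]_n) : dotv x y = (x^T *m y) 0 0.
Proof. by rewrite mxE; apply: eq_bigr => i _; rewrite mxE. Qed.

Lemma dotv_mulmx n k (M : 'M[R]_(n, k)) x y : dotv x (M *m y) = dotv (M^T *m x) y.
Proof. by rewrite !dotvE trmx_mul trmxK mulmxA. Qed.

(** Here the factor is read off the unit ball, which [M] preserves. The ball lies between two cubes,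
    so its measure is finite and positive and can be cancelled. *)
Lemma lam_orthogonal n (M : 'M[R]_n) (A : set 'cV[R]_n) : M^T *m M = 1%:M -> measurable A ->
  lam [set x | A (M *m x)] = lam A.
Proof.
move=> MtM mA; have MMt := mulmx1C MtM.
have mmul (N : 'M[R]_n) : measurable_fun setT (fun x : 'cV[R]_n => N *m x).
  exact: (measurable_mulmx N (@measurable_id _ _ setT)).
have MK : cancel (fun x : 'cV[R]_n => M *m x) (fun x => M^T *m x).
  by move=> x; rewrite mulmxA MtM mul1mx.
pose mu : {sigma_finite_measure set 'cV[R]_n -> \bar R} :=
  image_measure (@lam R n) (mmul M) (mmul M^T) MK.
pose B : set 'cV[R]_n := [set x | dotv x x <= 1].
have mB : measurable B.
  apply: measurable_le_fun; last exact: measurable_cst.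
  by apply: measurable_sum => i; apply: measurable_funM; exact: measurable_coord.
have muB : mu B = lam B.
  congr lam; apply/seteqP; split => x; rewrite /B /=.
    by rewrite dotv_mulmx mulmxA MtM mul1mx.
  by rewrite dotv_mulmx mulmxA MtM mul1mx.
have Bfin : (lam B \is a fin_num).
  rewrite ge0_fin_numE//; apply: (@le_lt_trans _ _ (lam (cube 1 : set 'cV[R]_n))).
    apply: le_measure; rewrite ?inE//; first exact: measurable_cube.
    move=> x; rewrite /B /= => Bx i; have : x i 0 * x i 0 <= 1.
      apply: le_trans Bx; rewrite /dotv (bigD1 i)//= lerDl sumr_ge0// => j _.
      by rewrite -expr2 sqr_ge0.
    by move=> xi; rewrite ler_norml; apply/andP; split; nra.
  by rewrite lam_cube// ltry.
have Bpos : (0 < lam B)%E.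
  apply: (@lt_le_trans _ _ (lam (cube n.+1%:R^-1 : set 'cV[R]_n))).
    by rewrite lam_cube ?invr_ge0// lte_fin exprn_gt0// -mulr_natr mulr_gt0 ?invr_gt0.
  apply: le_measure; rewrite ?inE//; first exact: measurable_cube.
  move=> x hx; rewrite /B /= /dotv.
  apply: (@le_trans _ _ (\sum_(i < n) n.+1%:R^-1)).
    apply: ler_sum => i _; have /ler_normlP[h1 h2] := hx i.
    have r0 : 0 <= n.+1%:R^-1 :> R by rewrite invr_ge0.
    have r1 : n.+1%:R^-1 <= 1 :> R by rewrite invf_le1// ler1n.
    move: h1 h2 r0 r1; move: (n.+1%:R^-1) (x i 0) => a z h1 h2 r0 r1; nra.
  rewrite sumr_const card_ord -[_ *+ n]mulr_natl ler_pdivrMr// mul1r.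
  by rewrite ler_nat.
have := @lam_proportional n mu A B _ mA mB; rewrite muB -[lam B]fineK// => h.
apply: (@mule_fin_inj _ (fine (lam B))); last apply: h.
  by rewrite gt_eqF// fine_gt0// Bpos -ge0_fin_numE.
move=> v X mX; rewrite /mu /= /image_measure /pushforward.
rewrite -[RHS](lam_shift (M^T *m v)); last first.
  by rewrite -[X in measurable X]setTI; apply: (mmul M measurableT).
by congr lam; apply/seteqP; split => x /=; rewrite mulmxDr mulmxA MMt mul1mx.
Qed.

(* [D] is the inverse of the absolute determinant of [col_mx M1 M2]. *)
Lemma lam_product k k1 k2 (M1 : 'M[R]_(k1, k)) (M2 : 'M[R]_(k2, k))
    (N1 : 'M[R]_(k, k1)) (N2 : 'M[R]_(k, k2)) :
  N1 *m M1 + N2 *m M2 = 1%:M -> M1 *m N1 = 1%:M -> M2 *m N2 = 1%:M ->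
  M1 *m N2 = 0 -> M2 *m N1 = 0 ->
  exists2 D : R, 0 < D & forall (A : set 'cV[R]_k1) (B : set 'cV[R]_k2),
    measurable A -> measurable B ->
    lam [set x | A (M1 *m x) /\ B (M2 *m x)] = (D%:E * (lam A * lam B))%E.
Proof.
move=> NM MN1 MN2 M12 M21.
pose f (x : 'cV[R]_k) := (M1 *m x, M2 *m x).
pose g (p : 'cV[R]_k1 * 'cV[R]_k2) := N1 *m p.1 + N2 *m p.2.
have mf : measurable_fun setT f.
  by apply: measurable_fun_pair; apply: (measurable_mulmx _ (@measurable_id _ _ setT)).
have mg : measurable_fun setT g.
  apply: measurable_columnP => i; under eq_fun do rewrite mxE.
  apply: measurable_funD.
    by apply: (measurableT_comp (measurable_coord i)); exact: measurable_mulmx.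
  by apply: (measurableT_comp (measurable_coord i)); exact: measurable_mulmx.
have fK : cancel f g by move=> x; rewrite /g /= !mulmxA -mulmxDl NM mul1mx.
have gK : cancel g f.
  move=> [x y]; rewrite /f /g /= !mulmxDr !mulmxA MN1 MN2 M12 M21.
  by rewrite !mul1mx !mul0mx addr0 add0r.
pose mu : {sigma_finite_measure set ('cV[R]_k1 * 'cV[R]_k2)%type -> \bar R} :=
  image_measure (@lam R k) mf mg fK.
pose la : {sigma_finite_measure set ('cV[R]_k1 * 'cV[R]_k2)%type -> \bar R} :=
  sigma_finite_product (@lam R k1) (@lam R k2).
have mu_inv (v : ('cV[R]_k1 * 'cV[R]_k2)%type) (X : set ('cV[R]_k1 * 'cV[R]_k2)%type) :
    measurable X -> mu [set x | X (x + v)] = mu X.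
  move=> mX; rewrite /mu /= /image_measure /pushforward.
  rewrite -[RHS](lam_shift (g v)); last first.
    by rewrite -[X in measurable X]setTI; apply: (mf measurableT).
  have fD x : f (x + g v) = f x + v.
    by rewrite -[v in RHS]gK /f !mulmxDr.
  by congr lam; apply/seteqP; split => x /=; rewrite fD.
have la_inv (v : ('cV[R]_k1 * 'cV[R]_k2)%type) (X : set ('cV[R]_k1 * 'cV[R]_k2)%type) :
    measurable X -> la [set x | X (x + v)] = la X.
  move=> mX; rewrite /la /= /sigma_finite_product.
  rewrite -(@product_measure1_invariant _ _ _ _ R (@lam R k1) (@lam R k2)
    (fun x => x + v.1) (fun x => x + v.2) _ _ _ X mX).
  - by congr (_ \x _)%E; apply/seteqP; split => -[x y].
  - apply: measurable_columnP => i; under eq_fun do rewrite mxE.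
    by apply: measurable_funD; [exact: measurable_coord|exact: measurable_cst].
  - by move=> B mB; exact: lam_shift.
  - by move=> B mB; exact: lam_shift.
have prop (X Y : set ('cV[R]_k1 * 'cV[R]_k2)%type) : measurable X -> measurable Y ->
    (mu X * la Y = la [set x | X (- x)%R] * mu Y)%E.
  have madd : measurable_fun setT
      (fun p : ('cV[R]_k1 * 'cV[R]_k2) * ('cV[R]_k1 * 'cV[R]_k2) => p.1 + p.2).
    by apply: measurable_fun_pair; apply: measurable_columnP => i;
      under eq_fun do rewrite mxE; apply: measurable_funD;
      apply: (measurableT_comp (measurable_coord i)); exact: measurableT_comp.
  have msub : measurable_fun setT
      (fun p : ('cV[R]_k1 * 'cV[R]_k2) * ('cV[R]_k1 * 'cV[R]_k2) => p.1 - p.2).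
    by apply: measurable_fun_pair; apply: measurable_columnP => i;
      under eq_fun do rewrite 2!mxE; apply: measurable_funB;
      apply: (measurableT_comp (measurable_coord i)); exact: measurableT_comp.
  move=> mX mY.
  have := @translation_invariant_proportional _ _ R (fun x y : 'cV[R]_k1 * 'cV[R]_k2 => x + y)
    (fun x y => x - y) 0 _ _ _ madd msub mu la mu_inv la_inv X Y mX mY.
  move=> -> //; last 3 first.
  - by move=> x y; rewrite addrK.
  - by move=> x y; rewrite opprD addrC subrK sub0r.
  - exact: addrC.
  by congr (la _ * _)%E; apply/seteqP; split => x /=; rewrite sub0r.
pose C : set ('cV[R]_k1 * 'cV[R]_k2)%type := cube 1 `*` cube 1.
have mC : measurable C by apply: measurableX; exact: measurable_cube.
pose c : R := 2 ^+ k1 * 2 ^+ k2.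
have laX (A : set 'cV[R]_k1) (B : set 'cV[R]_k2) : measurable A -> measurable B ->
    la (A `*` B) = (lam A * lam B)%E.
  by move=> mA mB; rewrite /la /= /sigma_finite_product product_measure1E.
have laC : la C = c%:E.
  by rewrite laX ?lam_cube//; exact: measurable_cube.
have c0 : 0 < c by rewrite mulr_gt0// exprn_gt0.
(* [X0] has known measure under [mu], since its preimage under [f] is the unit cube. The identity
   for [X0] and [C] has a finite positive left side, which rules out both 0 and infinity for
   [mu C]. *)
have [D0 D0p muC] : exists2 D0 : R, 0 < D0 & mu C = D0%:E.
  pose X0 : set ('cV[R]_k1 * 'cV[R]_k2)%type := g @^-1` cube 1.
  have mX0 : measurable X0.
    by rewrite -[X in measurable X]setTI; apply: (mg measurableT); exact: measurable_cube.
  have muX0 : mu X0 = (2 ^+ k)%:E.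
    rewrite -(@lam_cube k 1)//; congr lam; apply/seteqP; split => x /=.
      by rewrite /X0 /= fK.
    by rewrite /X0 /= fK.
  have := prop X0 C mX0 mC; rewrite muX0 laC.
  have : (0 <= mu C)%E by exact: measure_ge0.
  case: (mu C) => [r|//|//].
  - rewrite lee_fin le_eqVlt => /orP[/eqP <-|r0 _]; last by exists r.
    move=> /esym/eqP; rewrite mule0 eq_sym -EFinM eqe => /eqP h; exfalso.
    by have := lt0r_neq0 (mulr_gt0 (exprn_gt0 k (@ltr0Sn R 1)) c0); rewrite h eqxx.
  - move=> _; have : (0 <= la [set x | X0 (- x)%R])%E by exact: measure_ge0.
    rewrite le_eqVlt => /orP[/eqP <-|h]; last by rewrite gt0_muley// -EFinM.
    rewrite mul0e => /eqP; rewrite -EFinM eqe => /eqP h; exfalso.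
    by have := lt0r_neq0 (mulr_gt0 (exprn_gt0 k (@ltr0Sn R 1)) c0); rewrite h eqxx.
have lamN j (A : set 'cV[R]_j) : measurable A -> lam [set x | A (- x)%R] = lam A.
  move=> mA; have NtN : (- 1%:M : 'M[R]_j)^T *m (- 1%:M) = 1%:M.
    by rewrite mulmxN mulmx1 linearN /= opprK trmx1.
  rewrite -(lam_orthogonal NtN mA).
  by congr lam; apply/seteqP; split => x /=; rewrite mulNmx mul1mx.
exists (D0 / c); first exact: divr_gt0.
move=> A B mA mB; apply: (@mule_fin_inj _ c); first by rewrite gt_eqF.
have := prop (A `*` B) C (measurableX mA mB) mC; rewrite laC muC.
rewrite (_ : [set x | _] = [set x | A (- x)] `*` [set x | B (- x)]); last first.
  by apply/seteqP; split => -[x y].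
have mN j (X : set 'cV[R]_j) : measurable X -> measurable [set x | X (- x)].
  move=> mX; have := preimage_mulmx_measurable (- 1%:M) mX.
  by congr measurable; apply/seteqP; split => x /=; rewrite mulNmx mul1mx.
rewrite laX; [|exact: mN|exact: mN]; rewrite !lamN// => h.
rewrite [LHS](_ : _ = mu (A `*` B) * c%:E)%E// h.
rewrite [RHS]muleC muleA -EFinM mulrC -mulrA mulVf ?gt_eqF// mulr1.
by rewrite muleC.
Qed.

End LamInvariance.

(** * Hyperplanes, prisms and cones by slicing *)

Section LamSlices.
Variable R : realType.
Local Notation leb := (@lebesgue_measure R).

Lemma lam_slices n (A : set 'cV[R]_n.+1) :
  lam A = (\int[leb]_s lam [set y | A (ccons s y)])%E.
Proof.
rewrite lamS; apply: eq_integral => s _ /=; congr lam.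
by apply/seteqP; split => y /=; [move/xsectionP|move=> h; apply/xsectionP].
Qed.

Lemma lam_slice_measurable n (A : set 'cV[R]_n.+1) : measurable A ->
  measurable_fun setT (fun s : measurableTypeR R => lam [set y | A (ccons s y)]).
Proof.
move=> mA; have mA' : measurable [set p : measurableTypeR R * 'cV[R]_n | A (ccons p.1 p.2)].
  by rewrite -[X in measurable X]setTI; exact: measurable_ccons.
have := @measurable_fun_xsection _ _ _ _ R (@lam R n) _ mA'.
by congr measurable_fun; apply/funext => s /=; congr lam; apply/seteqP; split => y /=;
  [move/xsectionP|move=> h; apply/xsectionP].
Qed.

(** If the tail of [w] is nonzero, every slice is a hyperplane and induction applies. Otherwise only
    the slice at height [c / w ord0 0] can be nonempty, and one height has measure zero. *)
Lemma lam_hyperplane n (w : 'cV[R]_n) c : w != 0 -> lam [set x | dotv w x = c] = 0%E.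
Proof.
elim: n w c => [|n IH] w c w0.
  by move: w0; rewrite (_ : w = 0) ?eqxx//; apply/matrixP => -[].
rewrite lam_slices.
have dE s y : dotv w (ccons s y) = w ord0 0 * s + dotv (ctail w) y.
  rewrite /dotv big_ord_recl ccons0; congr (_ + _).
  by apply: eq_bigr => i _; rewrite cconsS mxE.
have [w'0|w'0] := eqVneq (ctail w) 0; last first.
  under eq_integral => s _.
    rewrite (_ : mkset _ = [set y | dotv (ctail w) y = c - w ord0 0 * s]).
      by rewrite IH//; over.
    apply/seteqP; split => y /=; rewrite dE => h; last by rewrite h addrC subrK.
    by rewrite -h addrC addKr.
  by rewrite integral0.
have w00 : w ord0 0 != 0.
  apply: contra w0 => /eqP h; apply/eqP; rewrite -[w]cconsK h w'0.
  apply/matrixP => i j; rewrite ord1; case: (unliftP ord0 i) => [k ->|->].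
    by rewrite cconsS !mxE.
  by rewrite ccons0 mxE.
have dE0 s y : dotv w (ccons s y) = w ord0 0 * s.
  by rewrite dE w'0 /dotv big1 ?addr0// => i _; rewrite mxE mul0r.
rewrite -[RHS](@integral_set1 R (fun s => lam [set y | dotv w (ccons s y) = c]) (c / w ord0 0)).
rewrite [RHS]integral_mkcond; apply: eq_integral => s _.
rewrite patchE; case: ifPn => //; rewrite notin_setE /= => sc.
rewrite (_ : mkset _ = set0) ?measure0// -subset0 => y /=.
by rewrite dE0 => h; apply: sc; rewrite -h mulrAC mulfV ?mul1r.
Qed.

(** Every slice over the unit interval [[b, b + 1]] is a translate of [G], so the shear direction
    [r] does not affect the measure. *)
Lemma lam_prism n (A : set 'cV[R]_n.+1) (G : set 'cV[R]_n) (r : 'cV[R]_n) b :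
  measurable G ->
  (forall s y, A (ccons s y) <-> b <= s <= b + 1 /\ G (y - (s - b) *: r)) ->
  lam A = lam G.
Proof.
move=> mG AE; rewrite lam_slices.
transitivity (\int[leb]_(s in `[b, (b + 1)%R]) lam G)%E; last first.
  rewrite integral_cst//= lebesgue_measure_itv /= lte_fin ltrDl ltr01.
  by rewrite -EFinB addrAC subrr add0r mule1.
rewrite [RHS]integral_mkcond; apply: eq_integral => s _; rewrite patchE.
case: ifPn => [|].
  rewrite inE /= in_itv /= => sb; rewrite -(lam_shift (- ((s - b) *: r)) mG).
  by congr lam; apply/seteqP; split => y /=; rewrite AE// => -[].
rewrite notin_setE /= in_itv /= => sb.
by rewrite (_ : mkset _ = set0) ?measure0// -subset0 => y /= /AE[].
Qed.

Lemma continuous_div_exp n (b : R) : continuous (fun s : R => (s / b) ^+ n).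
Proof.
move=> x; apply: (@continuous_comp _ _ _ (fun s : R => s / b) (fun s : R => s ^+ n)).
  exact: mulrr_continuous.
exact: exprn_continuous.
Qed.

(** The total weight of the slices of a cone of height [b]: at height [s] the slice is the base
    scaled by [s / b]. *)
Lemma integral_monomial n (b : R) : 0 < b ->
  (\int[leb]_(s in `]0%R, b]) ((s / b) ^+ n)%R%:E)%E = (b / n.+1%:R)%:E.
Proof.
move=> b0.
rewrite integral_itv_obnd_cbnd; last first.
  apply: measurable_funTS; apply/measurable_EFinP.
  apply: continuous_measurable_fun; exact: continuous_div_exp.
pose F := fun s : R => (b / n.+1%:R) * (s / b) ^+ n.+1.
have dF (x : R) : is_derive x 1 F ((x / b) ^+ n).
  have d1 : is_derive x 1 (fun s : R => s / b) b^-1.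
    by apply: is_derive_eq; rewrite scaler0 add0r /GRing.scale /= mulr1.
  have := @is_deriveX R R (fun s => s / b) n.+1 x 1 _ d1 => d2.
  have -> : F = (b / n.+1%:R) *: ((fun s : R => s / b) ^+ n.+1).
    by apply/funext => s; rewrite exprfctE.
  apply: is_derive_eq; rewrite /GRing.scale /=.
  by field; rewrite gt_eqF//= -natr1 pnatr_eq0.
have cF (x : R) : {for x, continuous F}.
  by apply/differentiable_continuous/derivable1_diffP; have [] := dF x.
rewrite (@continuous_FTC2 _ _ F)//.
- by rewrite /F mulfV ?gt_eqF// expr1n mul0r expr0n /= mulr0 mulr1 sube0.
- by apply: continuous_subspaceT; exact: continuous_div_exp.
- split; [by move=> x _; have [] := dF x|exact/cvg_at_right_filter/cF|exact/cvg_at_left_filter/cF].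
- by move=> x _; rewrite derive1E; have [] := dF x.
Qed.

Lemma lam_cone n (A : set 'cV[R]_n.+1) (G : set 'cV[R]_n) b :
  0 < b -> measurable A -> measurable G ->
  (forall s y, A (ccons s y) -> 0 <= s <= b) ->
  (forall s y, 0 < s <= b -> A (ccons s y) <-> G ((b / s) *: y)) ->
  lam A = ((b / n.+1%:R)%:E * lam G)%E.
Proof.
move=> b0 mA mG Ab AE; rewrite lam_slices.
rewrite -integral_monomial// -ge0_integralZr//; last 2 first.
- apply: measurable_funTS; apply/measurable_EFinP; apply: continuous_measurable_fun.
  exact: continuous_div_exp.
- move=> s /=; rewrite in_itv /= => /andP[s0 _].
  by rewrite lee_fin exprn_ge0// divr_ge0// ltW.
transitivity (\int[leb]_(s in `[0%R, b]) lam [set y | A (ccons s y)])%E.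
  rewrite [RHS]integral_mkcond; apply: eq_integral => s _; rewrite patchE.
  case: ifPn => //; rewrite notin_setE /= in_itv /= => sb.
  by rewrite (_ : mkset _ = set0) ?measure0// -subset0 => y /= /Ab.
rewrite -integral_itv_obnd_cbnd; last by apply: measurable_funTS; exact: (lam_slice_measurable mA).
apply: eq_integral => s; rewrite inE /= in_itv /= => sb.
have /andP[s0 _] := sb.
have := @lam_scale R n (b / s) G (divr_gt0 b0 s0) mG; rewrite invf_div => <-.
by congr lam; apply/seteqP; split => y /=; rewrite AE.
Qed.

End LamSlices.

(** * Orthonormal charts and volume *)

Section OrthonormalBasis.
Variables (R : realType) (n : nat).
Implicit Types (L : {vspace 'cV[R]_n}) (u x : 'cV[R]_n).

Lemma dotvC x y : dotv x y = dotv y x.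
Proof. by apply: eq_bigr => i _; rewrite mulrC. Qed.

Lemma dotvDr x y z : dotv x (y + z) = dotv x y + dotv x z.
Proof. by rewrite /dotv -big_split; apply: eq_bigr => i _; rewrite mxE mulrDr. Qed.

Lemma dotvZr x a y : dotv x (a *: y) = a * dotv x y.
Proof. by rewrite /dotv mulr_sumr; apply: eq_bigr => i _; rewrite mxE mulrCA. Qed.

Lemma dotvDl x y z : dotv (x + y) z = dotv x z + dotv y z.
Proof. by rewrite ![dotv _ z]dotvC dotvDr. Qed.

Lemma dotvZl a x y : dotv (a *: x) y = a * dotv x y.
Proof. by rewrite ![dotv _ y]dotvC dotvZr. Qed.

Lemma dotv0r x : dotv x 0 = 0.
Proof. by rewrite -(scale0r 0) dotvZr mul0r. Qed.

Lemma dotvNr x y : dotv x (- y) = - dotv x y.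
Proof. by rewrite -scaleN1r dotvZr mulN1r. Qed.

Lemma dotvBr x y z : dotv x (y - z) = dotv x y - dotv x z.
Proof. by rewrite dotvDr dotvNr. Qed.

Lemma dotv_sumr x (I : Type) (r : seq I) (P : pred I) (F : I -> 'cV[R]_n) :
  dotv x (\sum_(i <- r | P i) F i) = \sum_(i <- r | P i) dotv x (F i).
Proof. exact: (big_morph (dotv x) (dotvDr x) (dotv0r x)). Qed.

Lemma dotv_suml x (I : Type) (r : seq I) (P : pred I) (F : I -> 'cV[R]_n) :
  dotv (\sum_(i <- r | P i) F i) x = \sum_(i <- r | P i) dotv (F i) x.
Proof. by rewrite dotvC dotv_sumr; apply: eq_bigr => i _; rewrite dotvC. Qed.

Lemma dotvv_ge0 x : 0 <= dotv x x.
Proof. by apply: sumr_ge0 => i _; rewrite -expr2 sqr_ge0. Qed.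

Lemma dotvv_eq0 x : (dotv x x == 0) = (x == 0).
Proof.
apply/idP/eqP => [/eqP h|->]; last by rewrite dotv0r.
apply/matrixP => i j; rewrite ord1 mxE; apply/eqP; rewrite -sqrf_eq0 expr2.
move/eqP: h; rewrite psumr_eq0 => [/allP/(_ i (mem_index_enum _))//|k _].
by rewrite -expr2 sqr_ge0.
Qed.

Fact dotv_linear u : linear (dotv u : 'cV[R]_n -> R^o).
Proof. by move=> a x y; rewrite dotvDr dotvZr. Qed.

HB.instance Definition _ u :=
  GRing.isLinear.Build R 'cV[R]_n R^o _ (dotv u : 'cV[R]_n -> R^o) (dotv_linear u).

Lemma mulmxE_dotv k (Q : 'M[R]_(n, k)) i x : (Q^T *m x) i 0 = dotv (col i Q) x.
Proof. by rewrite mxE; apply: eq_bigr => j _; rewrite !mxE. Qed.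

Definition orthv L u : {vspace 'cV[R]_n} :=
  (L :&: lker (linfun (dotv u : 'cV[R]_n -> R^o)))%VS.

Lemma mem_orthv L u x : (x \in orthv L u) = (x \in L) && (dotv u x == 0).
Proof. by rewrite memv_cap memv_ker lfunE. Qed.

Lemma dim_orthv L u k : u \in L -> dotv u u = 1 -> \dim L = k.+1 -> \dim (orthv L u) = k.
Proof.
move=> uL u1 dL.
have u0 : u != 0 by rewrite -dotvv_eq0 u1 oner_eq0.
have : (<[u]> + orthv L u)%VS = L.
  apply/eqP; rewrite eqEsubv subv_add; apply/andP; split.
    by rewrite -memvE uL /orthv capvSl.
  apply/subvP => x xL; rewrite -[x](subrK (dotv u x *: u)) addrC.
  apply: memv_add; first by rewrite memvZ// memv_line.
  by rewrite mem_orthv rpredB ?memvZ//= dotvBr dotvZr u1 mulr1 subrr.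
move=> /(congr1 (fun V : {vspace _} => \dim V)); rewrite dL dimv_disjoint_sum.
  by rewrite dim_vline u0 add1n => -[].
apply/eqP; rewrite -subv0; apply/subvP => x; rewrite memv_cap => /andP[/vlineP[a ->]].
by rewrite mem_orthv dotvZr u1 mulr1 => /andP[_ /eqP->]; rewrite scale0r memv0.
Qed.

Definition onb k (Q : 'M[R]_(n, k)) L : Prop :=
  Q^T *m Q = 1%:M /\ forall x, (x \in L) <-> exists y, x = Q *m y.

Lemma onb_proj k (Q : 'M[R]_(n, k)) L x : onb Q L -> x \in L -> Q *m (Q^T *m x) = x.
Proof. by move=> [QQ QL] /QL[y ->]; rewrite !mulmxA -(mulmxA Q) QQ mulmx1. Qed.

Lemma onb_mem k (Q : 'M[R]_(n, k)) L y : onb Q L -> Q *m y \in L.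
Proof. by move=> [QQ QL]; apply/QL; exists y. Qed.

Lemma onb_row_mx k (u : 'cV[R]_n) (Q : 'M[R]_(n, k)) L :
  u \in L -> dotv u u = 1 -> onb Q (orthv L u) ->
  onb (row_mx u Q : 'M[R]_(n, k.+1)) L /\ u^T *m Q = 0.
Proof.
move=> uL u1 oQ; have [QQ QL] := oQ.
have uQ : u^T *m Q = 0.
  apply/matrixP => i j; rewrite !ord1 !mxE.
  transitivity (dotv u (Q *m delta_mx j 0)).
    by apply: eq_bigr => l _; rewrite -colE !mxE.
  by have := onb_mem (delta_mx j 0) oQ; rewrite mem_orthv => /andP[_ /eqP].
split=> //; split.
  have h : (row_mx u Q)^T *m (row_mx u Q) = 1%:M.
    rewrite tr_row_mx mul_col_row QQ uQ.
    have -> : Q^T *m u = 0 by rewrite -[LHS]trmxK trmx_mul trmxK uQ trmx0.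
    have -> : u^T *m u = 1%:M.
      by apply/matrixP => i j; rewrite !ord1 -dotvE u1 mxE.
    by rewrite -scalar_mx_block.
  exact: h.
move=> x; split => [xL|[y ->]].
  have /QL[y yE] : x - dotv u x *: u \in orthv L u.
    by rewrite mem_orthv rpredB ?memvZ//= dotvBr dotvZr u1 mulr1 subrr.
  by exists (ccons (dotv u x) y); rewrite mulmx_ccons -yE addrC subrK.
rewrite -(cconsK y) mulmx_ccons rpredD ?memvZ//.
by have := onb_mem (ctail y) oQ; rewrite mem_orthv => /andP[].
Qed.

(** Gram-Schmidt: normalize one vector of [L] and continue in its orthogonal complement within
    [L]. *)
Lemma onb_exists k L : \dim L = k -> exists Q : 'M[R]_(n, k), onb Q L.
Proof.
elim: k L => [|k IH] L dL.
  exists 0; split; first by apply/matrixP => -[].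
  move: dL => /eqP; rewrite dimv_eq0 => /eqP -> x; rewrite memv0; split.
    by move=> /eqP ->; exists 0; rewrite mulmx0.
  by move=> [y ->]; rewrite mul0mx.
pose v := vpick L; have v0 : v != 0 by rewrite vpick0 -dimv_eq0 dL.
pose u := (Num.sqrt (dotv v v))^-1 *: v.
have uL : u \in L by rewrite memvZ// memv_pick.
have u1 : dotv u u = 1.
  rewrite dotvZl dotvZr mulrA -expr2 exprVn sqr_sqrtr ?dotvv_ge0//.
  by rewrite mulVf// dotvv_eq0.
have [Q oQ] := IH _ (dim_orthv uL u1 dL).
by have [] := onb_row_mx uL u1 oQ; exists (row_mx u Q : 'M[R]_(n, k.+1)).
Qed.

End OrthonormalBasis.

(** * Chart independence and volume formulas in subspaces *)

Section Volume.
Variables (R : realType) (n : nat).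
Implicit Types (L : {vspace 'cV[R]_n}) (A F : set 'cV[R]_n).

(** A nonzero row of [N] gives a hyperplane containing [B]. *)
Lemma lam_null_of_kernel k (N : 'M[R]_k) (B : set 'cV[R]_k) :
  N != 0 -> measurable B -> (forall y, B y -> N *m y = 0) -> lam B = 0%E.
Proof.
move=> N0 mB BN; have [i rN] : exists i, col i N^T != 0.
  apply/existsP; apply: contraNT N0 => /existsPn h; apply/eqP/matrixP => i j.
  have := h i; rewrite negbK => /eqP /matrixP/(_ j 0); by rewrite !mxE.
apply/eqP; rewrite -measure_le0 -(lam_hyperplane 0 rN); apply: le_measure.
- by rewrite inE.
- by rewrite inE; apply: measurable_eq_fun; [exact: measurable_dotv|exact: measurable_cst].
- by move=> y /BN /= h; rewrite -mulmxE_dotv trmxK h mxE.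
Qed.

(** After both charts are moved to a common base point of [A], the matrix [M] converts coordinates
    of points of [A] from one chart to the other. *)
Lemma chart_independent k (A : set 'cV[R]_n) a (Q : 'M[R]_(n, k)) a' (Q' : 'M[R]_(n, k)) :
  measurable A -> orthonormal_chart A (a, Q) -> orthonormal_chart A (a', Q') ->
  lam [set y | A (a + Q *m y)] = lam [set y | A (a' + Q' *m y)].
Proof.
move=> mA [/= QQ AQ] [/= QQ' AQ'].
have [->|/set0P[z Az]] := eqVneq A set0.
  by rewrite (_ : mkset _ = set0)// (_ : mkset _ = set0).
have [s _ sE] := AQ _ Az; have [s' _ sE'] := AQ' _ Az.
have mz j (P : 'M[R]_(n, j)) : measurable [set y | A (z + P *m y)].
  exact: measurable_affine_preimage.
have -> : lam [set y | A (a + Q *m y)] = lam [set y | A (z + Q *m y)].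
  rewrite -(lam_shift s); last exact: measurable_affine_preimage.
  have e y : a + Q *m (y + s) = z + Q *m y by rewrite -sE /= mulmxDr addrA addrAC.
  by congr lam; apply/seteqP; split => y /=; rewrite e.
have -> : lam [set y | A (a' + Q' *m y)] = lam [set y | A (z + Q' *m y)].
  rewrite -(lam_shift s'); last exact: measurable_affine_preimage.
  have e y : a' + Q' *m (y + s') = z + Q' *m y by rewrite -sE' /= mulmxDr addrA addrAC.
  by congr lam; apply/seteqP; split => y /=; rewrite e.
pose M := Q'^T *m Q.
have MT : M^T = Q^T *m Q' by rewrite trmx_mul trmxK.
have M1 y : A (z + Q *m y) -> Q *m y = Q' *m (M *m y).
  move=> /AQ'[t _ tE]; have : Q *m y = Q' *m (t - s').
    by rewrite mulmxBr; apply: (addrI z); rewrite -[LHS]tE -sE' /= addrACA subrr addr0.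
  by move=> h; rewrite /M -mulmxA h (mulmxA Q'^T) QQ' mul1mx.
have M2 y : A (z + Q' *m y) -> Q' *m y = Q *m (M^T *m y).
  move=> /AQ[t _ tE]; have : Q' *m y = Q *m (t - s).
    by rewrite mulmxBr; apply: (addrI z); rewrite -[LHS]tE -sE /= addrACA subrr addr0.
  by move=> h; rewrite MT -mulmxA h (mulmxA Q^T) QQ mul1mx.
(* If [M] is orthogonal, rotation invariance concludes. If not, the two charts span different
   subspaces, so [A] is confined to a proper subspace of each and both readings are zero. *)
have [MM|MM] := eqVneq (M^T *m M) 1%:M.
  rewrite -(lam_orthogonal MM (mz _ Q')); congr lam; apply/seteqP; split => y /= h.
    by rewrite -M1.
  by move: (h); rewrite (M2 _ h) (mulmxA M^T) MM mul1mx.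
rewrite (@lam_null_of_kernel _ (1%:M - M^T *m M)) ?subr_eq0 1?eq_sym//; last first.
  move=> y /= h; rewrite mulmxBl mul1mx -mulmxA MT -mulmxA -(M1 _ h) mulmxA QQ mul1mx.
  by rewrite subrr.
have MM' : M *m M^T != 1%:M by apply: contra MM => /eqP /mulmx1C ->.
rewrite (@lam_null_of_kernel _ (1%:M - M *m M^T)) ?subr_eq0 1?eq_sym//.
move=> y /= h; rewrite mulmxBl mul1mx -mulmxA {1}/M -mulmxA -(M2 _ h) mulmxA QQ' mul1mx.
by rewrite subrr.
Qed.

(** As a chart exists, [xget] does not return its default, and its choice is immaterial by
    [chart_independent]. *)
Lemma vol_chart k A a (Q : 'M[R]_(n, k)) : measurable A ->
  orthonormal_chart A (a, Q) -> vol k A = lam [set y | A (a + Q *m y)].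
Proof.
move=> mA cQ; rewrite /vol; set p := xget _ _.
have : orthonormal_chart A p by rewrite /p; case: xgetP => // /(_ (a, Q)).
by case: p => a' Q' /= cp; exact: chart_independent.
Qed.

Lemma vol_subspace k L A (Q : 'M[R]_(n, k)) : onb Q L -> measurable A ->
  (forall x, A x -> x \in L) -> vol k A = lam [set y | A (Q *m y)].
Proof.
move=> [QQ QL] mA AL; rewrite (@vol_chart _ _ 0 Q)//; last first.
  by split => //= x /AL /QL[y ->]; exists y; rewrite ?add0r.
by congr lam; apply/seteqP; split => y /=; rewrite add0r.
Qed.

Lemma vol_scale k A r : 0 < r -> measurable A ->
  (exists p : 'cV[R]_n * 'M[R]_(n, k), orthonormal_chart A p) ->
  vol k [set x | A (r *: x)] = ((r^-1 ^+ k)%:E * vol k A)%E.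
Proof.
move=> r0 mA [[a Q] [QQ AQ]]; have rn0 : r != 0 by rewrite gt_eqF.
have mrA : measurable [set x | A (r *: x)].
  have := preimage_mulmx_measurable (r%:M) mA.
  by congr measurable; apply/seteqP; split => x /=; rewrite mul_scalar_mx.
rewrite (@vol_chart k _ (r^-1 *: a) Q)//; last first.
  split => //= x /AQ[y _ /= yE]; exists (r^-1 *: y) => //=.
  by rewrite -scalemxAr -scalerDr yE scalerA mulVf// scale1r.
rewrite (@vol_chart k A a Q)//.
rewrite -lam_scale//; last exact: measurable_affine_preimage.
by congr lam; apply/seteqP; split => y /=;
  rewrite scalerDr scalerA mulfV// scale1r scalemxAr.
Qed.

Section Slices.
Variables (k : nat) (L : {vspace 'cV[R]_n}) (u : 'cV[R]_n).
Hypotheses (uL : u \in L) (u1 : dotv u u = 1) (dL : \dim L = k.+1).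

(** An orthonormal basis of [L] with first vector [u]: the first coordinate becomes [dotv u], and
    the remaining columns chart every slice orthogonal to [u]. This reduces cones and prisms in [L]
    to [lam_cone] and [lam_prism]. *)
Lemma slice_charts : exists2 Q : 'M[R]_(n, k), u^T *m Q = 0 &
  onb (row_mx u Q : 'M[R]_(n, k.+1)) L /\
  forall F b, (forall x, F x -> x \in L /\ dotv u x = b) ->
    orthonormal_chart F (b *: u, Q).
Proof.
have [Q oQ] := onb_exists (dim_orthv uL u1 dL).
have [oR uQ] := onb_row_mx uL u1 oQ; exists Q => //; split => // F b FL.
have [QQ QL] := oQ; split => //= x /FL[xL ub].
have /QL[y yE] : x - b *: u \in orthv L u.
  by rewrite mem_orthv rpredB ?memvZ//= dotvBr dotvZr u1 mulr1 ub subrr.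
by exists y => //=; rewrite -yE addrC subrK.
Qed.

Lemma dotv_slice (Q : 'M[R]_(n, k)) s y : u^T *m Q = 0 -> dotv u (s *: u + Q *m y) = s.
Proof.
by move=> uQ; rewrite dotvDr dotvZr u1 mulr1 [dotv u (Q *m y)]dotvE mulmxA uQ mul0mx mxE addr0.
Qed.

Lemma vol_cone A F b : 0 < b -> measurable A -> measurable F ->
  (forall x, F x -> x \in L /\ dotv u x = b) ->
  (forall x, A x -> x \in L /\ 0 <= dotv u x <= b) ->
  (forall x, x \in L -> 0 < dotv u x <= b ->
     A x <-> F ((b / dotv u x) *: x)) ->
  vol k.+1 A = ((b / k.+1%:R)%:E * vol k F)%E.
Proof.
move=> b0 mA mF FL AL AF; have [Q uQ [oR cF]] := slice_charts.
rewrite (vol_subspace oR mA); last by move=> x /AL[].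
rewrite (vol_chart mF (cF _ _ FL)).
apply: lam_cone => //.
- exact: preimage_mulmx_measurable.
- exact: measurable_affine_preimage.
- by move=> s y /=; rewrite mulmx_ccons => /AL[_]; rewrite dotv_slice.
- move=> s y sb /=; rewrite mulmx_ccons AF ?dotv_slice//; last first.
    by rewrite -mulmx_ccons; exact: onb_mem.
  rewrite scalerDr scalerA divfK ?scalemxAr//.
  by case/andP: sb => s0 _; rewrite gt_eqF.
Qed.

(** The sweeping direction [w] may be oblique; only its height 1 over [F] matters. This freedom is
    what the product formula for faces relies on. *)
Lemma vol_prism A F b w : measurable A -> measurable F ->
  w \in L -> dotv u w = 1 ->
  (forall x, F x -> x \in L /\ dotv u x = b) ->
  (forall x, A x <-> [/\ x \in L, b <= dotv u x <= b + 1 & F (x - (dotv u x - b) *: w)]) ->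
  vol k.+1 A = vol k F.
Proof.
move=> mA mF wL uw FL AF; have [Q uQ [oR cF]] := slice_charts.
rewrite (vol_subspace oR mA); last by move=> x /AF[].
rewrite (vol_chart mF (cF _ _ FL)).
have [r rE] : exists r, w = u + Q *m r.
  have [_ RL] := oR; have /RL[y] := wL; rewrite -(cconsK y) mulmx_ccons => wE.
  exists (ctail y); rewrite {1}wE; congr (_ + _).
  by have := uw; rewrite {1}wE dotv_slice// => ->; rewrite scale1r.
apply: (@lam_prism _ _ _ _ r b); first exact: measurable_affine_preimage.
move=> s y /=; rewrite mulmx_ccons AF dotv_slice//.
have -> : s *: u + Q *m y - (s - b) *: w = b *: u + Q *m (y - (s - b) *: r).
  rewrite rE mulmxBr scalerDr -scalemxAr opprD addrACA; congr (_ + _).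
  by rewrite -scalerBl opprB addrC subrK.
split=> [[_ ? ?]//|[? ?]]; split => //.
by rewrite -mulmx_ccons; exact: onb_mem.
Qed.

End Slices.

Section Product.
Variables (k1 k2 : nat) (L1 L2 : {vspace 'cV[R]_n}).
(* [E1] and [E2] are the orthogonal projections to [L1] and [L2]; as these
   need not be orthogonal to each other, [D] can differ from [1]. *)
Definition product_chart (E1 E2 : 'M[R]_n) (D : R) : Prop :=
  [/\ forall x, E1 *m x \in L1 /\ E2 *m x \in L2,
      forall x l, (l \in L1 -> dotv l (E1 *m x) = dotv l x) /\
                  (l \in L2 -> dotv l (E2 *m x) = dotv l x),
      forall x1 x2, x1 \in L1 -> x2 \in L2 ->
        exists x, [/\ x \in (L1 + L2)%VS, E1 *m x = x1 & E2 *m x = x2],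
      0 < D &
      forall A A1 A2, measurable A -> measurable A1 -> measurable A2 ->
        (forall x, A x -> x \in (L1 + L2)%VS) -> (forall x, A1 x -> x \in L1) ->
        (forall x, A2 x -> x \in L2) ->
        (forall x, x \in (L1 + L2)%VS -> A x <-> A1 (E1 *m x) /\ A2 (E2 *m x)) ->
        vol (k1 + k2) A = (D%:E * (vol k1 A1 * vol k2 A2))%E].

(** In orthonormal coordinates the two projections are [M1] and [M2]. Stacked, they form a square
    matrix that is invertible because a vector of [L1 + L2] orthogonal to both summands is zero;
    then [lam_product] applies. *)
Lemma product_chart_exists : \dim L1 = k1 -> \dim L2 = k2 ->
  (L1 :&: L2)%VS = 0%VS -> exists E1 E2 D, product_chart E1 E2 D.
Proof.
move=> dL1 dL2 L12.
have dL : \dim (L1 + L2)%VS = (k1 + k2)%N by rewrite dimv_disjoint_sum// dL1 dL2.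
have [Q oQ] := onb_exists dL; have [Q1 oQ1] := onb_exists dL1.
have [Q2 oQ2] := onb_exists dL2.
pose M1 := Q1^T *m Q; pose M2 := Q2^T *m Q.
pose M : 'M[R]_(k1 + k2) := col_mx M1 M2.
have Mker (y : 'cV[R]_(k1 + k2)) : M *m y = 0 -> y = 0.
  rewrite mul_col_mx => /eqP; rewrite col_mx_eq0 => /andP[/eqP y1 /eqP y2].
  pose x := Q *m y.
  have x0 (l : 'cV[R]_n) : l \in (L1 + L2)%VS -> dotv l x = 0.
    move=> /memv_addP[l1 l1L [l2 l2L ->]]; rewrite dotvDl.
    have := l1L => /(proj2 oQ1)[z1 ->]; have := l2L => /(proj2 oQ2)[z2 ->].
    rewrite ![dotv (_ *m _) x]dotvC !dotv_mulmx /x !mulmxA y1 y2.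
    by rewrite dotvC dotv0r dotvC dotv0r addr0.
  have := x0 x (onb_mem y oQ) => /eqP; rewrite dotvv_eq0 /x => /eqP h.
  by rewrite -[y]mul1mx -(proj1 oQ) -mulmxA h mulmx0.
have Mu : M \in unitmx.
  rewrite -unitmx_tr -row_free_unit -kermx_eq0; apply/eqP/row_matrixP => i.
  have : row i (kermx M^T) *m M^T = 0.
    by apply/eqP; rewrite -sub_kermx row_sub.
  move=> /(congr1 trmx); rewrite trmx_mul trmxK trmx0 => /Mker /(congr1 trmx).
  by rewrite trmxK trmx0 row0.
pose N := invmx M; pose N1 := lsubmx N; pose N2 := rsubmx N.
have NE : N = row_mx N1 N2 by rewrite hsubmxK.
have NM : N1 *m M1 + N2 *m M2 = 1%:M by rewrite -mul_row_col -NE mulVmx.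
have := mulmxV Mu; rewrite -/N NE mul_col_row (scalar_mx_block k1 k2 1).
move=> /eq_block_mx[MN1 M12 M21 MN2].
have [D D0 prodD] := lam_product NM MN1 MN2 M12 M21.
have projl j (P : 'M[R]_(n, j)) (V : {vspace 'cV[R]_n}) (x l : 'cV[R]_n) : onb P V ->
    l \in V -> dotv l (P *m P^T *m x) = dotv l x.
  by move=> oP lV; rewrite -mulmxA !dotv_mulmx trmxK (onb_proj oP).
exists (Q1 *m Q1^T), (Q2 *m Q2^T), D; split => //.
- by move=> x; rewrite -!mulmxA; split; exact: onb_mem.
- by move=> x l; split; exact: projl.
- move=> x1 x2 x1L x2L.
  have /(proj2 oQ1)[y1 ->] := x1L; have /(proj2 oQ2)[y2 ->] := x2L.
  exists (Q *m (N1 *m y1 + N2 *m y2)); split; first exact: onb_mem.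
    rewrite -!mulmxA; congr (_ *m _); rewrite (mulmxA Q1^T) mulmxDr !mulmxA.
    by rewrite -/M1 MN1 M12 mul1mx mul0mx addr0.
  rewrite -!mulmxA; congr (_ *m _); rewrite (mulmxA Q2^T) mulmxDr !mulmxA.
  by rewrite -/M2 MN2 M21 mul1mx mul0mx add0r.
- move=> A A1 A2 mA mA1 mA2 AL A1L A2L AE.
  rewrite (vol_subspace oQ mA AL) (vol_subspace oQ1 mA1 A1L) (vol_subspace oQ2 mA2 A2L).
  rewrite -prodD; [|exact: preimage_mulmx_measurable|exact: preimage_mulmx_measurable].
  congr lam; apply/funext => y /=; apply/propext.
  rewrite AE; last exact: onb_mem.
  by rewrite /M1 /M2 !mulmxA.
Qed.

End Product.

Lemma product_chart_sym k1 k2 L1 L2 E1 E2 D :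
  product_chart k1 k2 L1 L2 E1 E2 D -> product_chart k2 k1 L2 L1 E2 E1 D.
Proof.
move=> [EL Edot Esurj D0 volE]; split => //.
- by move=> x; have [] := EL x.
- by move=> x l; have [] := Edot x l.
- move=> x1 x2 x1L x2L; have [x [xL ? ?]] := Esurj x2 x1 x2L x1L.
  by exists x; rewrite addvC.
move=> A A1 A2 mA mA1 mA2; rewrite addvC => AL A1L A2L AE.
rewrite addnC (volE A A2 A1)//; first by rewrite [X in (_ * X)%E]muleC.
by move=> x xL; rewrite AE// and_comm.
Qed.

End Volume.

(** * Volume as a measure on a fixed subspace *)

Section VolumeMeasure.
Variables (R : realType) (n : nat).

Lemma measurable_vspace (L : {vspace 'cV[R]_n}) : measurable [set x | x \in L].
Proof.
have [Q [QQ QL]] := onb_exists (erefl (\dim L)).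
have -> : [set x | x \in L] = [set x | forall i, (Q *m Q^T *m x) i 0 = x i 0].
  apply/seteqP; split => x /= => [/QL[y ->] i|h].
    by rewrite !mulmxA -(mulmxA Q) QQ mulmx1.
  apply/QL; exists (Q^T *m x); apply/matrixP => i j; rewrite ord1 mulmxA.
  exact/esym.
apply: measurable_forall => i; apply: measurable_eq_fun; last exact: measurable_coord.
apply: (measurableT_comp (measurable_coord i)).
exact: (measurable_mulmx _ (@measurable_id _ _ setT)).
Qed.

(** [vol] chooses a chart for each set separately. Inside one subspace a single chart serves all
    sets, so additivity and monotonicity of a genuine measure become available. *)
Lemma vol_measure (L : {vspace 'cV[R]_n}) k : \dim L = k ->
  exists nu : {measure set 'cV[R]_n -> \bar R},
  (forall A, measurable A -> (forall x, A x -> x \in L) -> vol k A = nu A) /\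
  (forall w c, w \in L -> w != 0 -> nu [set x | dotv w x = c] = 0%E).
Proof.
move=> dL; have [Q oQ] := onb_exists dL.
have mQ : measurable_fun setT (fun y : 'cV[R]_k => Q *m y).
  exact: (measurable_mulmx _ (@measurable_id _ _ setT)).
pose nu0 : {measure set 'cV[R]_n -> \bar R} := pushforward (@lam R k) (fun y : 'cV[R]_k => Q *m y).
exists (nu0 mQ); split => [A mA AL|w c wL w0].
  by rewrite (vol_subspace oQ mA AL).
rewrite /nu0 /= /pushforward -(@lam_hyperplane R k (Q^T *m w) c).
  by congr lam; apply/seteqP; split => y /=; rewrite dotv_mulmx.
by apply: contra w0 => /eqP h; rewrite -(onb_proj oQ wL) h mulmx0.
Qed.

Lemma vol_ge0 k (A : set 'cV[R]_n) : (0 <= vol k A)%E.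
Proof.
rewrite /vol; set p := xget _ _.
exact: (measure_ge0 (@lam R k) [set y | A (p.1 + p.2 *m y)]).
Qed.

Lemma measureU_null d (T : measurableType d) (mu : {measure set T -> \bar R}) A B :
  measurable A -> measurable B -> mu (A `&` B) = 0%E ->
  mu (A `|` B) = (mu A + mu B)%E.
Proof.
move=> mA mB AB; rewrite -[A `|` B](setDUK (A := A)) ?setDUl; last by left.
rewrite setDv set0U measureU//; last 2 first.
- exact: measurableD.
- by rewrite setDIK.
congr (_ + _)%E; rewrite [RHS](measureDI mu mB mA) [B `&` A]setIC. apply/esym.
exact: (eq_trans (congr1 (fun z => mu (B `\` A) + z)%E AB) (adde0 _)).
Qed.

(** Additivity up to null overlaps, as needed for facet cones, which share boundary pieces. *)
Lemma measure_bigsetU_null d (T : measurableType d) (mu : {measure set T -> \bar R})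
    (I : eqType) (r : seq I) (C : I -> set T) :
  uniq r -> (forall i, i \in r -> measurable (C i)) ->
  (forall i j, i \in r -> j \in r -> i != j -> mu (C i `&` C j) = 0%E) ->
  mu (\big[setU/set0]_(i <- r) C i) = (\sum_(i <- r) mu (C i))%E.
Proof.
elim: r => [|i r IH] /=; first by rewrite !big_nil measure0.
move=> /andP[ir ur] mC C0; rewrite !big_cons.
have mCi : measurable (C i) by apply: mC; rewrite mem_head.
have mB (s : seq I) : {subset s <= r} -> measurable (\big[setU/set0]_(j <- s) C j).
  move=> sr; rewrite big_seq; apply: bigsetU_measurable => j /sr jr.
  by apply: mC; rewrite inE jr orbT.
rewrite -IH//; last 2 first.
- by move=> j jr; apply: mC; rewrite inE jr orbT.
- by move=> j l jr lr; apply: C0; rewrite inE ?jr ?lr orbT.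
apply: measureU_null => //; first exact: mB.
have : {subset r <= r} by [].
elim: {-2}r => [|j s IHs] sr; first by rewrite big_nil setI0 measure0.
have jr : j \in r by apply: sr; rewrite mem_head.
have {}sr : {subset s <= r} by move=> l ls; apply: sr; rewrite inE ls orbT.
rewrite big_cons setIUr; apply/eqP; rewrite -measure_le0.
have mCj : measurable (C j) by apply: mC; rewrite inE jr orbT.
apply: le_trans (measureU2 mu _ _) _; [exact: measurableI|apply: measurableI => //; exact: mB|].
have h1 : (mu (C i `&` \big[setU/set0]_(l <- s) C l) <= 0)%E by rewrite IHs.
have h2 : (mu (C i `&` C j) <= 0)%E.
  by rewrite C0 ?inE ?eqxx ?jr ?orbT//; apply: contraNneq ir => ->.
by have := leeD h2 h1; rewrite adde0 => h; exact: h.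
Qed.

Lemma measure_bigsetU_le d (T : measurableType d) (mu : {measure set T -> \bar R})
    (I : eqType) (r : seq I) (C : I -> set T) :
  (forall i, i \in r -> measurable (C i)) ->
  (mu (\big[setU/set0]_(i <- r) C i) <= \sum_(i <- r) mu (C i))%E.
Proof.
elim: r => [|i r IH] mC; first by rewrite !big_nil measure0.
rewrite !big_cons; apply: le_trans (measureU2 mu _ _) _.
- by apply: mC; rewrite mem_head.
- by rewrite big_seq; apply: bigsetU_measurable => j jr; apply: mC; rewrite inE jr orbT.
by rewrite leeD2l//; apply: IH => j jr; apply: mC; rewrite inE jr orbT.
Qed.

End VolumeMeasure.

(** * Polytopes and their facet cones *)

Section Span.
Variables (R : realType) (n m : nat) (U : 'M[R]_(n, m)).
Implicit Types S T : {set 'I_m}.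

Lemma mem_lin S i : i \in S -> col i U \in lin U S.
Proof. by move=> iS; apply: memv_span; apply/mapP; exists i; rewrite ?mem_enum. Qed.

Lemma lin_subset (V : {vspace 'cV[R]_n}) S :
  (forall i, i \in S -> col i U \in V) -> (lin U S <= V)%VS.
Proof. by move=> SV; apply/span_subvP => x /mapP[i]; rewrite mem_enum => iS ->; exact: SV. Qed.

Lemma lin_combination S x : x \in lin U S ->
  exists c : 'I_m -> R, x = \sum_(i in S) c i *: col i U.
Proof.
pose P x := exists c : 'I_m -> R, x = \sum_(i in S) c i *: col i U.
have P0 : P 0 by exists (fun=> 0); rewrite big1// => i _; rewrite scale0r.
have PD a y z : P y -> P z -> P (a *: y + z).
  move=> [c ->] [d ->]; exists (fun i => a * c i + d i).
  rewrite scaler_sumr -big_split; apply: eq_bigr => i _.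
  by rewrite scalerDl scalerA.
move=> /coord_span ->; elim/big_ind: _ => [//|y z Py Pz|i _].
  by rewrite -[y]scale1r; exact: PD.
rewrite -[_ *: _]addr0; apply: PD => //.
have := @mem_nth _ 0 [seq col i U | i in S] i; rewrite size_map -cardE ltn_ord.
move=> /(_ isT) /mapP[j]; rewrite mem_enum => jS ->.
exists (fun l => (l == j)%:R); rewrite (bigD1 j)//= eqxx scale1r big1 ?addr0// => l.
by move=> /andP[_ /negbTE ->]; rewrite scale0r.
Qed.

Lemma lin_orthogonal_eq0 S x :
  x \in lin U S -> (forall i, i \in S -> dotv (col i U) x = 0) -> x = 0.
Proof.
move=> xS x0; apply/eqP; rewrite -dotvv_eq0.
have [c xE] := lin_combination xS; rewrite {1}xE dotv_suml big1// => i iS.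
by rewrite dotvZl x0// mulr0.
Qed.

Lemma lin_setU S T : lin U (S :|: T) = (lin U S + lin U T)%VS.
Proof.
apply/eqP; rewrite eqEsubv subv_add; apply/and3P; split.
- apply: lin_subset => i; rewrite inE => /orP[iS|iT].
    by rewrite -[col _ _]addr0 memv_add ?mem_lin ?mem0v.
  by rewrite -[col _ _]add0r memv_add ?mem_lin ?mem0v.
- by apply: lin_subset => i iS; apply: mem_lin; rewrite inE iS.
- by apply: lin_subset => i iS; apply: mem_lin; rewrite inE iS orbT.
Qed.

(* Equivalent to [pos S = lin S]. *)
Definition positively_dependent S : Prop :=
  exists c : 'I_m -> R, (forall i, i \in S -> 0 < c i) /\
    \sum_(i in S) c i *: col i U = 0.

(** Pairing the positive relation with [x] writes zero as a sum of terms of one sign. *)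
Lemma positively_dependent_dotv0 S x : positively_dependent S ->
  (forall i, i \in S -> dotv (col i U) x <= 0) ->
  forall i, i \in S -> dotv (col i U) x = 0.
Proof.
move=> [c [cp c0]] xle i iS.
have := congr1 (fun y => dotv y x) c0; rewrite dotv_suml [dotv 0 x]dotvC dotv0r.
under eq_bigr do rewrite dotvZl.
move=> /eqP; rewrite -oppr_eq0 -sumrN psumr_eq0 => [/allP/(_ i)|j jS].
  rewrite mem_index_enum iS /= => /(_ isT); rewrite oppr_eq0 mulf_eq0 gt_eqF ?cp//=.
  by move/eqP.
by rewrite oppr_ge0 mulr_ge0_le0 ?xle ?ltW ?cp.
Qed.

Lemma positively_dependent_eq0 S x : positively_dependent S -> x \in lin U S ->
  (forall i, i \in S -> dotv (col i U) x <= 0) -> x = 0.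
Proof.
move=> pd xS xle; apply: (lin_orthogonal_eq0 xS).
exact: positively_dependent_dotv0.
Qed.

End Span.

(** * Volumes of polytopes, faces and facet cones *)

Section Polytope.
Variables (R : realType) (n m : nat) (U : 'M[R]_(n, m)).
Hypotheses (U1 : forall i, dotv (col i U) (col i U) = 1)
  (Uinj : injective (fun i => col i U)).
Implicit Types (S T : {set 'I_m}) (b : 'cV[R]_m).

Lemma measurable_dotv_le w c : measurable [set x : 'cV[R]_n | dotv w x <= c].
Proof. by apply: measurable_le_fun; [exact: measurable_dotv|exact: measurable_cst]. Qed.

Lemma measurable_in_forall S (P : 'I_m -> set 'cV[R]_n) :
  (forall i, measurable (P i)) -> measurable [set x | forall i, i \in S -> P i x].
Proof.
move=> mP; apply: (@measurable_forall _ _ _ (fun i => [set x | i \in S -> P i x])) => i.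
case: (boolP (i \in S)) => iS.
  by rewrite (_ : mkset _ = P i)//; apply/seteqP; split => x /=; [exact|].
by rewrite (_ : mkset _ = setT)//; apply/seteqP; split.
Qed.

Lemma measurable_polytope S b : measurable (polytope U S b).
Proof.
apply: measurableI; first exact: measurable_vspace.
by apply: measurable_in_forall => i; exact: measurable_dotv_le.
Qed.

Lemma measurable_face S b i : measurable (face U S b i).
Proof.
apply: measurableI; first exact: measurable_polytope.
apply: measurableI; first exact: measurable_vspace.
by apply: measurable_eq_fun; [exact: measurable_dotv|exact: measurable_cst].
Qed.

Lemma rg_gt0 S i : i \in S -> (0 < rg U S)%N.
Proof.
move=> iS; rewrite lt0n dimv_eq0; apply: contraTneq (mem_lin U iS) => ->.
by rewrite memv0 -dotvv_eq0 U1 oner_eq0.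
Qed.

(** Upper bounds are the constraints. For lower bounds, the positive relation expresses -<u_i, x>
    through the other products, which are bounded above. *)
Lemma polytope_dotv_bounded S b : positively_dependent U S ->
  exists K, forall x, polytope U S b x -> forall i, i \in S -> `|dotv (col i U) x| <= K.
Proof.
move=> [c [cp c0]].
pose K i := \sum_(l in S) (c l / c i) * `|b l 0| + `|b i 0|.
have Kge0 i : i \in S -> 0 <= K i.
  move=> iS; apply: addr_ge0 => //; apply: sumr_ge0 => l lS.
  by rewrite mulr_ge0// divr_ge0 ?ltW ?cp.
exists (\sum_(i in S) K i) => x [xS xb] i iS.
apply: (@le_trans _ _ (K i)); last first.
  rewrite (bigD1 i)//= lerDl; apply: sumr_ge0 => j /andP[jS _]; exact: Kge0.
rewrite ler_norml; apply/andP; split; last first.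
  apply: le_trans (xb i iS) _; apply: le_trans (ler_norm _) _.
  rewrite /K lerDr; apply: sumr_ge0 => l lS.
  by rewrite mulr_ge0// divr_ge0 ?ltW ?cp.
have := congr1 (fun y => dotv y x) c0; rewrite dotv_suml [dotv 0 x]dotvC dotv0r.
under eq_bigr do rewrite dotvZl.
rewrite (bigD1 i)//= => /eqP; rewrite addr_eq0 => /eqP h.
have ci := cp i iS.
rewrite lerNl -(ler_pM2l ci) mulrN h opprK.
apply: (@le_trans _ _ (\sum_(l in S) c l * `|b l 0|)).
  rewrite [leRHS](bigD1 i)//=; apply: ler_wpDl; first by rewrite mulr_ge0// ltW.
  apply: ler_sum => l /andP[lS _]; rewrite ler_pM2l ?cp//.
  by apply: le_trans (xb l lS) _; exact: ler_norm.
rewrite /K mulrDr mulr_sumr; apply: ler_wpDr; first by rewrite mulr_ge0// ltW.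
by apply: ler_sum => l lS; rewrite mulrA mulrCA mulfV ?gt_eqF// mulr1.
Qed.

Lemma polytope_chart_cube S b k (Q : 'M[R]_(n, k)) : positively_dependent U S ->
  onb Q (lin U S) -> exists r, 0 <= r /\
  [set y | polytope U S b (Q *m y)] `<=` cube r.
Proof.
move=> pd oQ; have [K hK] := polytope_dotv_bounded b pd.
have /fin_all_exists[r hr] (j : 'I_k) : exists r, forall x, polytope U S b x ->
    `|dotv (col j Q) x| <= r.
  have /lin_combination[a aE] : col j Q \in lin U S by rewrite colE; exact: onb_mem.
  exists (\sum_(i in S) `|a i| * K) => x xP; rewrite aE dotv_suml.
  apply: le_trans (ler_norm_sum _ _ _) _; apply: ler_sum => i iS.
  by rewrite dotvZl normrM ler_wpM2l// hK.
exists (\sum_j `|r j|); split; first exact: sumr_ge0.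
move=> y /= yP j; have := hr j _ yP; rewrite -mulmxE_dotv mulmxA (proj1 oQ) mul1mx.
move=> h; apply: le_trans h _; apply: le_trans (ler_norm _) _.
by rewrite (bigD1 j)//= lerDl sumr_ge0.
Qed.

Lemma polytope_subset_lin S b x : polytope U S b x -> x \in lin U S.
Proof. by case. Qed.

Lemma vol_polytope_fin S b : positively_dependent U S ->
  vol (rg U S) (polytope U S b) \is a fin_num.
Proof.
move=> pd; have [Q oQ] := onb_exists (erefl (rg U S)).
have [r [r0 sr]] := polytope_chart_cube b pd oQ.
rewrite ge0_fin_numE ?vol_ge0//.
rewrite (vol_subspace oQ (measurable_polytope S b) (@polytope_subset_lin S b)).
apply: (@le_lt_trans _ _ (lam (cube r : set 'cV[R]_(rg U S)))); last first.
  by rewrite lam_cube// ltry.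
apply: le_measure => //; rewrite inE; last exact: measurable_cube.
apply: preimage_mulmx_measurable; exact: measurable_polytope.
Qed.

Lemma vol_polytope_gt0 S b : (forall i, i \in S -> 0 < b i 0) ->
  (0 < vol (rg U S) (polytope U S b))%E.
Proof.
move=> b0; have [Q oQ] := onb_exists (erefl (rg U S)).
rewrite (vol_subspace oQ (measurable_polytope S b) (@polytope_subset_lin S b)).
(* On [cube e] the product with [col i U] is at most [C i * e], and [e] is small enough to make this
   at most [b i 0] for every [i] in [S] at once. *)
pose C i := \sum_j `|(Q^T *m col i U) j 0|.
pose e := (1 + \sum_(i in S) C i / b i 0)^-1.
have C0 i : 0 <= C i by exact: sumr_ge0.
have s0 : 0 <= \sum_(i in S) C i / b i 0.
  by apply: sumr_ge0 => i iS; rewrite divr_ge0// ltW// b0.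
have e0 : 0 < e by rewrite invr_gt0 ltr_pwDl.
apply: (@lt_le_trans _ _ (lam (cube e : set 'cV[R]_(rg U S)))).
  by rewrite lam_cube ?ltW// lte_fin exprn_gt0// pmulrn_rgt0.
apply: le_measure => //; rewrite ?inE; first exact: measurable_cube.
  by apply: preimage_mulmx_measurable; exact: measurable_polytope.
move=> y ye; split; first exact: onb_mem.
move=> i iS; rewrite dotv_mulmx.
apply: (@le_trans _ _ (C i * e)).
  rewrite /dotv /C mulr_suml; apply: ler_sum => j _.
  by apply: le_trans (ler_norm _) _; rewrite normrM ler_wpM2l.
rewrite /e ler_pdivrMr ?ltr_pwDl// mulrC -ler_pdivrMr ?b0//.
rewrite (bigD1 i)//= addrCA lerDl addr_ge0// sumr_ge0// => j /andP[jS _].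
by rewrite divr_ge0// ltW// b0.
Qed.

Lemma polytopeZ S b a x : 0 < a ->
  polytope U S (a *: b) x <-> polytope U S b (a^-1 *: x).
Proof.
move=> a0; have an0 : a != 0 by rewrite gt_eqF.
split=> -[xS xb]; split.
- by rewrite memvZ.
- by move=> i iS; rewrite dotvZr ler_pdivrMl//; have := xb i iS; rewrite mxE.
- by rewrite -[x](scalerKV an0) memvZ.
- by move=> i iS; have := xb i iS; rewrite dotvZr mxE ler_pdivrMl.
Qed.

Lemma faceZ S b i a x : 0 < a ->
  face U S (a *: b) i x <-> face U S b i (a^-1 *: x).
Proof.
move=> a0; have an0 : a != 0 by rewrite gt_eqF.
rewrite /face /= polytopeZ//; split=> -[xP [xS xb]]; split => //; split.
- by rewrite memvZ.
- by rewrite dotvZr xb mxE mulrA mulVf// mul1r.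
- by rewrite -[x](scalerKV an0) memvZ.
- by rewrite mxE -xb dotvZr mulrA mulfV// mul1r.
Qed.

Lemma vol_polytopeZ S b a : 0 < a ->
  vol (rg U S) (polytope U S (a *: b)) = ((a ^+ rg U S)%:E * vol (rg U S) (polytope U S b))%E.
Proof.
move=> a0; have [Q [QQ QL]] := onb_exists (erefl (rg U S)).
have a'0 : 0 < a^-1 by rewrite invr_gt0.
have := @vol_scale _ _ (rg U S) _ _ a'0 (measurable_polytope S b).
rewrite invrK => <-.
- by congr vol; apply/funext => x; apply/propext; exact: polytopeZ.
- exists (0, Q); split => //= x [/QL[y ->] _]; by exists y; rewrite ?add0r.
Qed.

Lemma dim_lin_prednK S i : i \in S -> \dim (lin U S) = (rg U S - 1).+1.
Proof. by move=> /rg_gt0; rewrite /rg subn1 => /prednK. Qed.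

Lemma vol_faceZ S b i a : 0 < a -> i \in S ->
  vol (rg U S - 1) (face U S (a *: b) i) =
  ((a ^+ (rg U S - 1))%:E * vol (rg U S - 1) (face U S b i))%E.
Proof.
move=> a0 iS.
have [Q uQ [oR cF]] := slice_charts (mem_lin U iS) (U1 i) (dim_lin_prednK iS).
have a'0 : 0 < a^-1 by rewrite invr_gt0.
have := @vol_scale _ _ (rg U S - 1)%N _ _ a'0 (measurable_face S b i).
rewrite invrK => <-.
- by congr vol; apply/funext => x; apply/propext; exact: faceZ.
- by exists (b i 0 *: col i U, Q); apply: cF => x [_].
Qed.

(** For [0 < b i 0] this is the cone with apex 0 over the face of [i]: there [i] maximizes the ratio
    <u_l, x> / b_l. Clearing denominators keeps the condition meaningful when some b_l is zero. *)
Definition facet_cone S b i : set 'cV[R]_n :=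
  [set x | [/\ x \in lin U S, 0 <= dotv (col i U) x <= b i 0 &
    forall l, l \in S -> b i 0 * dotv (col l U) x <= b l 0 * dotv (col i U) x]].

Lemma measurable_facet_cone S b i : measurable (facet_cone S b i).
Proof.
have md l c : measurable_fun setT (fun x : 'cV[R]_n => c * dotv (col l U) x).
  by apply: measurable_funM; [exact: measurable_cst|exact: measurable_dotv].
rewrite (_ : facet_cone S b i = [set x | x \in lin U S] `&`
  ([set x | 0 <= dotv (col i U) x] `&` [set x | dotv (col i U) x <= b i 0]) `&`
  [set x | forall l, l \in S -> b i 0 * dotv (col l U) x <= b l 0 * dotv (col i U) x]).
  apply: measurableI; last by apply: measurable_in_forall => l; exact: measurable_le_fun.
  apply: measurableI; first exact: measurable_vspace.
  apply: measurableI; last exact: measurable_dotv_le.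
  by apply: measurable_le_fun; [exact: measurable_cst|exact: measurable_dotv].
apply/seteqP; split => x /=; first by case=> ? /andP[].
by move=> [[? [? ?]] ?]; split => //; apply/andP.
Qed.

Lemma facet_cone_sub S b i : i \in S -> 0 < b i 0 -> (forall l, 0 <= b l 0) ->
  facet_cone S b i `<=` polytope U S b.
Proof.
move=> iS bi b0 x [xS /andP[x0 xb] xl]; split => // l lS.
rewrite -(ler_pM2l bi); apply: le_trans (xl l lS) _.
by rewrite mulrC ler_wpM2r.
Qed.

Lemma vol_facet_cone S b i : i \in S -> 0 < b i 0 ->
  vol (rg U S) (facet_cone S b i) =
  ((b i 0 / (rg U S)%:R)%:E * vol (rg U S - 1) (face U S b i))%E.
Proof.
move=> iS bi.
have := @vol_cone R n _ (lin U S) (col i U) (mem_lin U iS) (U1 i) (dim_lin_prednK iS)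
  (facet_cone S b i) (face U S b i) (b i 0) bi (measurable_facet_cone S b i)
  (measurable_face S b i).
have -> : (rg U S - 1).+1 = rg U S by rewrite -(dim_lin_prednK iS).
apply.
- by move=> x [_].
- by move=> x [].
move=> x xS /andP[s0 sb]; have sn0 : dotv (col i U) x != 0 by rewrite gt_eqF.
split=> [[_ _ xl]|[[_ xb] _]].
  split; first split; first by rewrite memvZ.
    move=> l lS; rewrite dotvZr mulrAC ler_pdivrMr//; exact: xl.
  by split; [rewrite memvZ|rewrite dotvZr divfK].
split => //; first by rewrite ltW.
by move=> l lS; have := xb l lS; rewrite dotvZr mulrAC ler_pdivrMr.
Qed.

Lemma cone_volume_vectorE S b i : positively_dependent U S ->
  (forall l, 0 <= b l 0) -> i \in S -> 0 < b i 0 ->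
  (cone_volume_vector U S b i 0)%:E = vol (rg U S) (facet_cone S b i).
Proof.
move=> pd b0 iS bi; rewrite mxE iS vol_facet_cone// EFinM fineK//.
have rg0 := rg_gt0 iS; have c0 : 0 < b i 0 / (rg U S)%:R by rewrite divr_gt0// ltr0n.
have : vol (rg U S) (facet_cone S b i) \is a fin_num.
  have [nu [nuE _]] := vol_measure (erefl (rg U S)).
  have mC := measurable_facet_cone S b i.
  rewrite ge0_fin_numE ?vol_ge0//; apply: (@le_lt_trans _ _ (vol (rg U S) (polytope U S b))).
    rewrite !nuE//; [|exact: measurable_polytope|by move=> x []|by move=> x []].
    by apply: le_measure; rewrite ?inE//; [exact: measurable_polytope|exact: facet_cone_sub].
  by rewrite -ge0_fin_numE ?vol_ge0// vol_polytope_fin.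
(* The cone volume is a positive multiple of the face volume, so finiteness passes to the face and
   [fine] loses nothing. *)
rewrite vol_facet_cone//; have := vol_ge0 (rg U S - 1) (face U S b i).
by case: (vol _ _) => [r//|//|//] _; rewrite gt0_muley ?lte_fin.
Qed.

Lemma cone_volume_vector0 S b i : b i 0 = 0 -> cone_volume_vector U S b i 0 = 0.
Proof. by move=> bi; rewrite mxE bi !mul0r; case: ifP. Qed.

(** Take [i] maximizing <u_i, x> / b_i over the indices with b_i > 0; positive dependence makes the
    maximum positive. The cones are extended to infinity here, so that points outside P(S, b) are
    covered too, as [vol_polytope_le] requires. *)
Lemma facet_cone_cover S b x : positively_dependent U S -> (forall l, 0 <= b l 0) ->
  x \in lin U S -> x != 0 -> (forall l, l \in S -> b l 0 = 0 -> dotv (col l U) x <= 0) ->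
  exists i, [/\ i \in S, 0 < b i 0, 0 < dotv (col i U) x &
    forall l, l \in S -> b i 0 * dotv (col l U) x <= b l 0 * dotv (col i U) x].
Proof.
move=> pd b0 xS x0 xz.
have [i0 [i0S i0x]] : exists i, i \in S /\ 0 < dotv (col i U) x.
  apply: contrapT => h; move/eqP: x0; apply; apply: (positively_dependent_eq0 pd xS) => i iS.
  by rewrite leNgt; apply/negP => ix; apply: h; exists i.
have bpos l : l \in S -> 0 < dotv (col l U) x -> 0 < b l 0.
  move=> lS lx; rewrite lt_neqAle b0 andbT eq_sym; apply/eqP => bl.
  by have := xz l lS bl; rewrite leNgt lx.
pose P i := (i \in S) && (0 < b i 0).
pose f i := dotv (col i U) x / b i 0.
have Pi0 : P i0 by rewrite /P i0S bpos.
case: (@arg_maxP _ _ _ i0 P f Pi0) => i /andP[iS bi] imax.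
have fi : 0 < f i by apply: lt_le_trans (imax _ Pi0); rewrite divr_gt0// bpos.
have ix : 0 < dotv (col i U) x by move: fi; rewrite pmulr_lgt0// invr_gt0.
exists i; split => // l lS; have [bl|bl] := eqVneq (b l 0) 0.
  by rewrite bl mul0r; apply: mulr_ge0_le0; [exact: ltW|exact: xz].
have bl0 : 0 < b l 0 by rewrite lt_neqAle eq_sym bl b0.
have : f l <= f i by apply: imax; rewrite /P lS bl0.
by rewrite /f ler_pdivrMr// mulrAC ler_pdivlMr// mulrC [leRHS]mulrC.
Qed.

(** The overlap lies in the hyperplane orthogonal to [w]. If [w] were zero, comparing norms would
    give equal b_i and b_j, hence equal columns. *)
Lemma facet_cone_inter_null S b i j (nu : {measure set 'cV[R]_n -> \bar R}) :
  (forall w c, w \in lin U S -> w != 0 -> nu [set x | dotv w x = c] = 0%E) ->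
  i \in S -> j \in S -> i != j -> 0 < b i 0 -> 0 < b j 0 ->
  nu (facet_cone S b i `&` facet_cone S b j) = 0%E.
Proof.
move=> nu0 iS jS ij bi bj; apply/eqP; rewrite -measure_le0.
pose w := b i 0 *: col j U - b j 0 *: col i U.
have w0 : w != 0.
  apply: contra ij; rewrite subr_eq0 => /eqP h; apply/eqP/Uinj => /=.
  have := congr1 (fun z => dotv z z) h; rewrite !dotvZl !dotvZr !U1 !mulr1 => /eqP.
  rewrite -!expr2 eqrXn2 ?ltW// => /eqP e; move: h; rewrite e.
  move=> /(congr1 (fun z => (b j 0)^-1 *: z)).
  by rewrite !scalerA mulVf ?gt_eqF// !scale1r.
rewrite -(nu0 w 0 _ w0); last by rewrite rpredB ?memvZ ?mem_lin.
apply: le_measure; rewrite ?inE.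
- by apply: measurableI; exact: measurable_facet_cone.
- by apply: measurable_eq_fun; [exact: measurable_dotv|exact: measurable_cst].
move=> x [[_ _ h1] [_ _ h2]] /=; apply/eqP.
rewrite dotvC dotvBr !dotvZr ![dotv x _]dotvC subr_eq0 eq_le.
by rewrite h1//= h2.
Qed.

Lemma sum_cone_volume_vector S b : positively_dependent U S -> (0 < rg U S)%N ->
  (forall l, 0 <= b l 0) ->
  (\sum_(i in S) cone_volume_vector U S b i 0)%:E = vol (rg U S) (polytope U S b).
Proof.
move=> pd rg0 b0; have [nu [nuE nu0]] := vol_measure (erefl (rg U S)).
have mC := measurable_facet_cone S b.
(* Indices with b_i = 0 have entry zero, so only the cones of positive height are kept. *)
pose r := [seq i <- enum S | 0 < b i 0].
have rE i : (i \in r) = (i \in S) && (0 < b i 0).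
  by rewrite mem_filter mem_enum andbC.
pose C := \big[setU/set0]_(i <- r) facet_cone S b i.
have mCC : measurable C by apply: bigsetU_measurable => i _.
have CP x : C x <-> exists2 i, i \in r & facet_cone S b i x.
  by rewrite /C -bigcup_seq; split=> [[i /= ir ix]|[i ir ix]]; exists i.
have m0 : measurable [set 0 : 'cV[R]_n].
  rewrite (_ : [set 0] = [set x | x \in (0%VS : {vspace 'cV[R]_n})]).
    exact: measurable_vspace.
  by apply/seteqP; split => x /=; rewrite memv0 => /eqP.
have nu00 : nu [set 0] = 0%E.
  have [w wL w0] : exists2 w, w \in lin U S & w != 0.
    by exists (vpick (lin U S)); rewrite ?memv_pick// vpick0 -dimv_eq0 -lt0n.
  apply/eqP; rewrite -measure_le0 -(nu0 w 0 wL w0); apply: le_measure; rewrite ?inE//.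
    by apply: measurable_eq_fun; [exact: measurable_dotv|exact: measurable_cst].
  by move=> x /= ->; rewrite dotv0r.
have PE : nu (polytope U S b) = nu C.
  apply/eqP; rewrite eq_le; apply/andP; split.
    (* The covering lemma excludes the origin, so this null set is adjoined first. *)
    have -> : nu C = nu (C `|` [set 0]) by apply/esym; exact: measureU0.
    apply: le_measure; rewrite ?inE; [exact: measurable_polytope|exact: measurableU|].
    move=> x [xS xb]; have [->|x0] := eqVneq x 0; [by right|left].
    have [|i [iS bi ix il]] := facet_cone_cover pd b0 xS x0.
      by move=> l lS bl; have := xb l lS; rewrite bl.
    apply/CP; exists i; first by rewrite rE iS.
    by split => //; rewrite xb// ltW.
  apply: le_measure; rewrite ?inE//; first exact: measurable_polytope.
  move=> x /CP[i]; rewrite rE => /andP[iS bi]; exact: facet_cone_sub.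
rewrite nuE; [|exact: measurable_polytope|by move=> x []].
rewrite PE measure_bigsetU_null//; last 2 first.
- by rewrite filter_uniq// enum_uniq.
- move=> i j; rewrite !rE => /andP[iS bi] /andP[jS bj] ij.
  exact: facet_cone_inter_null.
rewrite (bigID (fun i => 0 < b i 0))/= [X in _ + X]big1 ?addr0; last first.
  move=> i /andP[iS]; rewrite -leNgt => bi; apply: cone_volume_vector0.
  by apply/eqP; rewrite eq_le bi b0.
rewrite big_filter big_enum_cond /= -sumEFin; apply: eq_bigr => i /andP[iS bi].
by rewrite (cone_volume_vectorE pd b0 iS bi) nuE// => x [].
Qed.

(** The facet cones for [b], extended to infinity, cover [lin U S]. Within the i-th one, the
    constraint of [i] puts P(S, b') inside the facet cone dilated by b'_i / b_i, which is [C i]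
    below. *)
Lemma vol_polytope_le S b b' : positively_dependent U S -> (0 < rg U S)%N ->
  (forall l, 0 < b l 0) -> (forall l, 0 < b' l 0) ->
  (vol (rg U S) (polytope U S b') <=
   (\sum_(i in S) (b' i 0 / b i 0) ^+ rg U S * cone_volume_vector U S b i 0)%:E)%E.
Proof.
move=> pd rg0 b0 b'0; have [nu [nuE nu0]] := vol_measure (erefl (rg U S)).
have b0' l : 0 <= b l 0 by rewrite ltW.
have mC := measurable_facet_cone S b.
pose C i := [set x | facet_cone S b i ((b i 0 / b' i 0) *: x)].
have mCi i : measurable (C i).
  have := preimage_mulmx_measurable ((b i 0 / b' i 0)%:M) (mC i).
  by congr measurable; apply/seteqP; split => x /=; rewrite mul_scalar_mx.
have q0 i : 0 < b i 0 / b' i 0 by rewrite divr_gt0.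
have CL i x : C i x -> x \in lin U S.
  by case=> h _ _; move: h; rewrite -[x in X in _ -> X](scalerK (lt0r_neq0 (q0 i))) => /memvZ ->.
apply: (@le_trans _ _ (\sum_(i <- enum S) nu (C i))%E); last first.
  rewrite big_enum /= -sumEFin; apply: lee_sum => i iS.
  rewrite EFinM (cone_volume_vectorE pd b0' iS (b0 i)) -nuE//; last exact: CL.
  rewrite vol_scale//; first by rewrite invf_div.
  have [Q [QQ QL]] := onb_exists (erefl (rg U S)).
  by exists (0, Q); split => //= x [/QL[y ->] _ _]; exists y; rewrite ?add0r.
rewrite nuE; [|exact: measurable_polytope|by move=> x []].
apply: le_trans (@measure_bigsetU_le _ _ _ nu _ _ C _) => //.
apply: le_measure; rewrite ?inE; [exact: measurable_polytope|by apply: bigsetU_measurable|].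
move=> x [xS xb]; rewrite -bigcup_seq /=.
have [x0|x0] := eqVneq x 0.
  have [i iS] : exists i, i \in S.
    apply: contrapT => h; move: rg0; rewrite /rg (_ : lin U S = 0%VS) ?dimv0//.
    apply/eqP; rewrite -subv0; apply: lin_subset => i iS; exfalso; by apply: h; exists i.
  exists i; first by rewrite /= mem_enum.
  rewrite x0 /C /= scaler0; split; rewrite ?mem0v ?dotv0r ?lexx ?b0'//.
  by move=> l _; rewrite !dotv0r !mulr0.
have [|i [iS bi ix il]] := facet_cone_cover pd b0' xS x0.
  by move=> l _ bl; have := b0 l; rewrite bl ltxx.
exists i; first by rewrite /= mem_enum.
have qn := q0 i; split; rewrite ?memvZ//.
  rewrite dotvZr; apply/andP; split; first by apply: mulr_ge0; exact: ltW.
  by rewrite mulrAC ler_pdivrMr// ler_pM2l//; exact: xb.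
move=> l lS; rewrite !dotvZr mulrCA [leRHS]mulrCA ler_pM2l//; exact: il.
Qed.

End Polytope.

(** * Splitting the cone-volume set *)

Section Splitting.
Variables (R : realType) (n m : nat) (U : 'M[R]_(n, m)).
Hypotheses (U1 : forall i, dotv (col i U) (col i U) = 1)
  (Uinj : injective (fun i => col i U)).
Implicit Types (S T : {set 'I_m}) (b : 'cV[R]_m).

Lemma polytope_ext S b b' : (forall i, i \in S -> b i 0 = b' i 0) ->
  polytope U S b = polytope U S b'.
Proof.
move=> bb'; apply/seteqP; split => x [xS xb]; split => // i iS.
  by rewrite -bb'//; exact: xb.
by rewrite bb'//; exact: xb.
Qed.

Lemma face_ext S b b' i : (forall i, i \in S -> b i 0 = b' i 0) -> i \in S ->
  face U S b i = face U S b' i.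
Proof. by move=> bb' iS; rewrite /face (polytope_ext bb') bb'. Qed.

Lemma cone_volume_vector_ext S b b' : (forall i, i \in S -> b i 0 = b' i 0) ->
  cone_volume_vector U S b = cone_volume_vector U S b'.
Proof.
move=> bb'; apply/matrixP => i j; rewrite !mxE; case: ifP => // iS.
by rewrite bb'// (face_ext bb' iS).
Qed.

Lemma fine_mulel (c : R) (x : \bar R) : 0 < c -> fine (c%:E * x)%E = c * fine x.
Proof.
move=> c0; case: x => [r//||] /=; first by rewrite gt0_muley ?lte_fin//= mulr0.
by rewrite gt0_muleNy ?lte_fin//= mulr0.
Qed.

Lemma cone_volume_vectorZ S b a : 0 < a ->
  cone_volume_vector U S (a *: b) = a ^+ rg U S *: cone_volume_vector U S b.
Proof.
move=> a0; apply/matrixP => i j; rewrite !mxE; case: ifP => [iS|]; last by rewrite mulr0.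
rewrite (vol_faceZ U1 _ a0 iS).
rewrite fine_mulel ?exprn_gt0//.
have -> : a ^+ rg U S = a * a ^+ (rg U S - 1) by rewrite -exprS -(dim_lin_prednK U1 iS).
by move: (fine _) (a ^+ _) (_^-1) (b i 0) => f e k c; ring.
Qed.

Lemma root_exists (x : R) k : 0 < x -> (0 < k)%N -> exists2 y, 0 < y & y ^+ k = x.
Proof.
move=> x0 k0; exists (x `^ k%:R^-1); first exact: powR_gt0.
by rewrite -powR_mulrn ?powR_ge0// -powRrM mulVf ?pnatr_eq0 -?lt0n// powRr1// ltW.
Qed.

(** Scaling [b] by [y] multiplies the volume and the cone-volume vector by the same power
    [y ^+ rg U S]; [y] is chosen to make this [v^-1]. *)
Lemma Ccv_normalize S b v : (0 < rg U S)%N -> (forall i, 0 <= b i 0) -> 0 < v ->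
  vol (rg U S) (polytope U S b) = v%:E -> Ccv U S (v^-1 *: cone_volume_vector U S b).
Proof.
move=> k0 b0 v0 bv; have vV : 0 < v^-1 by rewrite invr_gt0.
have [y y0 yk] := root_exists vV k0.
exists (y *: b); last by rewrite cone_volume_vectorZ// yk.
split; first by move=> i; rewrite mxE mulr_ge0// ltW.
by rewrite vol_polytopeZ// yk bv -EFinM mulVf// gt_eqF.
Qed.

(** The part of the relation on [T] is minus the part on [S :\: T]; it lies in both spans and hence
    vanishes. *)
Lemma positively_dependent_split S T : positively_dependent U S -> T \subset S ->
  (lin U T :&: lin U (S :\: T) = 0)%VS -> positively_dependent U T.
Proof.
move=> [c [cp c0]] TS TT; exists c; split; first by move=> i /(fintype.subsetP TS)/cp.
have := c0; rewrite (big_setID T)/= (finset.setIidPr TS) => /eqP; rewrite addr_eq0 => /eqP h.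
apply/eqP; rewrite -memv0 -TT memv_cap; apply/andP; split.
  by apply: memv_suml => i iT; rewrite memvZ// mem_lin.
by rewrite h memvN; apply: memv_suml => i iT; rewrite memvZ// mem_lin.
Qed.

Section TwoParts.
Variables (S1 S2 : {set 'I_m}).
Variables (E1 E2 : 'M[R]_n) (D : R).
Hypothesis rgS : rg U (S1 :|: S2) = (rg U S1 + rg U S2)%N.
Hypothesis chart : product_chart (rg U S1) (rg U S2) (lin U S1) (lin U S2) E1 E2 D.

(** [E1] and [E2] preserve products with the columns of [S1] and [S2], so the constraints
    separate. *)
Lemma vol_polytope_product b :
  vol (rg U S1 + rg U S2) (polytope U (S1 :|: S2) b) =
  (D%:E * (vol (rg U S1) (polytope U S1 b) * vol (rg U S2) (polytope U S2 b)))%E.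
Proof.
have [EL Edot Esurj D0 volE] := chart.
apply: volE; try exact: measurable_polytope.
- by move=> x [xS _]; rewrite -lin_setU.
- by move=> x [].
- by move=> x [].
move=> x xL; split=> [[xS xb]|[[x1 xb1] [x2 xb2]]].
  split; split => //; do ?by have [] := EL x.
    by move=> i iS; rewrite (proj1 (Edot x _)) ?mem_lin// xb// inE iS.
  by move=> i iS; rewrite (proj2 (Edot x _)) ?mem_lin// xb// inE iS orbT.
split; first by rewrite lin_setU.
move=> i; rewrite inE => /orP[iS|iS].
  by rewrite -(proj1 (Edot x _)) ?mem_lin// xb1.
by rewrite -(proj2 (Edot x _)) ?mem_lin// xb2.
Qed.

Lemma vol_face_product b i : i \in S1 ->
  vol (rg U S1 + rg U S2 - 1) (face U (S1 :|: S2) b i) =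
  (D%:E * (vol (rg U S1 - 1) (face U S1 b i) * vol (rg U S2) (polytope U S2 b)))%E.
Proof.
move=> iS1; have [EL Edot Esurj D0 volE] := chart.
have u1 := mem_lin U iS1; have e1 := U1 i.
have iS : i \in S1 :|: S2 by rewrite inE iS1.
have uS := mem_lin U iS; rewrite lin_setU in uS.
(* [w] projects to [col i U] on the first span and to 0 on the second. Sweeping along it moves only
   the first component, so the thickened face remains a product. *)
have [w [wL E1w E2w]] := Esurj (col i U) 0 u1 (mem0v _).
have uw : dotv (col i U) w = 1 by rewrite -(proj1 (Edot w _)) ?E1w.
have dS1 := dim_lin_prednK U1 iS1.
have r1 : (0 < rg U S1)%N := rg_gt0 U1 iS1.
(* Thicken the faces to prisms, to which the product formula for subsets of
   full dimension applies. *)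
pose prism (V : {set 'I_m}) w : set 'cV[R]_n := [set x | [/\ x \in lin U V,
  b i 0 <= dotv (col i U) x <= b i 0 + 1 &
  face U V b i (x - (dotv (col i U) x - b i 0) *: w)]].
have mprism V z : measurable (prism V z).
  have mdot : measurable_fun setT (dotv (col i U)) by exact: measurable_dotv.
  have mshear : measurable_fun setT (fun x : 'cV[R]_n => x - (dotv (col i U) x - b i 0) *: z).
    apply: measurable_columnP => j; under eq_fun do rewrite !mxE.
    apply: measurable_funB; first exact: measurable_coord.
    apply: measurable_funM; last exact: measurable_cst.
    by apply: measurable_funB => //; exact: measurable_cst.
  rewrite (_ : prism V z = [set x | x \in lin U V] `&`
    ([set x | b i 0 <= dotv (col i U) x] `&` [set x | dotv (col i U) x <= b i 0 + 1]) `&`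
    [set x | face U V b i (x - (dotv (col i U) x - b i 0) *: z)]).
    apply: measurableI.
      apply: measurableI; first exact: measurable_vspace.
      apply: measurableI; last exact: measurable_dotv_le.
      by apply: measurable_le_fun => //; exact: measurable_cst.
    by rewrite -[X in measurable X]setTI; apply: (mshear measurableT); exact: measurable_face.
  apply/seteqP; split => x /=; first by case=> ? /andP[].
  by move=> [[? [? ?]] ?]; split => //; apply/andP.
have dS : \dim (lin U S1 + lin U S2)%VS = (rg U S1 + rg U S2 - 1).+1.
  by rewrite -lin_setU -rgS (dim_lin_prednK U1 iS).
have -> : vol (rg U S1 + rg U S2 - 1) (face U (S1 :|: S2) b i) =
    vol (rg U S1 + rg U S2) (prism (S1 :|: S2) w).
  have := @vol_prism R n _ _ _ uS e1 dS (prism (S1 :|: S2) w) (face U (S1 :|: S2) b i)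
    (b i 0) w (mprism _ _) (measurable_face _ _ _ _) wL uw.
  rewrite (_ : (_ - 1).+1 = rg U S1 + rg U S2)%N; last by rewrite subn1 prednK// addn_gt0 r1.
  move=> ->//; first by move=> x [_]; rewrite lin_setU.
  by move=> x; rewrite -lin_setU.
have -> : vol (rg U S1 - 1) (face U S1 b i) = vol (rg U S1) (prism S1 (col i U)).
  have := @vol_prism R n _ _ _ u1 e1 dS1 (prism S1 (col i U)) (face U S1 b i)
    (b i 0) (col i U) (mprism _ _) (measurable_face _ _ _ _) u1 e1.
  by rewrite (_ : (_ - 1).+1 = rg U S1)%N; [move=> ->//; move=> x [_]|rewrite subn1 prednK].
apply: volE; try exact: mprism; try exact: measurable_polytope.
- by move=> x []; rewrite lin_setU.
- by move=> x [].
- by move=> x [].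
move=> x xL.
have d1 l : l \in S1 -> dotv (col l U) (E1 *m x) = dotv (col l U) x.
  by move=> lS; rewrite (proj1 (Edot x _)) ?mem_lin.
have d2 l : l \in S2 -> dotv (col l U) (E2 *m x) = dotv (col l U) x.
  by move=> lS; rewrite (proj2 (Edot x _)) ?mem_lin.
have w1 l : l \in S1 -> dotv (col l U) w = dotv (col l U) (col i U).
  by move=> lS; rewrite -(proj1 (Edot w _)) ?mem_lin ?E1w.
have w2 l : l \in S2 -> dotv (col l U) w = 0.
  by move=> lS; rewrite -(proj2 (Edot w _)) ?mem_lin ?E2w// dotv0r.
have [x1L x2L] := EL x.
rewrite /prism /= d1//; split.
  move=> [_ xb [[_ xP] [_ xe]]]; split; split => //.
    split; split => //; first by rewrite rpredB// memvZ.
      move=> l lS; have := xP l; rewrite inE lS => /(_ isT).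
      by rewrite !dotvBr !dotvZr w1// d1.
    by rewrite rpredB// memvZ.
    by rewrite dotvBr dotvZr e1 d1// mulr1 opprB addrC subrK.
  move=> l lS; have := xP l; rewrite inE lS orbT => /(_ isT).
  by rewrite dotvBr dotvZr w2// mulr0 subr0 d2.
move=> [[_ xb [[_ xP] [_ xe]]] [_ xP2]].
have xwL : x - (dotv (col i U) x - b i 0) *: w \in lin U (S1 :|: S2).
  by rewrite lin_setU rpredB// memvZ.
split => //; first by rewrite lin_setU.
split; split => //.
  move=> l; rewrite inE => /orP[lS|lS].
    by have := xP l lS; rewrite !dotvBr !dotvZr w1// d1.
  by rewrite dotvBr dotvZr w2// mulr0 subr0 -d2// xP2.
by rewrite dotvBr dotvZr uw mulr1 opprB addrC subrK.
Qed.

Lemma cone_volume_vector_product b i v : i \in S1 ->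
  vol (rg U S2) (polytope U S2 b) = v%:E -> 0 < v ->
  cone_volume_vector U (S1 :|: S2) b i 0 =
  (rg U S1)%:R / (rg U (S1 :|: S2))%:R * (D * v) * cone_volume_vector U S1 b i 0.
Proof.
move=> iS1 bv v0; have [_ _ _ D0 _] := chart.
have r1 : (0 < rg U S1)%N := rg_gt0 U1 iS1.
rewrite !mxE inE iS1 /= rgS vol_face_product// bv.
have Dv : 0 < D * v by exact: mulr_gt0.
rewrite [X in fine X](_ : _ = (D * v)%:E * vol (rg U S1 - 1) (face U S1 b i))%E; last first.
  by rewrite [(vol _ _ * _)%E]muleC muleA EFinM.
rewrite fine_mulel//.
have k1 : (rg U S1)%:R != 0 :> R by rewrite pnatr_eq0 -lt0n.
have k12 : (rg U S1 + rg U S2)%:R != 0 :> R by rewrite pnatr_eq0 -lt0n addn_gt0 r1.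
move: (fine _) ((rg U S1)%:R) ((_ + _)%:R) (b i 0) k1 k12 => f c1 c12 c k1 k12.
by field; rewrite k1 k12.
Qed.

End TwoParts.

(** The entries on [T] pick up the factor [D * v2] and those on the complement [D * v1], where v1
    and v2 are the volumes of the two parts. *)
Lemma Ccv_split S T : positively_dependent U S -> T \subset S ->
  T != finset.set0 -> S :\: T != finset.set0 ->
  (lin U T :&: lin U (S :\: T) = 0)%VS ->
  Ccv U S = [set x | exists y z, [/\ Ccv U T y, Ccv U (S :\: T) z &
    x = (rg U T)%:R / (rg U S)%:R *: y + (rg U (S :\: T))%:R / (rg U S)%:R *: z]].
Proof.
move=> pd TS T0 T'0 TT; set T' := S :\: T in T'0 TT *.
have SE : S = T :|: T' by rewrite /T' -{1}(finset.setIidPr TS) finset.setID.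
have TT' i : i \in T -> i \notin T' by rewrite inE => ->.
have pT := positively_dependent_split pd TS TT.
have pT' : positively_dependent U T'.
  apply: (positively_dependent_split pd); first exact: subsetDl.
  by rewrite /T' finset.setDDr finset.setDv finset.set0U (finset.setIidPr TS) -/T' capvC.
have rT : (0 < rg U T)%N by case/set0Pn: T0 => i; exact: rg_gt0.
have rT' : (0 < rg U T')%N by case/set0Pn: T'0 => i; exact: rg_gt0.
have rgS : rg U (T :|: T') = (rg U T + rg U T')%N.
  by rewrite /rg lin_setU dimv_disjoint_sum.
have rgS' : rg U (T' :|: T) = (rg U T' + rg U T)%N by rewrite finset.setUC rgS addnC.
have rS : (0 < rg U S)%N by rewrite SE rgS addn_gt0 rT.
have [E1 [E2 [D ch]]] := product_chart_exists (erefl (rg U T)) (erefl (rg U T')) TT.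
have ch' := product_chart_sym ch; have D0 : 0 < D by case: ch.
have volS b : vol (rg U S) (polytope U S b) = (D%:E *
    (vol (rg U T) (polytope U T b) * vol (rg U T') (polytope U T' b)))%E.
  by rewrite -(vol_polytope_product ch) -rgS -SE.
pose k1 : R := (rg U T)%:R / (rg U S)%:R; pose k2 : R := (rg U T')%:R / (rg U S)%:R.
have gamma b v1 v2 : vol (rg U T) (polytope U T b) = v1%:E ->
    vol (rg U T') (polytope U T' b) = v2%:E -> 0 < v1 -> 0 < v2 ->
    cone_volume_vector U S b = (k1 * (D * v2)) *: cone_volume_vector U T b
      + (k2 * (D * v1)) *: cone_volume_vector U T' b.
  move=> e1 e2 v10 v20; apply/matrixP => i j.
  rewrite ord1 [RHS]mxE [X in _ = X + _]mxE [X in _ = _ + X]mxE.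
  have [iT|iT] := boolP (i \in T).
    have iT' := TT' i iT; rewrite {1}SE (cone_volume_vector_product rgS ch iT e2 v20).
    rewrite [cone_volume_vector U T' b i 0]mxE (negbTE iT') mulr0 addr0.
    by rewrite -SE.
  have [iT'|iT'] := boolP (i \in T').
    rewrite {1}SE finset.setUC (cone_volume_vector_product rgS' ch' iT' e1 v10).
    rewrite [cone_volume_vector U T b i 0]mxE (negbTE iT) mulr0 add0r.
    by rewrite finset.setUC -SE.
  rewrite !mxE (negbTE iT) (negbTE iT') !mulr0 addr0 SE inE (negbTE iT) (negbTE iT') //.
have fin1 b := vol_polytope_fin b pT; have fin2 b := vol_polytope_fin b pT'.
apply/seteqP; split => [x [b [b0 bS] <-]|x [y [z [[b1 [b10 e1] <-] [b2 [b20 e2] <-] ->]]]].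
  pose v1 := fine (vol (rg U T) (polytope U T b)).
  pose v2 := fine (vol (rg U T') (polytope U T' b)).
  have e1 : vol (rg U T) (polytope U T b) = v1%:E by rewrite fineK.
  have e2 : vol (rg U T') (polytope U T' b) = v2%:E by rewrite fineK.
  have v10 : 0 <= v1 by rewrite fine_ge0// vol_ge0.
  have v20 : 0 <= v2 by rewrite fine_ge0// vol_ge0.
  have D1 : D * (v1 * v2) = 1.
    by move: bS; rewrite volS e1 e2 -!EFinM => -[].
  have v1p : 0 < v1.
    rewrite lt_neqAle v10 andbT; apply: contra_eq_neq D1 => <-.
    by rewrite mul0r mulr0 eq_sym oner_eq0.
  have v2p : 0 < v2.
    rewrite lt_neqAle v20 andbT; apply: contra_eq_neq D1 => <-.
    by rewrite !mulr0 eq_sym oner_eq0.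
  exists (v1^-1 *: cone_volume_vector U T b), (v2^-1 *: cone_volume_vector U T' b).
  split; [exact: Ccv_normalize|exact: Ccv_normalize|].
  (* Total volume one means D v1 v2 = 1, so [D * v2] is the inverse of v1 and [D * v1] that of v2:
     both parts come out normalized. *)
  rewrite (gamma b v1 v2)// !scalerA; congr (_ *: _ + _ *: _); congr (_ * _).
    by apply: (mulIf (lt0r_neq0 v1p)); rewrite mulVf ?gt_eqF// -mulrA [v2 * v1]mulrC.
  by apply: (mulIf (lt0r_neq0 v2p)); rewrite mulVf ?gt_eqF// -mulrA.
(* Conversely, gluing two normalized right-hand sides gives volume [D], and the final normalization
   cancels this constant. *)
pose b : 'cV[R]_m := \col_i (if i \in T then b1 i 0 else b2 i 0).
have b0 i : 0 <= b i 0 by rewrite mxE; case: ifP.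
have bT i : i \in T -> b i 0 = b1 i 0 by move=> iT; rewrite mxE iT.
have bT' i : i \in T' -> b i 0 = b2 i 0.
  by rewrite mxE inE => /andP[/negbTE -> _].
rewrite -(polytope_ext bT) in e1; rewrite -(polytope_ext bT') in e2.
have bS : vol (rg U S) (polytope U S b) = D%:E by rewrite volS e1 e2 !mule1.
have := Ccv_normalize rS b0 D0 bS; congr (Ccv U S _).
rewrite (gamma b 1 1)// !mulr1 scalerDr !scalerA !(mulrC D^-1) !mulfK ?gt_eqF//.
by rewrite (cone_volume_vector_ext bT) (cone_volume_vector_ext bT').
Qed.

End Splitting.

Section MinkowskiSum.
Variables (R : realType) (n : nat) (I : finType).
Implicit Types (P : {set I}) (A : I -> set 'cV[R]_n).

Lemma minkowski_sum_setU1 P A j : j \notin P ->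
  minkowski_sum (j |: P)%SET A =
  [set x | exists y z, [/\ A j y, minkowski_sum P A z & x = y + z]].
Proof.
move=> jP; apply/seteqP; split => x.
  move=> [y [yA ->]]; rewrite big_setU1//=.
  exists (y j), (\sum_(i in P) y i); split=> //; first by apply: yA; rewrite setU11.
  by exists y; split => // i iP; apply: yA; rewrite inE iP orbT.
move=> [y [_ [Ay [z [zA ->]] ->]]].
exists (fun i => if i == j then y else z i); split.
  move=> i; rewrite !inE; case: eqVneq => [->//|_ /= iP]; exact: zA.
rewrite big_setU1//= eqxx; congr (_ + _); apply: eq_bigr => i iP.
by rewrite ifN//; apply: contraNneq jP => <-.
Qed.

End MinkowskiSum.

(** * The splitting procedure *)

Section Reachable.
Variables (R : realType) (n m : nat) (U : 'M[R]_(n, m)).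
Hypotheses (U1 : forall i, dotv (col i U) (col i U) = 1)
  (Uinj : injective (fun i => col i U)).
Implicit Types (S T : {set 'I_m}) (P : {set {set 'I_m}}).

Lemma rg_set0 : rg U finset.set0 = 0%N.
Proof.
apply/eqP; rewrite dimv_eq0 -subv0; apply: lin_subset => i; by rewrite inE.
Qed.

Lemma splitting_flatsP S T : T \in splitting_flats U S ->
  [/\ T \subset S, T != finset.set0, S :\: T != finset.set0 &
      (lin U T :&: lin U (S :\: T) = 0)%VS].
Proof.
rewrite !inE => /andP[/and3P[TS /andP[rT rTS] _] /eqP TT]; split => //.
  by apply: contraTneq rT => ->; rewrite rg_set0.
rewrite finset.setD_eq0; apply: contraTN rTS => ST.
have <- : T = S by apply/eqP; rewrite finset.eqEsubset TS ST.
by rewrite -ltnNge subn1 prednK.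
Qed.

(** The three conclusions are proved by one induction: splitting a block further needs its positive
    dependence and its disjointness from the others. *)
Lemma reachable_Ccv P : rg U [set: 'I_m]%SET = n -> positively_dependent U [set: 'I_m]%SET ->
  [set: 'I_m]%SET != finset.set0 -> reachable U P ->
  [/\ finset.partition P [set: 'I_m]%SET, forall S, S \in P -> positively_dependent U S &
    Ccv U [set: 'I_m]%SET =
      minkowski_sum P (fun S => scale_set ((rg U S)%:R / n%:R) (Ccv U S))].
Proof.
move=> rU pdU U0; elim => [|{}P S T _ [/and3P[/eqP Pcov Ptriv P0] Ppd PC] SP Tsplit].
  split.
  - apply/and3P; split; [by rewrite /finset.cover big_set1|exact: finset.trivIset1|].
    by rewrite inE eq_sym.
  - by move=> S; rewrite inE => /eqP ->.
  apply/seteqP; split => x.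
    move=> Ux; exists (fun=> x); split; last by rewrite big_set1.
    move=> S; rewrite inE => /eqP ->; exists x => //.
    have n0 : (n%:R : R) != 0.
      rewrite pnatr_eq0 -lt0n -rU; have /set0Pn[i iU] := U0; exact: (rg_gt0 U1 iU).
    by rewrite rU divff// scale1r.
  move=> [y [yU ->]]; rewrite big_set1; have := yU [set: 'I_m]%SET.
  rewrite inE eqxx => /(_ isT)[z zU <-].
  have n0 : (n%:R : R) != 0.
    rewrite pnatr_eq0 -lt0n -rU; have /set0Pn[i iU] := U0; exact: (rg_gt0 U1 iU).
  by rewrite rU divff// scale1r.
have [TS T0 T'0 TT] := splitting_flatsP Tsplit.
have pdS := Ppd S SP.
have pdT := positively_dependent_split pdS TS TT.
have pdT' : positively_dependent U (S :\: T).
  apply: (positively_dependent_split pdS); first exact: subsetDl.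
  by rewrite finset.setDDr finset.setDv finset.set0U (finset.setIidPr TS) capvC.
have disjP (V W : {set 'I_m}) : V \subset S -> W \in (P :\ S)%SET ->
    fintype.disjoint (mem V) (mem W).
  move=> VS; rewrite !inE => /andP[WS WP].
  have /finset.trivIsetP/(_ S W SP WP) := Ptriv; rewrite eq_sym WS => /(_ isT).
  exact: fintype.disjointWl.
have PStriv : finset.trivIset (P :\ S)%SET by apply: finset.trivIsetS Ptriv; exact: subsetDl.
have PS0 : finset.set0 \notin (P :\ S)%SET by rewrite !inE negb_and P0 orbT.
have [triv1 T'n] := trivIsetU1 (fun W => disjP _ W (subsetDl S T)) PStriv PS0.
have PT'0 : finset.set0 \notin ((S :\: T) |: (P :\ S))%SET.
  by rewrite in_setU1 negb_or PS0 andbT eq_sym.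
have [triv2 TnT'] : finset.trivIset (T |: ((S :\: T) |: (P :\ S)))%SET /\
    T \notin ((S :\: T) |: (P :\ S))%SET.
  apply: trivIsetU1 => // W; rewrite in_setU1 => /orP[/eqP ->|]; last exact: disjP.
  by rewrite -finset.setI_eq0 finset.setIDA (finset.setIidPl TS) finset.setDv.
have PE : P = (S |: (P :\ S))%SET by rewrite finset.setD1K.
have Sn : S \notin (P :\ S)%SET by rewrite !inE eqxx.
have STE : T :|: (S :\: T) = S by rewrite -{1}(finset.setIidPr TS) finset.setID.
split.
- apply/and3P; split.
  + by rewrite -Pcov {2}PE /finset.cover !big_setU1//= finset.setUA STE.
  + exact: triv2.
  + by rewrite in_setU1 negb_or PT'0 andbT eq_sym.
- move=> V; rewrite !inE => /or3P[/eqP ->//|/eqP ->//|/andP[_ /Ppd]//].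
rewrite PC {1}PE !minkowski_sum_setU1//.
have rS0 : (rg U S)%:R != 0 :> R.
  have /set0Pn[i iT] := T0; rewrite pnatr_eq0 -lt0n; exact: (rg_gt0 U1 (fintype.subsetP TS i iT)).
(* The rank ratios telescope when the splitting of [S] is inserted into the sum. *)
have kE V : (rg U S)%:R / n%:R * ((rg U V)%:R / (rg U S)%:R) = (rg U V)%:R / n%:R :> R.
  by rewrite mulrC -mulrA mulKf.
apply/seteqP; split => x.
  move=> [_ [z [[s sS <-] zP ->]]].
  move: sS; rewrite (Ccv_split U1 pdS TS T0 T'0 TT) => -[y1 [y2 [y1T y2T ->]]].
  exists ((rg U T)%:R / n%:R *: y1), ((rg U (S :\: T))%:R / n%:R *: y2 + z); split.
  - by exists y1.
  - by exists ((rg U (S :\: T))%:R / n%:R *: y2), z; split => //; exists y2.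
  - by rewrite scalerDr !scalerA !kE addrA.
move=> [_ [_ [[y1 y1T <-] [_ [z [[y2 y2T <-] zP ->]]] ->]]].
exists ((rg U T)%:R / n%:R *: y1 + (rg U (S :\: T))%:R / n%:R *: y2), z; split => //.
  exists ((rg U T)%:R / (rg U S)%:R *: y1 + (rg U (S :\: T))%:R / (rg U S)%:R *: y2).
    by rewrite (Ccv_split U1 pdS TS T0 T'0 TT); exists y1, y2.
  by rewrite scalerDr !scalerA !kE.
by rewrite addrA.
Qed.

End Reachable.

(** * Invariance of the volume and rigidity on irreducible blocks *)

Section Invariance.
Variables (R : realType) (n m : nat) (U : 'M[R]_(n, m)).
Hypotheses (U1 : forall i, dotv (col i U) (col i U) = 1)
  (Uinj : injective (fun i => col i U)).
Implicit Types (S T : {set 'I_m}) (b w : 'cV[R]_m).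

(** This change of right-hand side translates the polytope by [v]. *)
Lemma vol_polytope_shift S b v : v \in lin U S ->
  vol (rg U S) (polytope U S (b + U^T *m v)) = vol (rg U S) (polytope U S b).
Proof.
move=> vS; have [Q oQ] := onb_exists (erefl (rg U S)).
rewrite !(vol_subspace oQ (measurable_polytope U S _) (@polytope_subset_lin _ _ _ _ S _)).
rewrite -[RHS](lam_shift (- (Q^T *m v))); last first.
  by apply: preimage_mulmx_measurable; exact: measurable_polytope.
congr lam; apply/funext => y /=; apply/propext.
rewrite mulmxBr (onb_proj oQ vS); split=> -[yS yb]; split.
- by rewrite rpredB.
- by move=> i iS; have := yb i iS; rewrite mxE mulmxE_dotv dotvBr lerBlDr.
- exact: onb_mem.
- by move=> i iS; have := yb i iS; rewrite mxE mulmxE_dotv dotvBr lerBlDr.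
Qed.

Local Notation S := [set: 'I_m]%SET.
Local Notation k := (rg U S).
Hypotheses (pdU : positively_dependent U S) (k0 : (0 < k)%N).

Definition polytope_volume b : R := fine (vol k (polytope U S b)).
Local Notation V := polytope_volume.

Lemma polytope_volumeE b : vol k (polytope U S b) = (V b)%:E.
Proof. by rewrite fineK// vol_polytope_fin. Qed.

Lemma polytope_volume_gt0 b : (forall i, 0 < b i 0) -> 0 < V b.
Proof.
by move=> b0; rewrite -lte_fin -polytope_volumeE; apply: vol_polytope_gt0.
Qed.

Lemma polytope_volume_le b b' : (forall i, b i 0 <= b' i 0) -> V b <= V b'.
Proof.
move=> bb'; have [nu [nuE _]] := vol_measure (erefl k).
rewrite -lee_fin -!polytope_volumeE !nuE; try exact: measurable_polytope;
  try by move=> x [].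
apply: le_measure; rewrite ?inE; try exact: measurable_polytope.
by move=> x [xS xb]; split => // i iS; exact: le_trans (xb i iS) (bb' i).
Qed.

(** With entries 1/(N+1) on [C] and [M] elsewhere, the polytopes decrease to a set on which the
    products with the columns of [C] are nonpositive, hence zero: a null set. Continuity from above
    yields an [N], and monotonicity extends the bound to all smaller [b]. *)
Lemma thin_polytope_volume (C : {set 'I_m}) M e : positively_dependent U C ->
  C != finset.set0 -> 0 < e ->
  exists2 d, 0 < d & forall b, (forall i, i \in C -> b i 0 <= d) ->
    (forall i, b i 0 <= M) -> V b < e.
Proof.
move=> pdC /set0Pn[i0 i0C] e0; have [nu [nuE nu0]] := vol_measure (erefl k).
pose b_ N : 'cV[R]_m := \col_i (if i \in C then N.+1%:R^-1 else M).
pose F N := polytope U S (b_ N).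
have mF N : measurable (F N) by exact: measurable_polytope.
have FE N : nu (F N) = (V (b_ N))%:E.
  by rewrite -polytope_volumeE nuE; [|exact: mF|move=> x []].
have Fdec : {homo F : p q / (p <= q)%N >-> (q <= p)%O}.
  move=> p q pq; apply/subsetPset => x [xS xb]; split => // i iS.
  apply: le_trans (xb i iS) _; rewrite !mxE; case: ifP => // _.
  by rewrite lef_pV2 ?posrE// ler_nat.
have mI : measurable (\bigcap_N F N) by exact: bigcap_measurable.
have I0 : nu (\bigcap_N F N) = 0%E.
  apply/eqP; rewrite -measure_le0.
  have un0 : col i0 U != 0 by rewrite -dotvv_eq0 U1 oner_eq0.
  rewrite -(nu0 (col i0 U) 0 _ un0) ?mem_lin//.
  apply: le_measure; rewrite ?inE//.
    by apply: measurable_eq_fun; [exact: measurable_dotv|exact: measurable_cst].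
  move=> x Fx /=; apply: (positively_dependent_dotv0 pdC) => // i iC.
  rewrite leNgt; apply/negP => ix.
  have [N] : exists N, N.+1%:R^-1 < dotv (col i U) x.
    exists (Num.truncn (dotv (col i U) x)^-1).
    by rewrite invf_plt ?posrE//; exact: truncnS_gt.
  have [_ /(_ i)] := Fx N I; rewrite mxE iC inE => /(_ isT) h h'.
  by have := lt_le_trans h' h; rewrite ltxx.
have : nu \o F @ \oo --> 0%E.
  rewrite -I0; apply: nonincreasing_cvg_mu => //.
  by rewrite FE ltry.
move=> /fine_cvgP[_ /cvgrPdist_lt/(_ e e0)[N _ /(_ N (leqnn N))]].
rewrite /= FE /= sub0r normrN => hN; exists N.+1%:R^-1; first by rewrite invr_gt0.
move=> b bC bM; apply: le_lt_trans (le_lt_trans (ler_norm _) hN).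
by apply: polytope_volume_le => i; rewrite mxE; case: ifP => iC; [exact: bC|exact: bM].
Qed.

Definition positive b := forall i, 0 < b i 0.

(** Only positive vectors are compared, because the torus invariance is derived for them alone. The
    price is paid in the lemma on sums. *)
Definition volume_invariant w := forall t b,
  positive b -> positive (b + t *: w) -> V (b + t *: w) = V b.

Lemma volume_invariantZ c w : volume_invariant w -> volume_invariant (c *: w).
Proof. by move=> Iw t b; rewrite scalerA; exact: Iw. Qed.

Lemma volume_invariant0 : volume_invariant 0.
Proof. by move=> t b _ _; rewrite scaler0 addr0. Qed.

(** Moving along [w1] first could leave the positive orthant. The segment is therefore cut into
    short pieces, each replaced by a small detour. *)
Lemma volume_invariantD w1 w2 :
  volume_invariant w1 -> volume_invariant w2 -> volume_invariant (w1 + w2).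
Proof.
move=> I1 I2 t b; set w := t *: (w1 + w2) => b0 bw0.
pose mn i := Num.min (b i 0) ((b + w) i 0).
have mn0 i : 0 < mn i by rewrite lt_min b0 bw0.
(* Coordinates on the segment are at least [mn i], and N+1 > q makes the detour t w1_i / (N+1)
   smaller than that in absolute value. *)
pose q := \sum_i `|(t *: w1) i 0| / mn i.
have q0 i : 0 <= `|(t *: w1) i 0| / mn i by rewrite divr_ge0// ltW.
have [N Nq] : exists N, q < N.+1%:R.
  exists (Num.truncn q); apply: truncnS_gt.
have N0 : 0 < N.+1%:R :> R by [].
have seg (s : R) : 0 <= s <= 1 -> positive (b + s *: w) /\
    positive (b + s *: w + N.+1%:R^-1 *: (t *: w1)).
  move=> /andP[s0 s1].
  have mnle i : mn i <= (b + s *: w) i 0.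
    have h1 : mn i <= b i 0 by rewrite ge_min lexx.
    have h2 : mn i <= (b + w) i 0 by rewrite ge_min lexx orbT.
    move: h1 h2; rewrite !mxE; move: (mn i) (b i 0) (_ * _) => x y z h1 h2.
    nra.
  split=> i; first exact: lt_le_trans (mn0 i) (mnle i).
  rewrite mxE; apply: (@lt_le_trans _ _ (mn i + (N.+1%:R^-1 *: (t *: w1)) i 0)); last first.
    by rewrite lerD2r.
  rewrite [X in _ + X]mxE -ltrBlDl sub0r.
  have h : `|(t *: w1) i 0| / mn i < N.+1%:R.
    apply: le_lt_trans Nq; rewrite /q (bigD1 i)//= lerDl; exact: sumr_ge0.
  have : `|(t *: w1) i 0| < mn i * N.+1%:R by rewrite mulrC -ltr_pdivrMr.
  rewrite ltr_norml => /andP[h1 _].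
  by rewrite mulrC ltr_pdivlMr// mulNr.
have step j : (j <= N.+1)%N -> V (b + (j%:R / N.+1%:R) *: w) = V b.
  elim: j => [|j IH] jN; first by rewrite mul0r scale0r addr0.
  have jN' : 0 <= (j%:R / N.+1%:R : R) <= 1.
    by rewrite divr_ge0//= ler_pdivrMr// mul1r ler_nat ltnW.
  have jN'' : 0 <= (j.+1%:R / N.+1%:R : R) <= 1.
    by rewrite divr_ge0//= ler_pdivrMr// mul1r ler_nat.
  have [p1 p2] := seg _ jN'; have [p3 _] := seg _ jN''.
  rewrite -(IH (ltnW jN)).
  have e : b + (j.+1%:R / N.+1%:R) *: w = b + (j%:R / N.+1%:R) *: w
      + (N.+1%:R^-1 * t) *: w1 + (N.+1%:R^-1 * t) *: w2.
    rewrite -addrA -scalerDr -[(_ * t) *: _]scalerA -/w -addrA -scalerDl; congr (_ + _ *: _).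
    by rewrite -natr1 mulrDl mul1r.
  rewrite (scalerA N.+1%:R^-1 t w1) in p2; rewrite e in p3 *.
  by rewrite I2//; exact: I1.
by have := step N.+1 (leqnn _); rewrite divff ?gt_eqF// scale1r.
Qed.

Lemma volume_invariant_sum (I : Type) (r : seq I) (F : I -> 'cV[R]_m) :
  (forall i, volume_invariant (F i)) -> volume_invariant (\sum_(i <- r) F i).
Proof.
move=> IF; elim/big_ind: _ => //; first exact: volume_invariant0.
exact: volume_invariantD.
Qed.

Lemma volume_invariant_translation v : lin U S = fullv -> volume_invariant (U^T *m v).
Proof.
move=> linU t b _ _; rewrite scalemxAr /V vol_polytope_shift// linU memvf//.
Qed.

End Invariance.

(** Invert exp(-x) >= 1 - x and use 1/(1 - x) <= 1 + x + 2 x^2 for |x| <= 1/2. *)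
Lemma expR_le_quadratic (R : realType) (x : R) : `|x| <= 2^-1 ->
  expR x <= 1 + x + 2 * x ^+ 2.
Proof.
move=> /ler_normlP[x1 x2].
have e1 : 1 - x <= expR (- x) by exact: expR_ge1Dx.
have x0 : 0 < 1 - x by lra.
have -> : expR x = (expR (- x))^-1 by rewrite expRN invrK.
apply: (@le_trans _ _ (1 - x)^-1); first by rewrite lef_pV2 ?posrE// expR_gt0.
rewrite -div1r ler_pdivrMr//.
have : 0 <= x ^+ 2 * (1 - 2 * x) by rewrite mulr_ge0 ?sqr_ge0//; lra.
by rewrite expr2; nra.
Qed.

(** * Invariance of the volume under the torus action *)

Section Torus.
Variables (R : realType) (n m : nat) (U : 'M[R]_(n, m)).
Hypotheses (U1 : forall i, dotv (col i U) (col i U) = 1)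
  (Uinj : injective (fun i => col i U)).
Local Notation S := [set: 'I_m]%SET.
Local Notation k := (rg U S).
Local Notation V := (polytope_volume U).
Hypotheses (pdU : positively_dependent U S) (k0 : (0 < k)%N).
Implicit Types (b w : 'cV[R]_m).

Variable a : 'I_m -> R.
Hypothesis a_cv : forall b, positive b ->
  \sum_i a i * cone_volume_vector U S b i 0 = 0.

Definition torus (t : R) b : 'cV[R]_m := \col_i (expR (t * a i) * b i 0).

Lemma torus_positive t b : positive b -> positive (torus t b).
Proof. by move=> b0 i; rewrite mxE mulr_gt0// expR_gt0. Qed.

Lemma torusD s t b : torus (s + t) b = torus s (torus t b).
Proof. by apply/matrixP => i j; rewrite !mxE mulrDl expRD mulrA. Qed.

Lemma torus0 b : torus 0 b = b.
Proof. by apply/matrixP => i j; rewrite mxE mul0r expR0 mul1r ord1. Qed.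

Lemma cone_volume_vector_ge0 b i : positive b -> 0 <= cone_volume_vector U S b i 0.
Proof.
move=> b0; rewrite mxE; case: ifP => // _; apply: mulr_ge0.
  by rewrite divr_ge0// ltW// b0.
by rewrite fine_ge0// vol_ge0.
Qed.

(** With the exponents k t a_i bounded by k |t| [A], the quadratic error in the exponential is at
    most [C * t ^+ 2]. *)
Let A : R := \sum_i `|a i|.
Let C : R := 2 * (k%:R * A) ^+ 2.

Let A0 : 0 <= A. Proof. exact: sumr_ge0. Qed.
Let C0 : 0 <= C. Proof. by rewrite mulr_ge0// sqr_ge0. Qed.

(** [vol_polytope_le] bounds the new volume with weights exp(k t a_i). Expanding them to second
    order, the linear term vanishes by [a_cv] and the constant term is the old volume. *)
Lemma torus_volume_step t b : positive b -> k%:R * `|t| * A <= 2^-1 ->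
  V (torus t b) <= V b * expR (C * t ^+ 2).
Proof.
move=> b0 tA; have t0 := torus_positive t b0.
have := vol_polytope_le U1 pdU k0 b0 t0.
rewrite (polytope_volumeE pdU) lee_fin => /le_trans; apply.
have sumV : \sum_i cone_volume_vector U S b i 0 = V b.
  have := sum_cone_volume_vector U1 Uinj pdU k0 (fun l => ltW (b0 l)).
  rewrite (polytope_volumeE pdU) => -[<-]; apply: eq_bigl => i; by rewrite inE.
apply: (@le_trans _ _ (V b * (1 + C * t ^+ 2))); last first.
  apply: ler_wpM2l; first by rewrite ltW// polytope_volume_gt0.
  exact: expR_ge1Dx.
apply: (@le_trans _ _ (\sum_i (1 + C * t ^+ 2) * cone_volume_vector U S b i 0
    + (k%:R * t) * \sum_i a i * cone_volume_vector U S b i 0)).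
  rewrite mulr_sumr -big_split/=; under eq_bigl do rewrite inE.
  apply: ler_sum => i _; rewrite [X in _ + X]mulrA -mulrDl.
  apply: ler_wpM2r; first exact: cone_volume_vector_ge0.
  rewrite mxE mulfK ?gt_eqF// -expRM_natl.
  have aA : `|a i| <= A by rewrite /A (bigD1 i)//= lerDl sumr_ge0.
  have h : `|k%:R * (t * a i)| <= k%:R * `|t| * A.
    by rewrite !normrM normr_nat mulrA ler_wpM2l// mulr_ge0.
  apply: le_trans (expR_le_quadratic (le_trans h tA)) _.
  have hx : 2 * (k%:R * (t * a i)) ^+ 2 <= C * t ^+ 2.
    have -> : C * t ^+ 2 = 2 * (k%:R * `|t| * A) ^+ 2.
      rewrite /C -(real_normK (num_real t)).
      by move: (k%:R) (`|t|) (A) => x y z; ring.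
    rewrite ler_pM2l// -[leLHS]real_normK ?num_real//.
    by rewrite lerXn2r// nnegrE ?mulr_ge0.
  by move: hx; rewrite mulrA; move: (k%:R * t * a i) (C * _) => x y; lra.
by rewrite a_cv// mulr0 addr0 -mulr_sumr sumV mulrC.
Qed.

Lemma torus_volume_iter j s b : positive b -> k%:R * `|s| * A <= 2^-1 ->
  V (torus (j%:R * s) b) <= V b * expR (j%:R * (C * s ^+ 2)).
Proof.
move=> b0 sA; elim: j => [|j IH]; first by rewrite !mul0r torus0 expR0 mulr1.
rewrite -natr1 !mulrDl !mul1r addrC torusD.
apply: le_trans (torus_volume_step (torus_positive _ b0) sA) _.
by rewrite expRD mulrA ler_pM2r ?expR_gt0.
Qed.

(** Dividing time [s] into N steps leaves the total factor exp(C s^2 / N), which tends to 1. The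
    opposite inequality comes from reversing time. *)
Lemma torus_volume t b : positive b -> V (torus t b) = V b.
Proof.
have le1 s c : positive c -> V (torus s c) <= V c.
  move=> c0; rewrite leNgt; apply/negP => VV.
  have Vc := polytope_volume_gt0 pdU c0.
  pose r := V (torus s c) / V c.
  have r1 : 1 < r by rewrite ltr_pdivlMr// mul1r.
  have lr : 0 < ln r by rewrite ln_gt0.
  (* N > q serves two purposes: the first summand forces C s^2 / N below [ln r], the second makes
     each step short enough for [torus_volume_step]. *)
  pose q := C * s ^+ 2 / ln r + 2 * (k%:R * `|s| * A).
  have q1 : 0 <= C * s ^+ 2 / ln r by rewrite divr_ge0 ?(ltW lr)// mulr_ge0// sqr_ge0.
  have q2 : 0 <= 2 * (k%:R * `|s| * A) by rewrite !mulr_ge0.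
  have := truncnS_gt q; set N := (Num.truncn q).+1 => qN.
  have N0 : 0 < N%:R :> R by rewrite ltr0n.
  have sN : k%:R * `|s / N%:R| * A <= 2^-1.
    rewrite normrM normfV normr_nat mulrA mulrAC ler_pdivrMr//.
    rewrite ler_pdivlMl//; apply: ltW; apply: le_lt_trans qN.
    by rewrite /q lerDr.
  have := torus_volume_iter N c0 sN.
  rewrite mulrCA mulfV ?gt_eqF// mulr1 => h.
  have : r <= expR (N%:R * (C * (s / N%:R) ^+ 2)).
    by rewrite /r ler_pdivrMr// mulrC.
  rewrite -[r in r <= _]lnK ?posrE ?(lt_trans ltr01)// ler_expR.
  have -> : N%:R * (C * (s / N%:R) ^+ 2) = C * s ^+ 2 / N%:R.
    rewrite exprMn expr2 [N%:R^-1 ^+ 2]expr2.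
    by move: (N%:R) N0 (C) => x x0 y; field; rewrite gt_eqF.
  rewrite ler_pdivlMr// leNgt => /negP; apply.
  rewrite [ltRHS]mulrC -ltr_pdivrMr//; apply: le_lt_trans qN.
  by rewrite /q lerDl.
move=> b0; apply/eqP; rewrite eq_le le1//=.
have := le1 (- t) _ (torus_positive t b0).
by rewrite -torusD addNr torus0.
Qed.

Lemma volume_invariant_torus j v : lin U S = fullv ->
  volume_invariant U (torus (- j%:R) (U^T *m v)).
Proof.
move=> linU t b b0 bw0; rewrite -(torus_volume j%:R bw0).
have -> : torus j%:R (b + t *: torus (- j%:R) (U^T *m v)) = torus j%:R b + t *: (U^T *m v).
  apply/matrixP => i l; rewrite ord1 !mxE mulrDr; congr (_ + _).
  by rewrite mulrCA; congr (_ * _); rewrite mulrA -expRD mulNr subrr expR0 mul1r.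
by rewrite scalemxAr /polytope_volume vol_polytope_shift ?linU ?memvf// -/(V _) torus_volume.
Qed.

(** Interpolation at the nodes exp(-a_i): the polynomial [p] vanishes at all of them except those
    equal to exp(-al), so its coefficients combine the directions exp(-j a_i) <u_i, v> into a
    multiple of the restriction to the level [al]. *)
Lemma volume_invariant_level (v : 'cV[R]_n) al : lin U S = fullv ->
  volume_invariant U (\col_i (if a i == al then dotv (col i U) v else 0)).
Proof.
move=> linU; pose p : {poly R} := \prod_(i | a i != al) ('X - (expR (- a i))%:P).
pose q := p.[expR (- al)].
have q0 : q != 0.
  rewrite /q horner_prod; apply/prodf_neq0 => i ai; rewrite hornerXsubC subr_eq0.
  by apply: contra ai => /eqP /expR_inj /oppr_inj ->.
have pE i : p.[expR (- a i)] = if a i == al then q else 0.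
  case: eqVneq => [->//|ai]; rewrite /p horner_prod (bigD1 i)//= hornerXsubC subrr.
  by rewrite mul0r.
have -> : \col_i (if a i == al then dotv (col i U) v else 0) =
    q^-1 *: \sum_(j < size p) p`_j *: torus (- j%:R) (U^T *m v).
  apply/matrixP => i l; rewrite ord1 !mxE summxE.
  transitivity (q^-1 * (p.[expR (- a i)] * dotv (col i U) v)).
    by rewrite pE; case: ifP => _; rewrite ?mul0r ?mulr0// mulKf.
  congr (_ * _); rewrite horner_coef mulr_suml; apply: eq_bigr => j _.
  rewrite !mxE -mulmxE_dotv !mxE [RHS]mulrA; congr (_ * _ * _).
  by rewrite -expRM_natl mulrN mulNr.
apply: volume_invariantZ; apply: volume_invariant_sum => j.
by apply: volume_invariantZ; exact: volume_invariant_torus.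
Qed.

End Torus.

Lemma fredholm_alternative (F : fieldType) m p (G : 'M[F]_(m, p)) (e : 'cV[F]_m) :
  (forall d : 'cV[F]_m, G^T *m d = 0 -> e^T *m d = 0) -> exists y : 'cV[F]_p, G *m y = e.
Proof.
move=> He; have : (e^T <= G^T)%MS.
  rewrite submxE; apply/eqP/matrixP => i j.
  have : e^T *m col j (cokermx G^T) = 0.
    by apply: He; rewrite colE mulmxA mulmx_coker mul0mx.
  by rewrite colE mulmxA -colE => /matrixP/(_ i 0); rewrite !mxE.
by move=> /submxP[D /(congr1 trmx)]; rewrite trmxK trmx_mul trmxK => eE; exists D^T.
Qed.

(** The Caratheodory step: move from [c] along [- d] until a first coordinate reaches zero. Changing
    the sign of [d] if necessary provides a positive entry, and the minimal ratio is attained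
    there. *)
Lemma conic_reduction (R : realFieldType) (I : finType) (c d : I -> R) :
  (forall i, 0 <= c i) -> (forall i, c i = 0 -> d i = 0) -> (exists i, d i != 0) ->
  exists la, (forall i, 0 <= c i - la * d i) /\ exists2 i, c i != 0 & c i - la * d i = 0.
Proof.
move=> c0 cd [i0 di0].
wlog {i0 di0} [i0 di0] : d cd / exists i, 0 < d i.
  move=> H; have [di|di] := ltP 0 (d i0); first by apply: H => //; exists i0.
  have [||la [h1 [i ci h2]]] := H (fun i => - d i).
  - by move=> i /cd ->; rewrite oppr0.
  - by exists i0; rewrite oppr_gt0 lt_neqAle di0.
  exists (- la); split; first by move=> l; rewrite mulNr -mulrN.
  by exists i => //; rewrite mulNr -mulrN.
case: (@arg_minP _ _ _ i0 (fun i => 0 < d i) (fun i => c i / d i) di0) => i di imin.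
exists (c i / d i); split; last first.
  exists i; last by rewrite divfK ?subrr// gt_eqF.
  by apply/eqP => /cd di'; rewrite di' ltxx in di.
move=> j; rewrite subr_ge0; have [dj|dj] := ltP 0 (d j).
  by rewrite -ler_pdivlMr// imin.
apply: le_trans (c0 j); rewrite mulr_ge0_le0// divr_ge0// ltW//.
Qed.

(** * Level sets of a functional vanishing on cone-volume vectors *)

Section Levels.
Variables (R : realType) (n m : nat) (U : 'M[R]_(n, m)).
Hypotheses (U1 : forall i, dotv (col i U) (col i U) = 1)
  (Uinj : injective (fun i => col i U)).
Local Notation S := [set: 'I_m]%SET.
Local Notation k := (rg U S).
Local Notation V := (polytope_volume U).
Hypotheses (pdU : positively_dependent U S) (k0 : (0 < k)%N) (linU : lin U S = fullv).
Implicit Types (b w : 'cV[R]_m).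
Variable a : 'I_m -> R.
Hypothesis a_cv : forall b, positive b ->
  \sum_i a i * cone_volume_vector U S b i 0 = 0.

(** Along [be + s *: w] the entries on [C] equal [s] while the others stay between [M] and [3 * M].
    As [s] tends to 0 the volume would tend to 0, yet invariance keeps it at a positive value. *)
Lemma volume_invariant_thin w (C : {set 'I_m}) : volume_invariant U w ->
  positively_dependent U C -> C != finset.set0 -> (forall i, i \in C -> w i 0 = 1) -> False.
Proof.
move=> Iw pdC C0 wC; pose M := 1 + \sum_i `|w i 0|.
have wM i : `|w i 0| <= M.
  by rewrite /M (bigD1 i)//= addrCA lerDl addr_ge0// sumr_ge0.
have M1 : 1 <= M by rewrite lerDl sumr_ge0.
pose be : 'cV[R]_m := \col_i (if i \in C then 0 else 2 * M).
have bs s : 0 < s <= 1 -> positive (be + s *: w).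
  move=> /andP[s0 s1] i; rewrite !mxE; case: ifP => iC.
    by rewrite wC// mulr1 add0r.
  have /ler_normlP[h1 h2] := wM i; move: h1 h2 M1; move: (w i 0) (M) => y z h1 h2 z1; nra.
have bM s i : 0 < s <= 1 -> (be + s *: w) i 0 <= 3 * M.
  move=> /andP[s0 s1]; rewrite !mxE; case: ifP => iC.
    by rewrite wC// mulr1 add0r; lra.
  have /ler_normlP[h1 h2] := wM i; move: h1 h2 M1; move: (w i 0) (M) => y z h1 h2 z1; nra.
have b1 : positive (be + 1 *: w) by apply: bs; rewrite ltr01 lexx.
have [d d0 dV] := thin_polytope_volume U1 pdU (3 * M) pdC C0 (polytope_volume_gt0 pdU b1).
pose s := Num.min d 1.
have s0 : 0 < s by rewrite lt_min d0 ltr01.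
have s1 : s <= 1 by rewrite ge_min lexx orbT.
have s01 : 0 < s <= 1 by rewrite s0 s1.
have E : be + 1 *: w = be + s *: w + (1 - s) *: w by rewrite -addrA -scalerDl [s + _]addrC subrK.
have VE : V (be + 1 *: w) = V (be + s *: w).
  by rewrite {1}E; apply: Iw; [exact: bs|rewrite -E].
have : V (be + s *: w) < V (be + 1 *: w).
  apply: dV => [i iC|i]; last exact: bM.
  by rewrite !mxE iC wC// mulr1 add0r ge_min lexx.
by rewrite VE ltxx.
Qed.

Lemma level_dependency al (c : 'I_m -> R) : (forall i, 0 <= c i) ->
  \sum_i c i *: col i U = 0 -> \sum_(i | a i == al) c i *: col i U = 0.
Proof.
have [N] := ubnP #|[pred i | c i != 0]|; elim: N c => // N IH c cN c0 cdep.
apply/eqP/negP => /negP z0.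
(* Minimality of the support of [c] makes its elements in each of the two
   parts linearly independent. *)
have cfree (d : 'I_m -> R) : (forall i, c i = 0 -> d i = 0) ->
    \sum_(i | a i == al) d i *: col i U = 0 ->
    \sum_(i | a i != al) d i *: col i U = 0 -> forall i, d i = 0.
  move=> cd dT dT' i; apply/eqP/negP => /negP di.
  (* [c - la * d] is a nonnegative relation of smaller support with the same sum over the level as
     [c], so the induction hypothesis contradicts [z0]. *)
  have [la [h1 [j cj h2]]] := conic_reduction c0 cd (ex_intro _ i di).
  have suml (Q : pred 'I_m) : \sum_(i | Q i) (c i - la * d i) *: col i U =
      \sum_(i | Q i) c i *: col i U - la *: \sum_(i | Q i) d i *: col i U.
    rewrite scaler_sumr -sumrB; apply: eq_bigr => l _.
    by rewrite scalerBl scalerA.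
  have := IH (fun i => c i - la * d i); rewrite (suml (fun i => a i == al)) dT scaler0 subr0.
  move=> H; move/eqP: z0; apply; apply: H => //.
    apply: (@leq_trans #|[pred i | c i != 0]|); last by rewrite -ltnS.
    apply: proper_card; apply/properP; split.
      apply/fintype.subsetP => l; rewrite !inE; apply: contra => /eqP cl.
      by rewrite cl cd// mulr0 subr0.
    by exists j; rewrite !inE ?cj// h2 eqxx.
  rewrite (suml xpredT) cdep sub0r; apply/eqP; rewrite oppr_eq0; apply/eqP.
  by rewrite (bigID (fun i => a i == al))/= dT dT' addr0 scaler0.
pose C : {set 'I_m} := finset (fun i => c i != 0).
(* The system asks for [x] and [x'] with <u_i, x> = 1 on the part of the support of [c] in the level
   and <u_i, x'> = 1 on the rest. Two copies of the space keep the unknowns apart, and [cfree] makes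
   the system solvable. *)
pose G : 'M[R]_(m, n + n) := \matrix_(i, j) ((c i != 0)%:R *
  (if a i == al then row_mx (col i U)^T 0 else row_mx 0 (col i U)^T) 0 j).
pose e : 'cV[R]_m := \col_i (c i != 0)%:R.
have [y yE] : exists y, G *m y = e.
  apply: fredholm_alternative => d Gd.
  pose d' i := (c i != 0)%:R * d i 0.
  have d'0 : forall i, d' i = 0.
    apply: cfree.
    - by move=> i ci; rewrite /d' ci eqxx mul0r.
    - apply/matrixP => i j; rewrite ord1 mxE.
      have := congr1 (fun M : 'cV[R]_(n + n) => M (lshift n i) 0) Gd; rewrite !mxE => <-.
      rewrite summxE [RHS](bigID (fun i => a i == al))/= [X in _ = _ + X]big1 ?addr0.
        by apply: eq_bigr => l al'; rewrite !mxE al' row_mxEl !mxE /d' mulrAC.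
      by move=> l /negbTE al'; rewrite !mxE al' row_mxEl !mxE mulr0 mul0r.
    - apply/matrixP => i j; rewrite ord1 mxE.
      have := congr1 (fun M : 'cV[R]_(n + n) => M (rshift n i) 0) Gd; rewrite !mxE => <-.
      rewrite summxE [RHS](bigID (fun i => a i == al))/= [X in _ = X + _]big1 ?add0r.
        by apply: eq_bigr => l /negbTE al'; rewrite !mxE al' row_mxEr !mxE /d' mulrAC.
      by move=> l al'; rewrite !mxE al' row_mxEr !mxE mulr0 mul0r.
  apply/matrixP => i j; rewrite !mxE big1// => l _; rewrite !mxE ord1; exact: d'0.
pose x := usubmx y; pose x' := dsubmx y.
(* Translating by [x'] and correcting by [x - x'] on the level makes [w] equal to 1 on the whole
   support, while both terms are invariant directions. *)
pose w : 'cV[R]_m := U^T *m x' + \col_i (if a i == al then dotv (col i U) (x - x') else 0).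
have Iw : volume_invariant U w.
  apply: volume_invariantD; first by apply: volume_invariant_translation.
  exact: (volume_invariant_level U1 Uinj pdU k0 a_cv).
apply: (@volume_invariant_thin w C) => //.
- exists c; split; first by move=> i; rewrite inE lt_neqAle c0 eq_sym andbT.
  rewrite -[RHS]cdep [RHS](bigID (fun i => c i != 0))/= [X in _ = _ + X]big1 ?addr0.
    by apply: eq_bigl => i; rewrite inE.
  by move=> i; rewrite negbK => /eqP ->; rewrite scale0r.
- apply: contra z0 => /eqP C0; apply/eqP/big1 => i _.
  have : i \notin C by rewrite C0 inE.
  by rewrite inE negbK => /eqP ->; rewrite scale0r.
move=> i; rewrite inE => ci.
have : (G *m y) i 0 = 1 by rewrite yE mxE ci.
rewrite [LHS]mxE.
have -> : (\sum_j G i j * y j 0) = if a i == al then dotv (col i U) x else dotv (col i U) x'.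
  rewrite big_split_ord /=; case: ifP => ai.
    rewrite [X in _ + X]big1 ?addr0.
      by apply: eq_bigr => j _; rewrite !mxE ai ci mul1r row_mxEl !mxE.
    by move=> j _; rewrite !mxE ai row_mxEr !mxE mulr0 mul0r.
  rewrite [X in X + _]big1 ?add0r.
    by apply: eq_bigr => j _; rewrite !mxE ai ci mul1r row_mxEr !mxE.
  by move=> j _; rewrite !mxE ai row_mxEl !mxE mulr0 mul0r.
move=> <-; rewrite [LHS]mxE mulmxE_dotv [X in _ + X]mxE.
case: ifP => _; last by rewrite addr0.
by rewrite dotvBr addrC subrK.
Qed.

(** If [a] took two values on [T], its level set [T1] in [T] would belong to
    [splitting_flats U T]. *)
Lemma constant_on_irreducible T : irreducible U T -> positively_dependent U T ->
  forall i j, i \in T -> j \in T -> a i = a j.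
Proof.
move=> irrT pdT i j iT jT; apply/eqP; rewrite eq_sym; apply/negP => /negP aij.
pose T1 : {set 'I_m} := [set l in T | a l == a i]%SET.
have T1T : T1 \subset T by apply/fintype.subsetP => l; rewrite inE => /andP[].
have iT1 : i \in T1 by rewrite inE iT eqxx.
have jT2 : j \in T :\: T1 by rewrite !inE jT aij.
have TT : (lin U T1 :&: lin U (T :\: T1) = 0)%VS.
  apply/eqP; rewrite -subv0; apply/subvP => z; rewrite memv_cap memv0.
  move=> /andP[/lin_combination[d zd] /lin_combination[e ze]].
  have [c [cp cdep]] := pdT.
  (* The two expressions of [z] form a relation [f] with arbitrary signs. Adding [la] times the
     positive relation [c] makes it nonnegative, since [la] dominates every |f_l| / c_l; the
     dependency on the level then holds for the sum and for [c], hence for [f]. *)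
  pose f l := if l \in T1 then d l else if l \in T then - e l else 0.
  pose la := \sum_(l in T) `|f l| / c l.
  pose g t l := if l \in T then t * c l + f l else 0.
  pose cc l := if l \in T then c l else 0.
  have level (h : 'I_m -> R) : (forall l, 0 <= h l) -> (forall l, l \notin T -> h l = 0) ->
      \sum_(l in T) h l *: col l U = 0 -> \sum_(l in T1) h l *: col l U = 0.
    move=> h0 hT hdep.
    have := @level_dependency (a i) h h0; rewrite (bigID (mem T))/= hdep add0r.
    rewrite big1 => [/(_ erefl)|l lT]; last by rewrite hT// scale0r.
    rewrite (bigID (mem T))/= [X in _ + X]big1 ?addr0 => [|l /andP[_ lT]].
      by move=> h1; rewrite -[RHS]h1; apply: eq_bigl => l; rewrite inE andbC.
    by rewrite hT// scale0r.
  have c1 : \sum_(l in T1) cc l *: col l U = 0.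
    apply: level => [l|l /negbTE lT|].
    - by rewrite /cc; case: ifP => // /cp /ltW.
    - by rewrite /cc lT.
    - by rewrite -[RHS]cdep; apply: eq_bigr => l lT; rewrite /cc lT.
  have g1 : \sum_(l in T1) g la l *: col l U = 0.
    apply: level => [l|l /negbTE lT|].
    - rewrite /g; case: ifP => // lT.
      have : `|f l| / c l <= la.
        rewrite /la (bigD1 l)//= lerDl sumr_ge0// => q /andP[qT _].
        by rewrite divr_ge0// ltW// cp.
      rewrite ler_pdivrMr ?cp// => h; have := ler_norm (- f l); rewrite normrN.
      by move=> h'; rewrite -lerBlDr sub0r; exact: le_trans h' h.
    - by rewrite /g lT.
    - rewrite (eq_bigr (fun l => la *: (c l *: col l U) + f l *: col l U)); last first.
        by move=> l lT; rewrite /g lT scalerDl scalerA.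
      rewrite big_split/= -scaler_sumr cdep scaler0 add0r.
      rewrite (big_setID T1)/= (finset.setIidPr T1T).
      rewrite (eq_bigr (fun l => d l *: col l U)); last by move=> l lT1; rewrite /f lT1.
      rewrite -zd (eq_bigr (fun l => - (e l *: col l U))); last first.
        by move=> l; rewrite inE => /andP[/negbTE lT1 lT]; rewrite /f lT1 lT scaleNr.
      by rewrite sumrN -ze subrr.
  rewrite zd; apply/eqP; rewrite -[RHS]g1.
  rewrite [RHS](eq_bigr (fun l => la *: (cc l *: col l U) + d l *: col l U)); last first.
    move=> l lT1; have lT := fintype.subsetP T1T l lT1.
    by rewrite /g /cc lT /f lT1 scalerDl scalerA.
  by rewrite big_split/= -scaler_sumr c1 scaler0 add0r.
have TE : T = T1 :|: (T :\: T1) by rewrite -{1}(finset.setIidPr T1T) finset.setID.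
have rT : rg U T = (rg U T1 + rg U (T :\: T1))%N.
  by rewrite {1}TE /rg lin_setU dimv_disjoint_sum.
have r1 := rg_gt0 U1 iT1; have r2 := rg_gt0 U1 jT2.
suff : T1 \in splitting_flats U T by rewrite irrT inE.
rewrite !inE T1T TT eqxx andbT /= r1 rT.
rewrite -addnBA// leq_addr/=; apply/eqP/setP => l; rewrite inE.
apply/andP/idP => [[lT lL]|lT1]; last by rewrite (fintype.subsetP T1T l lT1) mem_lin.
(* A column of [T :\: T1] in the span of [T1] would be a nonzero vector of the trivial
   intersection. *)
apply: contraT => lT1.
have : col l U \in (lin U T1 :&: lin U (T :\: T1))%VS.
  by rewrite memv_cap lL mem_lin// inE lT1.
by rewrite TT memv0 -dotvv_eq0 U1 oner_eq0.
Qed.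

End Levels.

(** * Dimension of the cone-volume set *)

Section Dimension.
Variable R : realType.

Lemma dim_column m : \dim (fullv : {vspace 'cV[R]_m}) = m.
Proof. by rewrite dimvf dim_matrix; exact: muln1. Qed.

Definition block_sums m (P : {set {set 'I_m}}) : 'M[R]_(#|P|, m) :=
  \matrix_(q, i) (i \in (enum_val q : {set 'I_m}))%:R.

Definition block_kernel m (P : {set {set 'I_m}}) : {vspace 'cV[R]_m} :=
  lker (linfun (mulmx (block_sums P) : 'cV[R]_m -> 'cV[R]_#|P|)).

Lemma block_sumsE m (P : {set {set 'I_m}}) (v : 'cV[R]_m) q :
  (block_sums P *m v) q 0 = \sum_(i in (enum_val q : {set 'I_m})) v i 0.
Proof.
rewrite mxE [RHS]big_mkcond; apply: eq_bigr => i _; rewrite mxE.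
by case: ifP => _; rewrite ?mul1r ?mul0r.
Qed.

Lemma mem_block_kernel m (P : {set {set 'I_m}}) (v : 'cV[R]_m) :
  reflect (forall T : {set 'I_m}, T \in P -> \sum_(i in T) v i 0 = 0)
    (v \in block_kernel P).
Proof.
rewrite memv_ker lfunE /=; apply: (iffP eqP) => [h T TP|h].
  by rewrite -(enum_rankK_in TP TP) -block_sumsE h mxE.
by apply/matrixP => q j; rewrite ord1 block_sumsE h ?mxE//; exact: enum_valP.
Qed.

(** Rank-nullity: the map of block sums is onto because the blocks are nonempty and disjoint. *)
Lemma dim_block_kernel m (P : {set {set 'I_m}}) : finset.trivIset P ->
  finset.set0 \notin P -> \dim (block_kernel P) = (m - #|P|)%N.
Proof.
move=> Ptriv P0; pose f := linfun (mulmx (block_sums P) : 'cV[R]_m -> 'cV[R]_#|P|).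
have e := limg_ker_dim f fullv; rewrite capfv dim_column in e.
suff limgE : limg f = fullv.
  rewrite limgE dim_column in e; apply/esym.
  transitivity (\dim (lker f) + #|P| - #|P|)%N; last by rewrite addnK.
  by congr subn; exact/esym.
apply/eqP; rewrite eqEsubv subvf; apply/subvP => y _.
have ne (q : 'I_#|P|) : exists i, i \in (enum_val q : {set 'I_m}).
  have qP : enum_val q \in P := enum_valP q.
  by apply/set0Pn; apply: contraNneq P0 => <-.
(* One representative index per block; by disjointness the unit vectors at these indices map to the
   standard basis. *)
have [r rq] := fin_all_exists ne.
suff <- : f (\sum_q y q 0 *: delta_mx (r q) 0) = y by apply: memv_img; exact: memvf.
rewrite lfunE /=; apply/matrixP => q j; rewrite ord1 block_sumsE.
rewrite (eq_bigr (fun i => \sum_q' (y q' 0 *: delta_mx (r q') 0 : 'cV[R]_m) i 0)); last first.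
  by move=> i _; exact: summxE.
rewrite exchange_big /= (bigD1 q)//= [X in _ + X]big1 ?addr0.
  rewrite (bigD1 (r q))//= !mxE !eqxx mulr1 big1 ?addr0// => i /andP[_ ir].
  by rewrite !mxE (negbTE ir) mulr0.
move=> q' qq'; apply: big1 => i iq; rewrite !mxE andbT.
case: eqVneq => [ir|_]; last by rewrite mulr0.
exfalso; have := Ptriv => /finset.trivIsetP.
move=> /(_ (enum_val q) (enum_val q') (enum_valP q) (enum_valP q')).
rewrite (inj_eq enum_val_inj) eq_sym qq' => /(_ isT) /pred0P /(_ i) /=.
by rewrite iq ir rq.
Qed.

(* A maximal linearly independent family of differences spans the direction
   of the affine hull. *)
Lemma affine_hull_span m (A : set 'cV[R]_m) x0 : A x0 ->
  exists L : {vspace 'cV[R]_m}, (forall x, A x -> x - x0 \in L) /\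
    (forall v, v \in L -> affine_hull A (x0 + v)).
Proof.
move=> Ax0; pose Q d := `[< exists X : seq 'cV[R]_m,
  (forall v, v \in X -> A (x0 + v)) /\ \dim <<X>>%VS = d >].
have exQ : exists d, Q d by exists 0%N; apply/asboolP; exists [::]; rewrite span_nil dimv0.
have leQ d : Q d -> (d <= m)%N.
  by move=> /asboolP[X [_ <-]]; rewrite -[leqRHS]dim_column dimvS// subvf.
case: (ex_maxnP exQ leQ) => d /asboolP[X [XA Xd]] dmax.
exists <<X>>%VS; split=> [x Ax|v].
  apply: contraT => xs; have : Q (\dim <<x - x0 :: X>>%VS).
    apply/asboolP; exists (x - x0 :: X); split => // v; rewrite inE => /orP[/eqP ->|/XA//].
    by rewrite addrC subrK.
  move=> /dmax; rewrite -Xd span_cons leqNgt => /negP; case.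
  rewrite ltn_neqAle dimvS ?addvSr// andbT; apply/negP => /eqP e.
  have : (<<X>> == <[x - x0]> + <<X>>)%VS by rewrite eqEdim addvSr e leqnn.
  move=> /eqP h; move: xs; rewrite h => /negP; apply.
  exact: (subvP (addvSl _ _) _ (memv_line _)).
move=> /(@coord_span _ _ _ (in_tuple X)) /= vE.
pose c i := coord (in_tuple X) i v.
(* Index 0 stands for [x0], with the weight that brings the total to one; the other indices stand
   for the translated members of [X]. *)
exists (size X).+1, (fun i => oapp (fun j : 'I_(size X) => x0 + X`_j) x0 (unlift ord0 i)),
  (fun i => oapp c (1 - \sum_j c j) (unlift ord0 i)); split.
- move=> i; case: unliftP => [j _|_] //=; apply: XA; exact: mem_nth.
- rewrite big_ord_recl unlift_none /=; under [X in _ + X]eq_bigr do rewrite liftK /=.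
  by rewrite subrK.
rewrite big_ord_recl unlift_none /=.
under [X in _ = _ + X]eq_bigr do rewrite liftK /= scalerDr.
rewrite big_split /= -scaler_suml addrA scalerBl scale1r subrK; congr (_ + _); exact: vE.
Qed.

Lemma affine_hull_ind m (A : set 'cV[R]_m) x0 (L : {vspace 'cV[R]_m}) :
  (forall x, A x -> x - x0 \in L) -> affine_hull A `<=` [set x0 + v | v in [set v | v \in L]].
Proof.
move=> AL y [k [x [c [xA c1 ->]]]]; exists (\sum_i c i *: (x i - x0)).
  by apply: memv_suml => i _; rewrite memvZ// AL.
under eq_bigr do rewrite scalerBr.
by rewrite sumrB -scaler_suml c1 scale1r addrC subrK.
Qed.

(** The difference between a vector of [H] and its orthogonal projection to [L] is orthogonal to
    [L], hence zero. *)
Lemma orthogonal_in_supspace m (L H : {vspace 'cV[R]_m}) : (L <= H)%VS ->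
  (forall a, a \in H -> (forall v, v \in L -> dotv a v = 0) -> a = 0) -> L = H.
Proof.
move=> LH Ha; apply/eqP; rewrite eqEsubv LH; apply/subvP => h hH.
have [Q oQ] := onb_exists (erefl (\dim L)).
have pL : Q *m (Q^T *m h) \in L by exact: onb_mem.
have : h - Q *m (Q^T *m h) = 0.
  apply: Ha; first by rewrite rpredB// (subvP LH).
  move=> v vL; rewrite dotvC dotvBr dotv_mulmx dotvC.
  have -> : dotv (Q^T *m v) (Q^T *m h) = dotv v h.
    by rewrite dotvC -dotv_mulmx (onb_proj oQ vL) dotvC.
  by rewrite dotvC subrr.
by move/eqP; rewrite subr_eq0 => /eqP ->.
Qed.

End Dimension.

(** * Consequences of membership in U(n, m) *)

Section InUnm.
Variables (R : realType) (n m : nat) (U : 'M[R]_(n, m)).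
Hypotheses (hn : (0 < n)%N) (hU : in_Unm U).

Lemma in_Unm_unit i : dotv (col i U) (col i U) = 1.
Proof.
have [/(_ i) h _ _] := hU; have := sqr_sqrtr (dotvv_ge0 (col i U)).
by rewrite -/(enorm _) h expr1n.
Qed.

Lemma in_Unm_lin : lin U [set: 'I_m]%SET = fullv.
Proof.
have [_ _ hpos] := hU; apply/eqP; rewrite eqEsubv subvf; apply/subvP => x _.
have : pos_hull U [set: 'I_m]%SET x by rewrite hpos.
by move=> [c [_ ->]]; apply: memv_suml => i iU; rewrite memvZ// mem_lin.
Qed.

Lemma in_Unm_rg : rg U [set: 'I_m]%SET = n.
Proof. by rewrite /rg in_Unm_lin dim_column. Qed.

(** Minus the sum of all columns is a nonnegative combination of them; adding the sum back gives a
    relation with coefficients at least 1. *)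
Lemma in_Unm_positively_dependent : positively_dependent U [set: 'I_m]%SET.
Proof.
have [_ _ hpos] := hU.
have : pos_hull U [set: 'I_m]%SET (- \sum_(i in [set: 'I_m]%SET) col i U) by rewrite hpos.
move=> [c [c0 cE]]; exists (fun i => 1 + c i); split.
  by move=> i _; rewrite ltr_pwDl.
under eq_bigr do rewrite scalerDl scale1r.
by rewrite big_split /= -cE subrr.
Qed.

Lemma in_Unm_neq0 : [set: 'I_m]%SET != finset.set0.
Proof.
by apply: contraTneq hn => U0; rewrite -in_Unm_rg U0 rg_set0.
Qed.

End InUnm.

Unset Implicit Arguments.

(* The Minkowski sum below is direct: [Ccv U S] lies in the coordinate subspace
   of the indices in S, and the members of P are pairwise disjoint. *)
Theorem proposition2p7 (R : realType) (n m : nat) (U : 'M[R]_(n, m))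
    (P : {set {set 'I_m}}) (hn : (0 < n)%N) (hU : in_Unm U)
    (hP : irreducible_partition U P) :
  Ccv U [set: 'I_m]%SET =
    minkowski_sum P (fun S => scale_set ((rg U S)%:R / n%:R) (Ccv U S)) /\
  has_dim (Ccv U [set: 'I_m]%SET) (m - #|P|).
Proof.
have U1 := in_Unm_unit hU; have [_ Uinj _] := hU; have linU := in_Unm_lin hU.
have rgU := in_Unm_rg hU; have pdU := in_Unm_positively_dependent hU.
have k0 : (0 < rg U [set: 'I_m]%SET)%N by rewrite rgU.
have [Preach Pirr] := hP.
have [/and3P[/eqP Pcov Ptriv P0] Ppd CE] :=
  reachable_Ccv U1 rgU pdU (in_Unm_neq0 hn hU) Preach.
split=> //.
(* The summands of the other blocks vanish on [T], and the entries of a member of [Ccv U T] add up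
   to the volume, which is one. These equations bound the dimension from above. *)
have blocks x : Ccv U [set: 'I_m]%SET x -> forall T : {set 'I_m}, T \in P ->
    \sum_(i in T) x i 0 = (rg U T)%:R / n%:R.
  rewrite CE => -[y [yC ->]] T TP.
  under eq_bigr do rewrite summxE.
  rewrite exchange_big/= (bigD1 T)//= [X in _ + X]big1 ?addr0.
    have [_ [b [b0 bV] <-] <-] := yC T TP.
    under eq_bigr do rewrite mxE.
    rewrite -mulr_sumr.
    have rT : (0 < rg U T)%N.
      have /set0Pn[i iT] : T != finset.set0 by apply: contraNneq P0 => <-.
      exact: rg_gt0 iT.
    have := sum_cone_volume_vector U1 Uinj (Ppd T TP) rT b0; rewrite bV => -[->].
    by rewrite mulr1.
  move=> T' /andP[TP' TT']; apply: big1 => i iT.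
  have [_ [b _ <-] <-] := yC T' TP'; rewrite !mxE ifN ?mulr0//.
  have /finset.trivIsetP/(_ T T' TP TP') := Ptriv; rewrite eq_sym TT' => /(_ isT).
  by move=> /pred0P/(_ i)/=; rewrite iT /= => ->.
have normalized b : positive b -> Ccv U [set: 'I_m]%SET
    ((polytope_volume U b)^-1 *: cone_volume_vector U [set: 'I_m]%SET b).
  move=> b0; apply: Ccv_normalize => //.
  - by move=> i; rewrite ltW.
  - exact: polytope_volume_gt0.
  - exact: polytope_volumeE.
have [x0 Cx0] : exists x, Ccv U [set: 'I_m]%SET x.
  by eexists; apply: (normalized (const_mx 1)) => i; rewrite mxE.
have [L [CL LC]] := affine_hull_span Cx0.
(* One inclusion is the block equations. For the other, a vector [a] of the kernel orthogonal to all
   differences of members of [Ccv] is shown to vanish. *)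
have LE : L = block_kernel R P.
  apply: orthogonal_in_supspace.
    apply/subvP => v /LC; have CH x : Ccv U [set: 'I_m]%SET x -> x - x0 \in block_kernel R P.
      move=> Cx; apply/mem_block_kernel => T TP; under eq_bigr do rewrite !mxE.
      by rewrite sumrB !blocks// subrr.
    by move=> /(affine_hull_ind CH)[w wH] /addrI <-.
  move=> a /mem_block_kernel aH aL.
  have acv x : Ccv U [set: 'I_m]%SET x -> dotv a x = dotv a x0.
    by move=> /CL /aL; rewrite dotvBr => /eqP; rewrite subr_eq0 => /eqP.
  (* The entries of a member of [Ccv] sum to one, so subtracting the constant value of [a] from
     every coordinate turns constancy on [Ccv] into vanishing. *)
  pose a' i := a i 0 - dotv a x0.
  have a'0 b : positive b -> \sum_i a' i * cone_volume_vector U [set: 'I_m]%SET b i 0 = 0.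
    move=> b0; have V0 := polytope_volume_gt0 pdU b0.
    have := acv _ (normalized b b0); rewrite dotvZr => h.
    have sumV : \sum_i cone_volume_vector U [set: 'I_m]%SET b i 0 = polytope_volume U b.
      have := sum_cone_volume_vector U1 Uinj pdU k0 (fun l => ltW (b0 l)).
      by rewrite (polytope_volumeE pdU) => -[<-]; apply: eq_bigl => i; rewrite inE.
    under eq_bigr do rewrite mulrBl.
    rewrite sumrB -mulr_sumr sumV -h mulrAC mulVf ?gt_eqF// mul1r.
    exact: subrr.
  have aconst (T : {set 'I_m}) i j : T \in P -> i \in T -> j \in T -> a i 0 = a j 0.
    move=> TP iT jT.
    have := constant_on_irreducible U1 Uinj pdU k0 linU a'0 (Pirr T TP)
      (Ppd T TP) iT jT.
    by move=> /addIr.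
  (* On each block [a] is constant and sums to zero, so every block contributes nothing to its
     squared norm. *)
  apply/eqP; rewrite -dotvv_eq0 /dotv.
  rewrite (eq_bigl (fun i => i \in [set: 'I_m]%SET)) => [|i]; last by rewrite inE.
  rewrite -Pcov finset.big_trivIset//= big1// => T TP.
  have /set0Pn[i iT] : T != finset.set0 by apply: contraNneq P0 => <-.
  rewrite (eq_bigr (fun j => a i 0 * a j 0)) => [|j jT]; last by rewrite (aconst T j i).
  by rewrite -mulr_sumr aH// mulr0.
exists x0, L; split; first by rewrite LE dim_block_kernel.
apply/seteqP; split; first exact: affine_hull_ind.
by move=> _ [v vL <-]; exact: LC.
Qed.
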